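(* Suppose that $\psi_g(p)$ is finite on some interval $2\le p\le b$, $b\le\infty$, and that $$\int_0^1\exp\left(v_{*,\overline{\psi}}\big(H(T,\gamma_\psi,\epsilon)\big)\right)d\epsilon<\infty,\qquad \psi=\psi_g .$$ Then the centered Gaussian field $X(t)$ is almost surely continuous with respect to the distance $\gamma_\psi$, and for every $u>0$ $$\lim_{n\to\infty}\mathbf P\left(\sqrt n\,\sup_{t\in T}|I_n(t)-I(t)|>u\right)=\mathbf P\left(\sup_{t\in T}|X(t)|>u\right).$$
   Context: Setting. $(X,\Sigma,\nu)$ is a probability space, $T$ a parameter set carrying a probability measure, and $g:T\times X\to\mathbb R$ is such that $g(t,\cdot)\in L_2(X,\nu)$ for every $t\in T$. The function $Q(x)=\operatorname{ess\,sup}_{t\in T}|g(t,x)|$ is assumed finite $\nu$-a.e. Put $I(t)=\int_X g(t,x)\,\nu(dx)$ and $I_n(t)=n^{-1}\sum_{i=1}^n g(t,\eta_i)$, where $\eta,\eta_1,\eta_2,\dots$ are i.i.d. with distribution $\nu$. Let $g^0(t,x)=g(t,x)-I(t)$. All random fields are taken separable. The field $X(t)$, $t\in T$, is the separable centered Gaussian field with covariance $\mathbf E X(t)X(s)=\int_X g(t,x)g(s,x)\,\nu(dx)-I(t)I(s)$. For a random variable $\xi$, $|\xi|_p=(\mathbf E|\xi|^p)^{1/p}$. Define $\psi_g(p)=\sup_{t\in T}|g^0(t,\eta)|_p$, with support the set of $p$ where it is finite. For a function $\psi$, $\|\xi\|G(\psi)=\sup_{p\in\operatorname{supp}\psi}|\xi|_p/\psi(p)$,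 and $\gamma_\psi(t,s)=\|g^0(t,\eta)-g^0(s,\eta)\|G(\psi_g)$. For a function $\psi$ put $\overline\psi(p)=C_0^{-1}\,p\,\psi(p)/\log p$ for $p\ge2$ in the support of $\psi$, and $\overline\psi(p)=+\infty$ for all other $p$; here $C_0\approx1.77638\ldots$ is an absolute constant. For a function $\psi$ put $v_{*,\psi}(x)=\inf_{y\in(0,1)}\left(xy+\log\psi(1/y)\right)$. $H(T,\rho,\epsilon)$ is the metric entropy: the logarithm of the minimal number of closed $\rho$-balls of radius $\epsilon$ with centers in $T$ covering $T$. *)

(* Defs.v *)
From HB Require Import structures.
From mathcomp Require Export all_boot all_order all_algebra.
From mathcomp Require Export all_classical all_reals all_analysis ess_sup_inf.

Set Implicit Arguments.
Unset Strict Implicit.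
Unset Printing Implicit Defensive.

Import Order.TTheory GRing.Theory Num.Theory.
Import numFieldNormedType.Exports.

Local Open Scope classical_set_scope.
Local Open Scope ring_scope.
Local Open Scope ereal_scope.

(* Value at [A] of the completion of [P].  The supremum of a separable field
   over an uncountable index set agrees with a random variable only outside a
   negligible set, so the event that it exceeds a level is measurable for the
   completion of [P] but in general not for [P] itself. *)
Definition completed_prob (R : realType) (d : measure_display)
    (Omega : measurableType d) (P : probability Omega R) (A : set Omega)
    : \bar R :=
  @completed_measure_extension d Omega R P A.

Definition mutually_independent (R : realType) (d d' : measure_display)
    (Omega : measurableType d) (X : measurableType d')
    (P : probability Omega R) (eta : nat -> {mfun Omega >-> X}) : Prop :=
  forall (s : seq nat) (A : nat -> set X),
    uniq s -> (forall i, measurable (A i)) ->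
    P (\bigcap_(i in [set` s]) (eta i @^-1` A i)) =
    \prod_(i <- s) P (eta i @^-1` A i).

Definition iid_with_distribution (R : realType) (d d' : measure_display)
    (Omega : measurableType d) (X : measurableType d')
    (P : probability Omega R) (nu : probability X R)
    (eta : nat -> {mfun Omega >-> X}) : Prop :=
  mutually_independent P eta /\
  forall (i : nat) (A : set X), measurable A -> distribution P (eta i) A = nu A.

(* [normal_prob m s] is a normal law only for [s != 0], so that the degenerate
   Gaussian laws have to be listed separately. *)
Definition gaussian_variable (R : realType) (d : measure_display)
    (Omega : measurableType d) (P : probability Omega R) (Y : Omega -> R)
    : Prop :=
  measurable_fun [set: Omega] Y /\
  ((exists m s : R, (0 < s)%R /\
      forall A : set R, measurable A -> P (Y @^-1` A) = normal_prob m s A) \/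
   (exists m : R,
      forall A : set R, measurable A -> P (Y @^-1` A) = \d_m A)).

Definition gaussian_field (R : realType) (d : measure_display)
    (Omega : measurableType d) (P : probability Omega R) (T : Type)
    (Z : T -> Omega -> R) : Prop :=
  forall (n : nat) (t : 'I_n -> T) (a : 'I_n -> R),
    gaussian_variable P (fun w => (\sum_(i < n) a i * Z (t i) w)%R).

(* Separability in the sense of Doob, with respect to the distance [rho]. *)
Definition separable_field (R : realType) (d : measure_display)
    (Omega : measurableType d) (P : probability Omega R) (T : Type)
    (rho : T -> T -> \bar R) (Z : T -> Omega -> R) : Prop :=
  exists S : set T, countable S /\
    {ae P, forall w, forall (t : T) (e : R), (0 < e)%R ->
       exists s : T,
         [/\ S s, rho t s < e%:E & (`|Z s w - Z t w| < e)%R]}.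

Definition as_continuous_field (R : realType) (d : measure_display)
    (Omega : measurableType d) (P : probability Omega R) (T : Type)
    (rho : T -> T -> \bar R) (Z : T -> Omega -> R) : Prop :=
  {ae P, forall w, forall (t : T) (e : R), (0 < e)%R ->
     exists2 delta : R, (0 < delta)%R &
       forall s : T, rho t s < delta%:E -> (`|Z s w - Z t w| < e)%R}.

Definition mean (R : realType) (d : measure_display) (X : measurableType d)
    (nu : probability X R) (T : Type) (g : T -> X -> R) (t : T) : R :=
  (\int[nu]_x g t x)%R.

Definition centered (R : realType) (d : measure_display) (X : measurableType d)
    (nu : probability X R) (T : Type) (g : T -> X -> R) (t : T) (x : X) : R :=
  (g t x - mean nu g t)%R.

(* The sample is [eta 1, ..., eta n]; [eta 0] is the generic variable called
   eta in the definitions of psi_g and gamma_psi. *)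
Definition sample_mean (R : realType) (d d' : measure_display)
    (Omega : measurableType d) (X : measurableType d')
    (eta : nat -> {mfun Omega >-> X}) (T : Type) (g : T -> X -> R)
    (n : nat) (t : T) (w : Omega) : R :=
  (n%:R^-1 * \sum_(1 <= i < n.+1) g t (eta i w))%R.

Definition moment_function (R : realType) (d : measure_display)
    (Omega : measurableType d) (P : probability Omega R) (T : Type)
    (xi : T -> Omega -> R) (p : R) : \bar R :=
  ereal_sup (range (fun t : T => 'N[P]_(p%:E)[EFin \o xi t])).

Definition gls_support (R : realType) (psi : R -> \bar R) : set R :=
  [set p | (1 <= p)%R /\ psi p < +oo].

(* [0 * 0^-1 = 0] in [\bar R], so [psi p = 0] causes no anomaly when the
   p-th norm of [xi] vanishes too. *)
Definition gls_norm (R : realType) (d : measure_display)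
    (Omega : measurableType d) (P : probability Omega R) (psi : R -> \bar R)
    (xi : Omega -> R) : \bar R :=
  ereal_sup [set 'N[P]_(p%:E)[EFin \o xi] * (psi p)^-1 | p in gls_support psi].

Definition gls_distance (R : realType) (d : measure_display)
    (Omega : measurableType d) (P : probability Omega R) (T : Type)
    (psi : R -> \bar R) (xi : T -> Omega -> R) (t s : T) : \bar R :=
  gls_norm P psi (fun w => (xi t w - xi s w)%R).

Definition psi_bar (R : realType) (C0 : R) (psi : R -> \bar R) (p : R)
    : \bar R :=
  if ((2 <= p)%R && (psi p < +oo)) then (C0^-1 * p / ln p)%:E * psi p else +oo.

Definition v_star (R : realType) (psi : R -> \bar R) (x : \bar R) : \bar R :=
  ereal_inf [set x * y%:E + lne (psi (y^-1)%R) | y in `]0%R, 1%R[].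

(* +oo when no finite cover exists. *)
Definition covering_number (R : realType) (T : Type) (rho : T -> T -> \bar R)
    (eps : R) : \bar R :=
  ereal_inf [set (n%:R)%:E | n in [set n : nat |
    exists c : 'I_n -> T, forall t : T, exists i : 'I_n, rho (c i) t <= eps%:E]].

Definition metric_entropy (R : realType) (T : Type) (rho : T -> T -> \bar R)
    (eps : R) : \bar R :=
  lne (covering_number rho eps).

(* Main.v *)
(* The sums of a centered variable in L_p satisfy |S_n|_p <= sqrt(5 p n) |xi|_p, and a Gaussian
   variable with L_2-norm v satisfies |Y|_p <= 12 sqrt(p) v.  Since sqrt(p) <= 2 p / log p, the
   normalized empirical processes and the Gaussian field all have increments bounded in L_p by a
   multiple of p / log p * psi(p) * gamma, and for an optimal exponent p at each dyadic scale the
   entropy integral is exactly what chaining needs.  Chaining gives one modulus of continuity in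
   probability for all these fields: hence the continuity of X and the reduction of suprema to
   maxima over finite nets, up to small probability.  Finite-dimensional laws are compared through
   trigonometric polynomials that approximate indicators of boxes, by the central limit theorem
   for characteristic functions.  Finally the supremum of |X| has no atom at u > 0: the indices
   with small variance do not matter, the other ones split into finitely many groups of variables
   positively correlated with one of them, c; conditionally on the part of the field uncorrelated
   with c, the maximum over a group is increasing in X(c) with slope at least 1/2. *)

(* The obstacle is the passage from finitely many indices to all of [T]. Every statement about a
   supremum is made along one sequence [s] that enumerates separating sets of all the fields at
   once, so that its events are countable intersections; the completed probability absorbs the
   exceptional null sets. Convergence is then proved directly for the distribution functions of the
   suprema, without weak convergence in a function space. Comparison through characteristic
   functions shifts the level [u] in both directions. An upward shift is harmless, because the
   events [sup <= u + e] decrease to [sup <= u]. A downward shift could lose an atom at [u], and the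
   estimate that excludes it has to be uniform in the number of indices; this is where [u > 0]
   enters, since a degenerate field does have an atom at 0. Constants are not optimised: what
   matters is that the moment bounds grow like [sqrt p] and that a single scale [K p] serves the
   empirical and the Gaussian fields. *)
Require Import Defs.
From mathcomp Require Import measurable_realfun ring lra.

Set Implicit Arguments.
Unset Strict Implicit.
Unset Printing Implicit Defensive.
Import Order.TTheory GRing.Theory Num.Theory.
Import numFieldNormedType.Exports.

Local Open Scope classical_set_scope.
Local Open Scope ring_scope.

(** * Moments of sums of independent variables *)

Section real_integrable.
Context (R : realType) d (T : measurableType d) (m : {measure set T -> \bar R}).
Implicit Types f g : T -> R.

Lemma integrableD_fin f g : m.-integrable setT (EFin \o f) ->
  m.-integrable setT (EFin \o g) -> m.-integrable setT (EFin \o (fun x => f x + g x)).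
Proof.
move=> fi gi; have := integrableD measurableT fi gi.
by apply: eq_integrable => // x _ /=; rewrite EFinD.
Qed.

Lemma integrableB_fin f g : m.-integrable setT (EFin \o f) ->
  m.-integrable setT (EFin \o g) -> m.-integrable setT (EFin \o (fun x => f x - g x)).
Proof.
move=> fi gi; have := integrableB measurableT fi gi.
by apply: eq_integrable => // x _ /=; rewrite EFinB.
Qed.

Lemma integrableZl_fin (k : R) f : m.-integrable setT (EFin \o f) ->
  m.-integrable setT (EFin \o (fun x => k * f x)).
Proof.
move=> fi; have := integrableZl measurableT k fi.
by apply: eq_integrable => // x _ /=; rewrite EFinM.
Qed.

Lemma integrableZr_fin (k : R) f : m.-integrable setT (EFin \o f) ->
  m.-integrable setT (EFin \o (fun x => f x * k)).
Proof.
by move=> fi; under eq_fun do rewrite mulrC; exact: integrableZl_fin.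
Qed.

Lemma Rintegral_sum_fin (I : Type) (r : seq I) (F : I -> T -> R) :
  (forall i, m.-integrable setT (EFin \o F i)) ->
  m.-integrable setT (EFin \o (fun x => \sum_(i <- r) F i x)) /\
  \int[m]_x (\sum_(i <- r) F i x) = \sum_(i <- r) \int[m]_x F i x.
Proof.
move=> iF; elim: r => [|i r [IHi IH]].
  have -> : (fun x => \sum_(i <- [::]) F i x) = cst 0.
    by apply/funext => x; rewrite big_nil.
  by rewrite big_nil Rintegral_cst// mul0r; split=> //; exact: integrable0.
have -> : (fun x => \sum_(j <- i :: r) F j x) = (fun x => F i x + \sum_(j <- r) F j x).
  by apply/funext => x; rewrite big_cons.
by split; [exact: integrableD_fin|rewrite RintegralD// IH big_cons].
Qed.

End real_integrable.

Section independence.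
Context (R : realType) d (Omega : measurableType d) (P : probability Omega R).
Implicit Types U V : Omega -> R.

Definition independent_pair U V : Prop :=
  forall A B : set R, measurable A -> measurable B ->
    P (U @^-1` A `&` V @^-1` B) = (P (U @^-1` A) * P (V @^-1` B))%E.

Lemma independent_pair_comp U V (f g : R -> R) :
  measurable_fun setT f -> measurable_fun setT g ->
  independent_pair U V -> independent_pair (f \o U) (g \o V).
Proof.
move=> mf mg UV A B mA mB; apply: (UV (f @^-1` A) (g @^-1` B)).
- by rewrite -[_ @^-1` _]setTI; exact: mf.
- by rewrite -[_ @^-1` _]setTI; exact: mg.
Qed.

Lemma integrable_distribution (U : {mfun Omega >-> R}) :
  P.-integrable setT (EFin \o U) ->
  (distribution P U).-integrable setT (EFin : R -> \bar R) /\
  (\int[distribution P U]_x x%:E = \int[P]_w (U w)%:E)%E.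
Proof.
move=> iU; split; last by rewrite integral_distribution.
apply/integrableP; split; first exact: EFin_measurable.
rewrite ge0_integral_distribution//; last first.
  by apply: measurableT_comp => //; exact: EFin_measurable.
by case/integrableP : iU.
Qed.

(** A product measure is determined by its values on rectangles, where the claim is independence.
    The pair enters as a bundled measurable map [W], so that its law can be formed. *)
Lemma independent_product_law (U V : {mfun Omega >-> R})
    (W : {mfun Omega >-> (R * R)%type}) :
  (forall w, W w = (U w, V w)) -> independent_pair U V ->
  forall X, measurable X ->
    (distribution P U \x distribution P V)%E X = distribution P W X.
Proof.
move=> WE UV; apply: product_measure_unique => A B mA mB.
rewrite /distribution /pushforward /= -UV//; congr (P _).
by apply/seteqP; split=> w /=; rewrite WE.
Qed.

(** Fubini for the product of the two laws. Integrability comes first, from Tonelli applied to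
    absolute values, because Fubini presupposes it. *)
Let integrable_independentM_mfun (U V : {mfun Omega >-> R})
    (W : {mfun Omega >-> (R * R)%type}) :
  (forall w, W w = (U w, V w)) -> independent_pair U V ->
  P.-integrable setT (EFin \o U) -> P.-integrable setT (EFin \o V) ->
  P.-integrable setT (EFin \o (fun w => U w * V w)) /\
  (\int[P]_w (U w * V w)%:E = (\int[P]_w (U w)%:E) * (\int[P]_w (V w)%:E))%E.
Proof.
move=> WE UV iU iV.
have prodE := independent_product_law WE UV.
have mprod : measurable_fun setT (fun z : R * R => (z.1 * z.2)%:E).
  by apply/measurable_EFinP; apply: measurable_funM.
have [i1 e1] := integrable_distribution iU.
have [i2 e2] := integrable_distribution iV.
have f1 : (\int[distribution P U]_x x%:E)%E \is a fin_num.
  exact: integrable_fin_num.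
have f2 : (\int[distribution P V]_x x%:E)%E \is a fin_num.
  exact: integrable_fin_num.
have absprod : (\int[P]_w `|(U w * V w)%:E| =
    (\int[distribution P U]_x `|x%:E|) * (\int[distribution P V]_x `|x%:E|))%E.
  transitivity (\int[distribution P W]_z `|(z.1 * z.2)%:E|)%E.
    rewrite ge0_integral_distribution//; last exact: measurableT_comp.
    by apply: eq_integral => w _; rewrite /= WE.
  rewrite -(eq_measure_integral (distribution P W)
     (m1 := (distribution P U \x distribution P V)%E)); last first.
    by move=> A mA _; exact: prodE.
  rewrite fubini_tonelli1//; last exact: measurableT_comp.
  under eq_integral => x _.
    rewrite /fubini_F/=.
    under eq_integral => y _ do rewrite normrM EFinM.
    rewrite ge0_integralZl_EFin//; last first.
      by apply/measurable_EFinP; exact: normr_measurable.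
    over.
  rewrite /= ge0_integralZr//; last 2 first.
    by apply/measurable_EFinP; exact: normr_measurable.
    by apply: integral_ge0 => y _; rewrite lee_fin.
have iUV : P.-integrable setT (EFin \o (fun w => U w * V w)).
  apply/integrableP; split.
    by apply/measurable_EFinP; exact: measurable_funM.
  rewrite absprod; case/integrableP : i1 => _ i1; case/integrableP : i2 => _ i2.
  apply: lte_mul_pinfty => //.
  - by apply: integral_ge0 => y _; rewrite lee_fin.
  - by rewrite ge0_fin_numE//; apply: integral_ge0 => y _; rewrite lee_fin.
split => //.
have iprod : (distribution P U \x distribution P V)%E.-integrable setT
    (fun z : R * R => (z.1 * z.2)%:E).
  apply/integrableP; split => //.
  rewrite (eq_measure_integral (distribution P W)); last first.
    by move=> A mA _; exact: prodE.
  rewrite ge0_integral_distribution//; last exact: measurableT_comp.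
  case/integrableP : iUV => _.
  by under eq_integral => w _ do rewrite /= -[U w]/((U w, V w).1) -[V w]/((U w, V w).2) -WE.
transitivity (\int[distribution P W]_z (z.1 * z.2)%:E)%E.
  rewrite integral_distribution//.
    by apply: eq_integral => w _; rewrite /= WE.
  apply: eq_integrable iUV => // w _.
  by rewrite /= WE.
rewrite -(eq_measure_integral (distribution P W)
   (m1 := (distribution P U \x distribution P V)%E)); last first.
  by move=> A mA _; exact: prodE.
rewrite -integral12_prod_meas1//=.
under eq_integral => x _.
  rewrite /fubini_F/=.
  under eq_integral => y _ do rewrite EFinM.
  rewrite integralZl//; over.
by rewrite /= -(fineK f2) integralZr// fineK// e1 e2.
Qed.

Lemma integrable_independentM U V :
  independent_pair U V ->
  P.-integrable setT (EFin \o U) -> P.-integrable setT (EFin \o V) ->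
  P.-integrable setT (EFin \o (fun w => U w * V w)) /\
  (\int[P]_w (U w * V w) = (\int[P]_w U w) * (\int[P]_w V w)).
Proof.
move=> UV iU iV.
have mU : measurable_fun setT U.
  by apply/measurable_EFinP; exact: measurable_int iU.
have mV : measurable_fun setT V.
  by apply/measurable_EFinP; exact: measurable_int iV.
have mUV : measurable_fun setT (fun w => (U w, V w)).
  exact: measurable_fun_pair.
have [iUV e] := @integrable_independentM_mfun
  (mfun_Sub (mem_set mU)) (mfun_Sub (mem_set mV)) (mfun_Sub (mem_set mUV))
  (fun=> erefl) UV iU iV.
split => //; rewrite /Rintegral.
by rewrite e fineM// integrable_fin_num.
Qed.

End independence.

(** * Independence of a partial sum and the next term *)

Section iid_sum.
Context (R : realType) (d d' : measure_display)
  (Omega : measurableType d) (X : measurableType d')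
  (P : probability Omega R) (eta : nat -> {mfun Omega >-> X}).
Hypothesis indep : mutually_independent P eta.

(** Fix an event of the last variable. The events independent of it form a lambda-system containing
    the pi-system [G] of intersections over [1 <= i <= n], hence the sigma-algebra generated by [G],
    for which the partial sum is measurable. *)
Lemma iid_sum_independent (h : X -> R) (n : nat) :
  measurable_fun setT h ->
  independent_pair P (fun w => \sum_(1 <= i < n.+1) h (eta i w))
    (fun w => h (eta n.+1 w)).
Proof.
move=> mh.
pose I := [set` iota 1 n].
pose G : set (set Omega) := [set B | exists2 A : nat -> set X,
  (forall i, measurable (A i)) & B = \bigcap_(i in I) eta i @^-1` A i].
have meta i (A : set X) : measurable A -> measurable (eta i @^-1` A).
  by move=> mA; rewrite -[_ @^-1` _]setTI; exact: measurable_funP.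
have GI : setI_closed G.
  move=> _ _ [A mA ->] [B mB ->]; exists (fun i => A i `&` B i).
    by move=> i; exact: measurableI.
  by rewrite -bigcapI; apply: eq_bigcapr => i _; rewrite preimage_setI.
have key (C : set X) : measurable C -> <<s G>> `<=`
    [set B | measurable B /\
       P (B `&` eta n.+1 @^-1` C) = (P B * P (eta n.+1 @^-1` C))%E].
  move=> mC; apply: (@lambda_system_subset _ G GI setT) => //.
  - apply/dynkin_lambda_system; split.
    + by split => //; rewrite setTI probability_setT mul1e.
    + move=> B [mB BE]; split; first exact: measurableC.
      rewrite setIC -setDE measureD//; last 2 first.
        exact: meta.
        by rewrite -ge0_fin_numE//; exact: fin_num_measure (meta _ _ mC).
      rewrite setIC; move: (BE) => /= ->; rewrite probability_setC// muleBl//.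
        by rewrite mul1e.
      exact: fin_num_measure (meta _ _ mC).
    + move=> F tF HF; split.
        by apply: bigcup_measurable => k _; case: (HF k).
      rewrite setI_bigcupl measure_bigcup//; last 2 first.
        by move=> k _; apply: measurableI; [case: (HF k)|exact: meta].
        by apply: trivIset_setIr.
      rewrite measure_bigcup//; last by move=> k _; case: (HF k).
      rewrite (eq_eseriesr (g := fun k => (P (eta n.+1 @^-1` C) * P (F k))%E));
        last by move=> k _; exact: etrans (HF k).2 (muleC _ _).
      by rewrite -(fineK (fin_num_measure P _ (meta n.+1 C mC))) nneseriesZl// muleC.
  - move=> B [A mA ->]; split.
      by rewrite /I; apply: fin_bigcap_measurable => // i _; exact: meta.
    (* [indep] takes a single family of sets: the index [n.+1], absent from [iota 1 n], receives
       [C]. *)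
    pose A' i := if i == n.+1 then C else A i.
    have mA' i : measurable (A' i) by rewrite /A'; case: ifP.
    have nI : n.+1 \notin iota 1 n by rewrite mem_iota add1n ltnn andbF.
    have h1 : (\prod_(i <- iota 1 n) P (eta i @^-1` A' i))%E =
              P (\bigcap_(i in I) eta i @^-1` A i).
      rewrite -(indep (iota_uniq 1 n) mA'); congr (P _).
      apply: eq_bigcapr => i /= Ii; rewrite /A'; case: eqP => // ein.
      by move: nI; rewrite -ein Ii.
    have := @indep (n.+1 :: iota 1 n) A'; rewrite /= nI iota_uniq => /(_ isT mA').
    rewrite big_cons h1 {2}/A' eqxx => e.
    rewrite muleC -e; congr (P _).
    apply/seteqP; split=> w /=.
      move=> [hA hC] i /=; rewrite inE => /predU1P[->|Ii]; rewrite /A'.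
        by rewrite eqxx.
      case: eqP => [ein|_]; last exact: hA.
      by move: nI; rewrite -ein Ii.
    move=> hA'; split=> [i /= Ii|].
      have := hA' i; rewrite /= inE Ii orbT /A' => /(_ isT).
      case: eqP => // ein.
      by move: nI; rewrite -ein Ii.
    have := hA' n.+1; rewrite /= inE eqxx /A' => /(_ isT).
    by rewrite eqxx.
have mS (D : set R) : measurable D ->
    <<s G>> ((fun w => \sum_(1 <= i < n.+1) h (eta i w)) @^-1` D).
  move=> mD.
  (* Measurability for the sigma-algebra of [G]: the preimage under one term is the intersection
     whose other factors are all [setT]. *)
  have : measurable_fun setT
      ((fun w => \sum_(1 <= i < n.+1) h (eta i w)) : g_sigma_algebraType G -> R).
    under eq_fun do rewrite big_add1/= big_mkord.
    apply: measurable_sum => /= i.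
    move=> _ B mB; rewrite setTI.
    apply: sub_sigma_algebra.
    exists (fun j => if j == i.+1 then h @^-1` B else setT).
      move=> j; case: ifP => // _.
      by rewrite -[_ @^-1` _]setTI; exact: mh.
    apply/seteqP; split=> w /=.
      move=> hB j _ /=; by case: eqP => [->|//].
    move=> /(_ i.+1); rewrite /I /= eqxx; apply.
    by rewrite mem_iota /= add1n ltnS.
  by move=> /(_ measurableT D mD); rewrite setTI.
move=> A B mA mB.
have mhB : measurable (h @^-1` B) by rewrite -[_ @^-1` _]setTI; exact: mh.
exact: (key _ mhB _ (mS A mA)).2.
Qed.

End iid_sum.

(** * Elementary inequalities behind the moment bound *)

Section power_inequalities.
Context (R : realType).
Implicit Types a p q x y z s : R.

(** Young's inequality with exponents [q] and [q / (q - 1)], applied to the [q]-th root of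
    [1 + q * a] and to 1, bounds that root by [1 + a]. *)
Lemma bernoulli_powR a q : 0 <= a -> 1 <= q -> 1 + q * a <= (1 + a) `^ q.
Proof.
move=> a0; rewrite le_eqVlt => /predU1P[<-|q1].
  by rewrite powRr1 ?mul1r// addr_ge0.
have q0 : 0 < q by lra.
have qa : 0 <= 1 + q * a by rewrite addr_ge0// mulr_ge0// ltW.
have -> : 1 + q * a = ((1 + q * a) `^ q^-1) `^ q.
  by rewrite -powRrM mulVf ?gt_eqF// powRr1.
apply: ge0_ler_powR; rewrite ?nnegrE ?powR_ge0// ?(ltW q0)//.
  by rewrite addr_ge0.
have q10 : 0 < q / (q - 1) by rewrite divr_gt0// subr_gt0.
have qq : q^-1 + (q / (q - 1))^-1 = 1.
  rewrite invf_div; field; lra.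
have := conjugate_powR (powR_ge0 (1 + q * a) q^-1) ler01 q0 q10 qq.
rewrite mulr1 -powRrM mulVf ?gt_eqF// powRr1// powR1.
move=> /le_trans; apply.
suff -> : (1 + q * a) / q + 1 / (q / (q - 1)) = 1 + a by [].
field; lra.
Qed.

(** Bernoulli after factoring out [x]; the factor left in front of [q * y] is [x^(q - 1)], at least
    1. *)
Lemma powR_add_ge x y q : 1 <= x -> 0 <= y -> 1 <= q ->
  x `^ q + q * y <= (x + y) `^ q.
Proof.
move=> x1 y0 q1.
have x0 : 0 < x by lra.
have -> : x + y = x * (1 + y / x) by field; lra.
have yx : 0 <= y / x by rewrite divr_ge0// ltW.
rewrite powRM ?(ltW x0)//; last by rewrite addr_ge0.
apply: (@le_trans _ _ (x `^ q * (1 + q * (y / x)))); last first.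
  by rewrite ler_wpM2l ?powR_ge0//; exact: bernoulli_powR.
rewrite mulrDr mulr1 lerD2l.
have -> : x `^ q * (q * (y / x)) = (x `^ q / x) * (q * y) by field; lra.
rewrite ler_peMl//; first by rewrite mulr_ge0//; lra.
rewrite ler_pdivlMr// mul1r; exact: le1r_powR.
Qed.

(** Squaring [exp (s / 2) <= (1 - s / 2)^-1] leaves a polynomial inequality, whose two sides differ
    exactly by [s^2 (1 - s) (5/2 - s) / 2]. *)
Lemma expR_le_quadratic s : s <= 1 -> expR s <= 1 + s + 2 * s ^+ 2.
Proof.
move=> s1.
have h : 0 < 1 - s / 2 by lra.
have e2 : expR (s / 2) <= (1 - s / 2)^-1.
  rewrite -[s / 2]opprK expRN lef_pV2 ?posrE ?expR_gt0//; last by rewrite opprK.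
  by rewrite opprK; exact: expR_ge1Dx.
have -> : s = s / 2 + s / 2 by lra.
rewrite expRD; apply: (@le_trans _ _ ((1 - s / 2)^-1 * (1 - s / 2)^-1)).
  by apply: ler_pM; rewrite ?expR_ge0.
rewrite -invfM -[leLHS]mul1r ler_pdivrMr ?mulr_gt0//.
have : 0 <= s ^+ 2 * (1 - s) * (5 / 2 - s) / 2.
  by rewrite divr_ge0// mulr_ge0//; [rewrite mulr_ge0// ?sqr_ge0//; lra|lra].
nra.
Qed.

(** If [|p z| <= 1], the left side is at most [exp (p z) <= 1 + p z + 2 (p z)^2], and Bernoulli
    recovers [5/2 (p z)^2] from the power. Otherwise [|z| <= p z^2]: of the coefficient [5 p], a
    part [2 p + 1] dominates [(1 + z)^2], and another [2 p] pays, through [powR_add_ge], for a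
    negative [p z]. *)
Lemma abs1D_powR_le p z : 2 <= p ->
  `|1 + z| `^ p <= p * z + (1 + 5 * p * z ^+ 2) `^ (p / 2).
Proof.
move=> p2.
have z20 : 0 <= z ^+ 2 by exact: sqr_ge0.
have pz0 : 0 <= 5 * p * z ^+ 2 by rewrite mulr_ge0// mulr_ge0//; lra.
have q1 : 1 <= p / 2 by lra.
have [pz|pz] := leP `|p * z| 1.
  have [pz1 pz2] : -1 <= p * z /\ p * z <= 1 by move: pz; rewrite ler_norml => /andP.
  have z1 : 0 <= 1 + z by nra.
  rewrite (ger0_norm z1).
  apply: (@le_trans _ _ (expR z `^ p)).
    by apply: ge0_ler_powR; rewrite ?nnegrE ?expR_ge0//; [lra|exact: expR_ge1Dx].
  rewrite -expRM mulrC.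
  apply: le_trans (expR_le_quadratic pz2) _.
  have := bernoulli_powR pz0 q1.
  have -> : p / 2 * (5 * p * z ^+ 2) = 5 / 2 * (p * z) ^+ 2 by lra.
  have := sqr_ge0 (p * z); lra.
have z2E : z ^+ 2 = `|z| ^+ 2 by rewrite real_normK ?num_real.
have zle : `|z| <= p * z ^+ 2.
  move: pz; rewrite normrM (ger0_norm (_ : 0 <= p)); last lra.
  move=> pz; rewrite z2E; have := normr_ge0 z; nra.
have -> : `|1 + z| `^ p = (`|1 + z| ^+ 2) `^ (p / 2).
  rewrite -powR_mulrn// -powRrM; congr (_ `^ _); lra.
rewrite real_normK ?num_real//.
have zz : z <= `|z| /\ - z <= `|z| by split; [exact: ler_norm|rewrite -normrN ler_norm].
apply: (@le_trans _ _ ((1 + (2 * p + 1) * z ^+ 2) `^ (p / 2))).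
  apply: ge0_ler_powR; rewrite ?nnegrE ?sqr_ge0//; [lra|nra|].
  nra.
have X1 : 1 <= 1 + (2 * p + 1) * z ^+ 2 by nra.
have Y0 : 0 <= 2 * p * z ^+ 2 by rewrite mulr_ge0// mulr_ge0//; lra.
have := powR_add_ge X1 Y0 q1.
have -> : p / 2 * (2 * p * z ^+ 2) = p * (p * z ^+ 2) by lra.
move=> h.
have h2 : (1 + (2 * p + 1) * z ^+ 2 + 2 * p * z ^+ 2) `^ (p / 2)
    <= (1 + 5 * p * z ^+ 2) `^ (p / 2).
  apply: ge0_ler_powR; rewrite ?nnegrE; [lra|nra|lra|nra].
have h3 : - (p * z) <= p * (p * z ^+ 2).
  rewrite -mulrN ler_pM2l; lra.
lra.
Qed.

(* The linear term is killed by independence; the constant [5 * p], linear in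
   [p], is what makes the moment bound below grow only like [sqrt p]. *)
Lemma absD_powR_le p x y : 2 <= p ->
  `|x + y| `^ p <= p * (Num.sg x * `|x| `^ (p - 1) * y)
                   + (x ^+ 2 + 5 * p * y ^+ 2) `^ (p / 2).
Proof.
move=> p2.
have [->|x0] := eqVneq x 0.
  rewrite add0r sgr0 !mul0r mulr0 add0r expr0n add0r.
  have -> : `|y| `^ p = (`|y| ^+ 2) `^ (p / 2).
    rewrite -powR_mulrn// -powRrM; congr (_ `^ _); lra.
  rewrite real_normK ?num_real//.
  have y2 := sqr_ge0 y.
  apply: ge0_ler_powR; rewrite ?nnegrE//; [lra|nra|nra].
have nx0 : 0 < `|x| by rewrite normr_gt0.
have [z ->] : exists z, y = x * z by exists (y / x); field.
have -> : x + x * z = x * (1 + z) by ring.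
rewrite normrM powRM//.
have -> : Num.sg x * `|x| `^ (p - 1) * (x * z) = `|x| `^ p * z.
  rewrite -[in RHS](mulr_powRB1 (normr_ge0 x)); last lra.
  by rewrite [X in _ = X * _ * _]normrEsg; ring.
have -> : x ^+ 2 + 5 * p * (x * z) ^+ 2 = `|x| ^+ 2 * (1 + 5 * p * z ^+ 2).
  by rewrite real_normK ?num_real//; ring.
have z2 := sqr_ge0 z.
rewrite [(_ * _) `^ (p / 2)]powRM ?sqr_ge0//; last nra.
have -> : (`|x| ^+ 2) `^ (p / 2) = `|x| `^ p.
  rewrite -powR_mulrn// -powRrM; congr (_ `^ _); lra.
rewrite mulrCA -mulrDr ler_wpM2l ?powR_ge0//; exact: abs1D_powR_le.
Qed.

End power_inequalities.

Section moments.
Context (R : realType) d (Omega : measurableType d) (P : probability Omega R).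
Local Open Scope ereal_scope.

Lemma integral_powR_Lnorm (f : Omega -> R) (q : R) : (q != 0)%R ->
  (forall w, 0 <= f w)%R ->
  \int[P]_w ((f w) `^ q)%:E = 'N[P]_q%:E[EFin \o f] `^ q.
Proof.
move=> q0 f0; rewrite (poweR_Lnorm P (EFin \o f) q0).
by apply: eq_integral => w _; rewrite /= ger0_norm.
Qed.

Lemma le_Lnorm_integral_powR (f g : Omega -> R) (q : R) : (0 < q)%R ->
  (forall w, 0 <= f w)%R -> (forall w, 0 <= g w)%R ->
  \int[P]_w ((f w) `^ q)%:E <= \int[P]_w ((g w) `^ q)%:E ->
  'N[P]_q%:E[EFin \o f] <= 'N[P]_q%:E[EFin \o g].
Proof.
move=> q0 f0 g0 fg.
have q00 : (q != 0)%R by rewrite gt_eqF.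
have NE (h : Omega -> R) : (forall w, 0 <= h w)%R ->
    'N[P]_q%:E[EFin \o h] = (\int[P]_w ((h w) `^ q)%:E) `^ q^-1.
  move=> h0; rewrite integral_powR_Lnorm// -poweRrM mulfV// poweRe1//.
  exact: Lnorm_ge0.
rewrite (NE f f0) (NE g g0); apply: gt0_ler_poweR; last exact: fg.
- by rewrite invr_ge0 ltW.
- by rewrite in_itv/= leey andbT; apply: integral_ge0 => w _; rewrite lee_fin powR_ge0.
- by rewrite in_itv/= leey andbT; apply: integral_ge0 => w _; rewrite lee_fin powR_ge0.
Qed.

Lemma integrable_powR_le (f : Omega -> R) (p r : R) : (0 < r <= p)%R ->
  measurable_fun setT f ->
  P.-integrable setT (fun w => (`|f w| `^ p)%:E) ->
  P.-integrable setT (fun w => (`|f w| `^ r)%:E).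
Proof.
move=> /andP[r0 rp] mf ip.
have mr (s : R) : measurable_fun setT (fun w => (`|f w| `^ s)%R).
  apply: (measurableT_comp (measurable_powR s)); exact: measurableT_comp.
have i1 : P.-integrable setT (EFin \o (fun w => (1 + `|f w| `^ p)%R)).
  rewrite [X in integrable _ _ X](_ : _ = (cst 1%:E \+ (fun w => (`|f w| `^ p)%:E)))//.
  apply: integrableD => //; exact: finite_measure_integrable_cst.
apply: le_integrable i1 => //; first exact/measurable_EFinP.
move=> w _ /=; rewrite lee_fin (ger0_norm (powR_ge0 _ _)) [leRHS]ger0_norm; last first.
  by rewrite addr_ge0// powR_ge0.
have [f1|f1] := leP 1%R `|f w|%R.
  by apply: (le_trans (ler_powR f1 rp)); rewrite lerDr.
apply: (@le_trans _ _ 1%R); last by rewrite lerDl powR_ge0.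
have <- : (1 `^ r = 1 :> R)%R by rewrite powR1.
by apply: ge0_ler_powR; rewrite ?nnegrE ?(ltW r0) ?(ltW f1).
Qed.

(** Integrating [absD_powR_le] kills the term linear in [Y]; Minkowski, valid since [p / 2 >= 1],
    splits the rest. Additivity of this norm of the squares is what produces the factor [n^(p / 2)]
    for a sum of [n] terms. *)
Lemma Lnorm_independentD (S Y : Omega -> R) (p : R) : (2 <= p)%R ->
  measurable_fun setT S -> measurable_fun setT Y ->
  independent_pair P S Y ->
  P.-integrable setT (fun w => (`|S w| `^ p)%:E) ->
  P.-integrable setT (fun w => (`|Y w| `^ p)%:E) ->
  (\int[P]_w Y w = 0)%R ->
  'N[P]_(p / 2)%:E[EFin \o (fun w => (S w + Y w) ^+ 2)%R] <=
  'N[P]_(p / 2)%:E[EFin \o (fun w => S w ^+ 2)%R] +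
  'N[P]_(p / 2)%:E[EFin \o (fun w => 5 * p * Y w ^+ 2)%R].
Proof.
move=> p2 mS mY SY iS iY Y0.
have q1 : (1 <= p / 2)%R by lra.
have q0 : (0 < p / 2)%R by lra.
have p50 : (0 <= 5 * p)%R by lra.
have mS2 : measurable_fun setT (fun w => S w ^+ 2)%R by exact: measurable_funX.
have mY2 : measurable_fun setT (fun w => 5 * p * Y w ^+ 2)%R.
  by apply: measurable_funM => //; exact: measurable_funX.
have sqE (x : R) : ((x ^+ 2) `^ (p / 2) = `|x| `^ p)%R.
  rewrite -[in LHS](real_normK (num_real x)) -powR_mulrn// -powRrM.
  congr (_ `^ _)%R; lra.
set G := (fun w => S w ^+ 2 + 5 * p * Y w ^+ 2)%R.
have G0 w : (0 <= G w)%R.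
  by rewrite /G addr_ge0 ?sqr_ge0// mulr_ge0// sqr_ge0.
have mG : measurable_fun setT G by exact: measurable_funD.
have N1 : 'N[P]_(p / 2)%:E[EFin \o (fun w => S w ^+ 2)%R] < +oo.
  apply: (@lty_poweRy _ _ (p / 2)); first by rewrite gt_eqF.
  rewrite -integral_powR_Lnorm ?(gt_eqF q0)//; last by move=> w; exact: sqr_ge0.
  under eq_integral => w _ do rewrite sqE.
  by have := @integrable_lty _ _ _ P setT measurableT _ iS.
have N2 : 'N[P]_(p / 2)%:E[EFin \o (fun w => 5 * p * Y w ^+ 2)%R] < +oo.
  apply: (@lty_poweRy _ _ (p / 2)); first by rewrite gt_eqF.
  rewrite -integral_powR_Lnorm ?(gt_eqF q0)//; last by move=> w; rewrite mulr_ge0// sqr_ge0.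
  under eq_integral => w _ do rewrite powRM ?sqr_ge0// sqE EFinM.
  rewrite ge0_integralZl_EFin ?powR_ge0//; last first.
    by case/integrableP: iY.
  apply: lte_mul_pinfty; rewrite ?lee_fin ?powR_ge0//.
  by have := @integrable_lty _ _ _ P setT measurableT _ iY.
have mink : 'N[P]_(p / 2)%:E[EFin \o G] <=
    'N[P]_(p / 2)%:E[EFin \o (fun w => S w ^+ 2)%R] +
    'N[P]_(p / 2)%:E[EFin \o (fun w => 5 * p * Y w ^+ 2)%R].
  exact: minkowski_EFin.
apply: le_trans mink.
apply: le_Lnorm_integral_powR => //; first by move=> w; exact: sqr_ge0.
have iG : P.-integrable setT (EFin \o (fun w => G w `^ (p / 2))%R).
  apply/integrableP; split.
    by apply/measurable_EFinP; apply: (measurableT_comp (measurable_powR _)).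
  under eq_integral => w _ do rewrite gee0_abs ?lee_fin ?powR_ge0//.
  rewrite integral_powR_Lnorm ?gt_eqF//; apply: poweR_lty.
  apply: le_lt_trans (minkowski_EFin _ _ _ _) _ => //.
  exact: lte_add_pinfty.
pose F := (fun w => Num.sg (S w) * `|S w| `^ (p - 1))%R.
have msg : measurable_fun setT (fun x : R => Num.sg x * `|x| `^ (p - 1))%R.
  apply: measurable_funM; last first.
    by apply: (measurableT_comp (measurable_powR _)).
  apply: nondecreasing_measurable => // x y xy.
  case: (sgrP x) => hx; case: (sgrP y) => hy; lra.
have mF : measurable_fun setT F by apply: (measurableT_comp msg).
have iF : P.-integrable setT (EFin \o F).
  have iS1 : P.-integrable setT (fun w => (`|S w| `^ (p - 1))%:E).
    apply: integrable_powR_le iS => //; lra.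
  apply: le_integrable iS1 => //; first exact/measurable_EFinP.
  move=> w _ /=; rewrite /F lee_fin normrM ler_piMl//.
  by rewrite normr_sg; case: (_ != _).
have iY1 : P.-integrable setT (EFin \o Y).
  have iY1 : P.-integrable setT (fun w => (`|Y w| `^ 1)%:E).
    apply: integrable_powR_le iY => //; lra.
  apply: le_integrable iY1 => //; first exact/measurable_EFinP.
  by move=> w _ /=; rewrite powRr1// normr_id.
have FY : independent_pair P F Y.
  exact: (@independent_pair_comp _ _ _ _ _ _ _ id msg _ SY).
have [iFY FY0] := integrable_independentM FY iF iY1.
have iH : P.-integrable setT (EFin \o (fun w => p * (F w * Y w) + G w `^ (p / 2))%R).
  rewrite [X in integrable _ _ X](_ : _ =
    (fun w => p%:E * (F w * Y w)%:E) \+ (EFin \o (fun w => G w `^ (p / 2))%R))//.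
  by apply: integrableD => //; exact: integrableZl.
have iL : P.-integrable setT (EFin \o (fun w => ((S w + Y w) ^+ 2) `^ (p / 2))%R).
  apply: le_integrable iH => //.
    apply/measurable_EFinP; apply: (measurableT_comp (measurable_powR _)).
    by apply: measurable_funX; exact: measurable_funD.
  move=> w _ /=; rewrite lee_fin ger0_norm ?powR_ge0//.
  apply: le_trans (ler_norm _); rewrite sqE; exact: absD_powR_le.
have fL := integrable_fin_num measurableT iL.
have fG := integrable_fin_num measurableT iG.
rewrite -(fineK fL) -(fineK fG) lee_fin.
apply: (@le_trans _ _ (\int[P]_w (p * (F w * Y w) + G w `^ (p / 2)))%R).
  by apply: le_Rintegral => // w _; rewrite sqE; exact: absD_powR_le.
rewrite RintegralD//; last exact: (integrableZl measurableT p iFY).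
by rewrite RintegralZl// FY0 Y0 !mulr0 add0r.
Qed.

End moments.

Section iid_moments.
Context (R : realType) (d d' : measure_display)
  (Omega : measurableType d) (X : measurableType d')
  (P : probability Omega R) (nu : probability X R)
  (eta : nat -> {mfun Omega >-> X}).
Hypothesis heta : iid_with_distribution P nu eta.
Local Open Scope ereal_scope.

Lemma ge0_integral_iid (f : X -> \bar R) (i : nat) :
  measurable_fun setT f -> (forall x, 0 <= f x) ->
  \int[P]_w f (eta i w) = \int[nu]_x f x.
Proof.
move=> mf f0; rewrite -(@ge0_integral_distribution _ _ _ _ _ P (eta i) f mf f0).
by apply: eq_measure_integral => A mA _; exact: heta.2.
Qed.

Lemma integrable_iid (f : X -> \bar R) (i : nat) :
  nu.-integrable setT f -> P.-integrable setT (f \o eta i).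
Proof.
move=> /integrableP[mf fi]; apply/integrableP; split.
  exact: measurableT_comp.
have -> // : \int[P]_x `|(f \o eta i) x| = \int[nu]_x `|f x|.
apply: (@ge0_integral_iid (abse \o f)); first exact: measurableT_comp.
by move=> x; exact: abse_ge0.
Qed.

Lemma integral_iid (f : X -> \bar R) (i : nat) :
  nu.-integrable setT f -> \int[P]_w f (eta i w) = \int[nu]_x f x.
Proof.
move=> fi; have mf := measurable_int _ fi.
rewrite -(@integral_distribution _ _ _ _ _ P (eta i) f mf (integrable_iid i fi)).
by apply: eq_measure_integral => A mA _; exact: heta.2.
Qed.

Lemma sqr_powR_half (p x : R) : ((x ^+ 2) `^ (p / 2) = `|x| `^ p)%R.
Proof.
rewrite -[in LHS](real_normK (num_real x)) -powR_mulrn// -powRrM.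
by congr (_ `^ _)%R; lra.
Qed.

(** Integrability and the bound share one induction: the step needs the [p]-th moment of the partial
    sum to be finite. *)
Let iid_sum_Lnorm (h : X -> R) (p : R) (n : nat) : (2 <= p)%R ->
  measurable_fun setT h -> nu.-integrable setT (fun x => (`|h x| `^ p)%:E) ->
  (\int[nu]_x h x = 0)%R ->
  P.-integrable setT (fun w => (`|(\sum_(1 <= i < n.+1) h (eta i w))%R| `^ p)%:E) /\
  'N[P]_(p / 2)%:E[EFin \o (fun w => (\sum_(1 <= i < n.+1) h (eta i w)) ^+ 2)%R] <=
  n%:R%:E * 'N[nu]_(p / 2)%:E[EFin \o (fun x => 5 * p * h x ^+ 2)%R].
Proof.
move=> p2 mh ih h0.
have q0 : (0 < p / 2)%R by lra.
have q00 : (p / 2 != 0)%R by rewrite gt_eqF.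
have p5 : (0 <= 5 * p)%R by lra.
pose S k w := (\sum_(1 <= i < k.+1) h (eta i w))%R.
have mS k : measurable_fun setT (S k).
  rewrite /S; under eq_fun do rewrite big_add1/= big_mkord.
  by apply: measurable_sum => i; exact: measurableT_comp.
elim: n => [|n [IHi IH]].
  have pn0 : (p != 0)%R by rewrite gt_eqF//; lra.
  under eq_fun do rewrite big_geq// normr0 powR0//.
  split; first exact: finite_measure_integrable_cst.
  rewrite (_ : EFin \o _ = cst 0); first by rewrite Lnorm0// mul0e.
  by apply/funext => w /=; rewrite big_geq// expr0n.
have SE w : S n.+1 w = (S n w + h (eta n.+1 w))%R by rewrite /S big_nat_recr.
have iY : P.-integrable setT (fun w => (`|h (eta n.+1 w)| `^ p)%:E).
  exact: (integrable_iid n.+1 ih).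
have ih1 : nu.-integrable setT (EFin \o h).
  have ih1 : nu.-integrable setT (fun w => (`|h w| `^ 1)%:E).
    apply: integrable_powR_le ih => //; lra.
  apply: le_integrable ih1 => //; first exact/measurable_EFinP.
  by move=> w _ /=; rewrite powRr1// normr_id.
have Y0 : (\int[P]_w h (eta n.+1 w) = 0)%R.
  by rewrite /Rintegral (integral_iid n.+1 ih1).
have mY : measurable_fun setT (fun w => h (eta n.+1 w)) by exact: measurableT_comp.
have step := Lnorm_independentD p2 (mS n) mY
  (iid_sum_independent heta.1 n mh) IHi iY Y0.
have E5 : 'N[P]_(p / 2)%:E[EFin \o (fun w => 5 * p * h (eta n.+1 w) ^+ 2)%R] =
          'N[nu]_(p / 2)%:E[EFin \o (fun x => 5 * p * h x ^+ 2)%R].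
  rewrite unlock; congr (_ `^ _).
  rewrite (ge0_integral_iid (f := fun x => `|(5 * p * h x ^+ 2)%:E| `^ (p / 2)))//.
    apply: (measurableT_comp (f := fun x => x `^ (p / 2))).
      exact: measurable_poweR.
    apply: measurableT_comp => //; apply/measurable_EFinP.
    by apply: measurable_funM => //; exact: measurable_funX.
  by move=> x; exact: poweR_ge0.
have N1 : 'N[P]_(p / 2)%:E[EFin \o (fun w => S n.+1 w ^+ 2)%R] <=
  n.+1%:R%:E * 'N[nu]_(p / 2)%:E[EFin \o (fun x => 5 * p * h x ^+ 2)%R].
  have -> : (fun w => S n.+1 w ^+ 2)%R = (fun w => (S n w + h (eta n.+1 w)) ^+ 2)%R.
    by apply/funext => w; rewrite SE.
  apply: le_trans step _; rewrite E5.
  have -> : n.+1%:R = (n%:R + 1)%R :> R by rewrite natr1.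
  by rewrite EFinD ge0_muleDl ?lee_fin// mul1e leeD2r.
split; last exact: N1.
apply/integrableP; split.
  apply/measurable_EFinP; apply: (measurableT_comp (measurable_powR p)).
  exact: (measurableT_comp _ (mS n.+1)).
under eq_integral => w _ do rewrite gee0_abs ?lee_fin ?powR_ge0// -sqr_powR_half.
rewrite (integral_powR_Lnorm P q00 (f := fun w => (S n.+1 w) ^+ 2)%R); last first.
  by move=> w; exact: sqr_ge0.
apply: poweR_lty; apply: le_lt_trans N1 _.
apply: lte_mul_pinfty; rewrite ?lee_fin//.
apply: (@lty_poweRy _ _ (p / 2)) => //.
rewrite -(integral_powR_Lnorm nu q00 (f := fun x => 5 * p * h x ^+ 2)%R); last first.
  by move=> w; rewrite mulr_ge0// sqr_ge0.
under eq_integral => w _ do rewrite powRM ?sqr_ge0// sqr_powR_half EFinM.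
rewrite ge0_integralZl_EFin ?powR_ge0//; last by case/integrableP: ih.
apply: lte_mul_pinfty; rewrite ?lee_fin ?powR_ge0//.
by have := @integrable_lty _ _ _ nu setT measurableT _ ih.
Qed.

Lemma iid_sum_moment (h : X -> R) (p : R) (n : nat) : (2 <= p)%R ->
  measurable_fun setT h -> nu.-integrable setT (fun x => (`|h x| `^ p)%:E) ->
  (\int[nu]_x h x = 0)%R ->
  \int[P]_w (`|(\sum_(1 <= i < n.+1) h (eta i w))%R| `^ p)%:E <=
  ((5 * p * n%:R) `^ (p / 2))%:E * \int[nu]_x (`|h x| `^ p)%:E.
Proof.
move=> p2 mh ih h0.
have q0 : (0 < p / 2)%R by lra.
have q00 : (p / 2 != 0)%R by rewrite gt_eqF.
have p5 : (0 <= 5 * p)%R by lra.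
have [_ le] := iid_sum_Lnorm n p2 mh ih h0.
under eq_integral => w _ do rewrite -sqr_powR_half.
rewrite (integral_powR_Lnorm P q00 (f := fun w => (\sum_(1 <= i < n.+1) h (eta i w)) ^+ 2)%R);
  last by move=> w; exact: sqr_ge0.
apply: (@le_trans _ _ ((n%:R%:E *
  'N[nu]_(p / 2)%:E[EFin \o (fun x => 5 * p * h x ^+ 2)%R]) `^ (p / 2))).
  apply: gt0_ler_poweR => //; first exact: ltW.
  - by rewrite in_itv/= leey andbT Lnorm_ge0.
  - by rewrite in_itv/= leey andbT mule_ge0 ?Lnorm_ge0.
rewrite poweRM ?Lnorm_ge0// poweR_EFin.
rewrite -(integral_powR_Lnorm nu q00 (f := fun x => 5 * p * h x ^+ 2)%R); last first.
  by move=> w; rewrite mulr_ge0// sqr_ge0.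
under eq_integral => w _ do rewrite powRM ?sqr_ge0// sqr_powR_half EFinM.
rewrite ge0_integralZl_EFin ?powR_ge0//; last by case/integrableP: ih.
by rewrite muleA -EFinM -powRM// [(n%:R * _)%R]mulrC.
Qed.

End iid_moments.

(** * Convergence of characteristic functions *)

Section trigonometric_bounds.
Context (R : realType).
Implicit Types x y : R.

(** Mean value theorem from 0. Bounding the derivative by its maximum instead of integrating only
    costs constants, such as [x^3 / 2] in place of [x^3 / 6]. *)
Lemma le_norm_is_derive (f f' : R -> R) (C y : R) : 0 <= y ->
  (forall x, is_derive x (1 : R) f (f' x)) -> f 0 = 0 ->
  (forall x, 0 <= x <= y -> `|f' x| <= C) -> `|f y| <= C * y.
Proof.
move=> y0 df f0 f'C.
have cf : {within `[0, y], continuous f}.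
  apply: continuous_subspaceT => x.
  by apply/differentiable_continuous/derivable1_diffP; case: (df x).
have [c] := @MVT_segment R f f' 0 y y0 (fun x _ => df x) cf.
rewrite in_itv/= f0 !subr0 => cy ->.
by rewrite normrM (ger0_norm y0) ler_wpM2r// f'C.
Qed.

Lemma norm_sin_le x : `|sin x| <= `|x|.
Proof.
wlog x0 : x / 0 <= x.
  move=> h; have [|/ltW x0] := leP 0 x; first exact: h.
  by have := h (- x); rewrite sinN !normrN oppr_ge0; exact.
rewrite (ger0_norm x0) -[leRHS]mul1r.
by apply: (@le_norm_is_derive sin cos) => //; [rewrite sin0|move=> ? _; exact: cos_max].
Qed.

Lemma onem_cos_ge0 x : 0 <= 1 - cos x.
Proof. by rewrite subr_ge0 cos_le1. Qed.

Lemma onem_cos_le x : 1 - cos x <= x ^+ 2 / 2.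
Proof.
have -> : x = (x / 2) *+ 2 by rewrite mulr2n; lra.
rewrite cos_mulr2n cos2sin2.
have h := norm_sin_le (x / 2).
have : sin (x / 2) ^+ 2 <= (x / 2) ^+ 2.
  by rewrite -(real_normK (num_real (sin _))) -(real_normK (num_real (x / 2))) lerXn2r ?nnegrE.
move: (sin (x / 2) ^+ 2) => s hs; rewrite !mulr2n.
have -> : (x / 2 + x / 2) ^+ 2 / 2 = 2 * (x / 2) ^+ 2 by field.
lra.
Qed.

Lemma norm_sub_sin_le x : `|x - sin x| <= `|x| ^+ 3 / 2.
Proof.
wlog x0 : x / 0 <= x.
  move=> h; have [|/ltW x0] := leP 0 x; first exact: h.
  have := h (- x); rewrite sinN -opprD !normrN oppr_ge0; exact.
rewrite (ger0_norm x0).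
have -> : x ^+ 3 / 2 = (x ^+ 2 / 2) * x by rewrite exprSr mulrAC.
apply: (@le_norm_is_derive (fun x => x - sin x) (fun x => 1 - cos x)) => //.
  by rewrite sin0 subr0.
move=> y /andP[y0 yx]; rewrite ger0_norm ?onem_cos_ge0//.
apply: (le_trans (onem_cos_le y)); rewrite ler_pM2r// lerXn2r ?nnegrE//.
Qed.

Lemma norm_cos_taylor2_le4 x : `|cos x - 1 + x ^+ 2 / 2| <= x ^+ 4 / 2.
Proof.
wlog x0 : x / 0 <= x.
  move=> h; have [|/ltW x0] := leP 0 x; first exact: h.
  have := h (- x); rewrite cosN sqrrN -[4%N]/(2 * 2)%N !exprM sqrrN oppr_ge0; exact.
have -> : x ^+ 4 / 2 = (x ^+ 3 / 2) * x by rewrite exprSr mulrAC.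
apply: (@le_norm_is_derive (fun x => cos x - 1 + x ^+ 2 / 2) (fun x => x - sin x)) => //.
- move=> y; apply: is_derive_eq.
  by rewrite /GRing.scale/= ?expr1; lra.
- by rewrite cos0 subrr expr0n mul0r addr0.
move=> y /andP[y0 yx].
apply: (le_trans (norm_sub_sin_le y)); rewrite ler_pM2r//.
by rewrite (ger0_norm y0) lerXn2r ?nnegrE//.
Qed.

(** The quadratic bound is the dominating function, integrable with two moments; the quartic one
    gives pointwise convergence. *)
Lemma norm_cos_taylor2_le2 x : `|cos x - 1 + x ^+ 2 / 2| <= x ^+ 2 / 2.
Proof.
have := onem_cos_ge0 x; have := onem_cos_le x; have := sqr_ge0 x => h1 h2 h3.
by rewrite ler_norml; apply/andP; split; lra.
Qed.

Lemma norm_sub_sin_le2 x : `|x - sin x| <= 2 * x ^+ 2.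
Proof.
have [x1|x1] := leP `|x| 1.
  apply: (le_trans (norm_sub_sin_le x)).
  rewrite -[x ^+ 2](real_normK (num_real x)).
  have x0 := normr_ge0 x; nra.
apply: (le_trans (ler_normB _ _)).
have := norm_sin_le x; rewrite -[x ^+ 2](real_normK (num_real x)).
nra.
Qed.

End trigonometric_bounds.

Section power_limit.
Context (R : realType).

Lemma cvg_dist_squeeze (u e : nat -> R) (l : R) :
  (\forall n \near \oo, `|u n - l| <= e n) -> e @ \oo --> (0 : R) ->
  u @ \oo --> l.
Proof.
move=> ue e0; apply/cvgrPdist_le => eps eps0.
move/cvgr0Pnorm_le : e0 => /(_ eps eps0) e0.
near=> n; rewrite distrC.
apply: (@le_trans _ _ (e n)); first by near: n; exact: ue.
by apply: (le_trans (ler_norm _)); near: n; exact: e0.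
Unshelve. all: by end_near. Qed.

Lemma cvg_exp_remainder (v : R) : 0 <= v ->
  (fun n => n%:R * (expR (- v / n%:R) - 1 + v / n%:R)) @ \oo --> (0 : R).
Proof.
move=> v0.
apply: (@squeeze_cvgr _ _ _ _ (cst 0) (fun n => 2 * v ^+ 2 / n%:R)).
- near=> n.
  have n0 : 0 < n%:R :> R by rewrite ltr0n; near: n; exists 1%N.
  have x0 : 0 <= v / n%:R by rewrite divr_ge0// ltW.
  have -> : - v / n%:R = - (v / n%:R) by rewrite mulNr.
  apply/andP; split.
    apply: mulr_ge0; first exact: ltW.
    have := expR_ge1Dx (- (v / n%:R)); lra.
  have -> : 2 * v ^+ 2 / n%:R = n%:R * (2 * (v / n%:R) ^+ 2) by field; rewrite gt_eqF.
  rewrite ler_pM2l//.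
  have h : - (v / n%:R) <= 1 by lra.
  have := expR_le_quadratic h; rewrite sqrrN; lra.
- exact: cvg_cst.
- rewrite -[X in _ --> X](mulr0 (2 * v ^+ 2)).
  apply: cvgMr; apply/gtr0_cvgV0; last exact: cvgr_idn.
  by near=> n; rewrite ltr0n; near: n; exists 1%N.
Unshelve. all: by end_near. Qed.

(* [C], [D] are the real and imaginary parts of a characteristic function of a sum of [k] terms,
   [c n], [s n] those of a single term. *)
Lemma cvg_char_powers (v : R) (c s : nat -> R) (C D : nat -> nat -> R) : 0 <= v ->
  (forall n k, `|C n k| <= 1) -> (forall n k, `|D n k| <= 1) ->
  (forall n, `|c n| <= 1) ->
  (forall n, C n 0 = 1) -> (forall n, D n 0 = 0) ->
  (forall n k, C n k.+1 = C n k * c n - D n k * s n) ->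
  (forall n k, D n k.+1 = D n k * c n + C n k * s n) ->
  (fun n => n%:R * (c n - 1 + v / n%:R)) @ \oo --> (0 : R) ->
  (fun n => n%:R * s n) @ \oo --> (0 : R) ->
  (fun n => C n n) @ \oo --> expR (- v) /\ (fun n => D n n) @ \oo --> (0 : R).
Proof.
move=> v0 C1 D1 c1 C0 D0 CS DS cc cs.
pose r n := expR (- v / n%:R).
have r1 n : `|r n| <= 1.
  rewrite ger0_norm ?expR_ge0// expR_le1 mulNr oppr_le0 divr_ge0//.
have hD n k : `|D n k| <= k%:R * `|s n|.
  elim: k => [|k IH]; first by rewrite D0 normr0 mul0r.
  rewrite DS; apply: (le_trans (ler_normD _ _)).
  rewrite -natr1 mulrDl mul1r; apply: lerD; rewrite normrM.
    by apply: le_trans IH; rewrite ler_piMr.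
  by rewrite ler_piMl.
(* Real form of [|z^k - r^k| <= k |z - r|] for numbers of modulus at most 1; the imaginary part only
   contributes [|s n|] at each step. *)
have hC n k : `|C n k - r n ^+ k| <= k%:R * (`|c n - r n| + `|s n|).
  elim: k => [|k IH]; first by rewrite C0 expr0 subrr normr0 mul0r.
  have -> : C n k.+1 - r n ^+ k.+1 =
     C n k * (c n - r n) - D n k * s n + r n * (C n k - r n ^+ k).
    by rewrite CS exprS; ring.
  apply: (le_trans (ler_normD _ _)).
  have -> : k.+1%:R * (`|c n - r n| + `|s n|) =
      (`|c n - r n| + `|s n|) + k%:R * (`|c n - r n| + `|s n|).
    by rewrite -natr1 mulrDl mul1r addrC.
  apply: lerD; last first.
    by rewrite normrM; apply: le_trans IH; rewrite ler_piMl.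
  apply: (le_trans (ler_normB _ _)).
  by apply: lerD; rewrite normrM ler_piMl.
have cs' : (fun n => n%:R * `|s n|) @ \oo --> (0 : R).
  have h : (fun n => `|n%:R * s n|) @ \oo --> `|0 : R| by exact: cvg_norm.
  by move: h; rewrite normr0; under eq_fun do rewrite normrM ger0_norm//.
have cr' : (fun n => n%:R * `|c n - r n|) @ \oo --> (0 : R).
  have h : (fun n => n%:R * (c n - r n)) @ \oo --> (0 - 0 : R).
    rewrite (_ : (fun n => _) = (fun n => n%:R * (c n - 1 + v / n%:R)) -
        (fun n => n%:R * (expR (- v / n%:R) - 1 + v / n%:R))).
      by apply: cvgB => //; exact: cvg_exp_remainder.
    by apply/funext => n; rewrite !fctE /r; ring.
  have : (fun n => `|n%:R * (c n - r n)|) @ \oo --> `|0 - 0 : R| by exact: cvg_norm.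
  by rewrite subr0 normr0; under eq_fun do rewrite normrM ger0_norm//.
split.
- apply: (@cvg_dist_squeeze _ (fun n => n%:R * (`|c n - r n| + `|s n|))).
    near=> n; have n0 : n%:R != 0 :> R by rewrite pnatr_eq0 -lt0n; near: n; exists 1%N.
    have -> : expR (- v) = r n ^+ n.
      by rewrite /r -expRM_natl mulrC divfK.
    exact: hC.
  rewrite -[X in _ --> X](addr0 0).
  rewrite (_ : (fun n => _) = (fun n => n%:R * `|c n - r n| + n%:R * `|s n|)); last first.
    by apply/funext => n; rewrite mulrDr.
  exact: cvgD.
- apply: (@cvg_dist_squeeze _ (fun n => n%:R * `|s n|)) => //.
  by near=> n; rewrite subr0.
Unshelve. all: by end_near. Qed.

End power_limit.

Section char_expansion.
Context (R : realType) d (Omega : measurableType d) (P : probability Omega R).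

Lemma Rintegral_dominated_cvg0 (F : nat -> Omega -> R) (G : Omega -> R) :
  (forall n, measurable_fun setT (F n)) -> P.-integrable setT (EFin \o G) ->
  (forall n w, `|F n w| <= G w) ->
  (forall w, (fun n => F n w) @ \oo --> (0 : R)) ->
  (fun n => \int[P]_w F n w) @ \oo --> (0 : R).
Proof.
move=> mF iG FG F0.
have h1 n : measurable_fun setT (fun w => (F n w)%:E) by exact/measurable_EFinP.
have h2 : measurable_fun setT (cst 0%E : Omega -> \bar R) by exact: measurable_cst.
have h3 : {ae P, forall w, setT w -> (fun n => (F n w)%:E) @ \oo --> cst 0%E w}.
  by apply: aeW => w _; apply: cvg_EFin; [near=> n|exact: F0].
have h4 : {ae P, forall w n, setT w -> (`|(F n w)%:E| <= (EFin \o G) w)%E}.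
  by apply: aeW => w n _; rewrite lee_fin.
have [_ _] := @dominated_convergence _ _ _ P setT measurableT _ _ _ h1 h2 h3 iG h4.
by rewrite integral0 => /fine_cvg.
Unshelve. all: by end_near. Qed.

Lemma bounded_integrable (f : Omega -> R) (M : R) :
  measurable_fun setT f -> (forall w, `|f w| <= M) ->
  P.-integrable setT (EFin \o f).
Proof.
move=> mf fM; apply: (@le_integrable _ _ _ P setT measurableT _ (cst M%:E)).
- exact/measurable_EFinP.
- move=> w _ /=; rewrite lee_fin; apply: le_trans (fM w) (ler_norm _).
- exact: finite_measure_integrable_cst.
Qed.

Lemma measurable_cos_comp (f : Omega -> R) :
  measurable_fun setT f -> measurable_fun setT (fun w => cos (f w)).
Proof.
move=> mf; apply: (measurableT_comp (f := cos)) => //.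
by apply: continuous_measurable_fun; exact: continuous_cos.
Qed.

Lemma measurable_sin_comp (f : Omega -> R) :
  measurable_fun setT f -> measurable_fun setT (fun w => sin (f w)).
Proof.
move=> mf; apply: (measurableT_comp (f := sin)) => //.
by apply: continuous_measurable_fun; exact: continuous_sin.
Qed.

Lemma integrable_cos (f : Omega -> R) : measurable_fun setT f ->
  P.-integrable setT (EFin \o (fun w => cos (f w))).
Proof.
move=> mf; apply: (@bounded_integrable _ 1); first exact: measurable_cos_comp.
by move=> w; exact: cos_max.
Qed.

Lemma integrable_sin (f : Omega -> R) : measurable_fun setT f ->
  P.-integrable setT (EFin \o (fun w => sin (f w))).
Proof.
move=> mf; apply: (@bounded_integrable _ 1); first exact: measurable_sin_comp.
by move=> w; exact: sin_max.
Qed.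

Lemma norm_Rintegral_le (f : Omega -> R) (M : R) :
  measurable_fun setT f -> (forall w, `|f w| <= M) -> `|\int[P]_w f w| <= M.
Proof.
move=> mf fM; have fi := bounded_integrable mf fM.
apply: (le_trans (le_normr_Rintegral measurableT fi)).
have -> : M = \int[P]_w (cst M w).
  have P1 : fine (P setT) = 1 by rewrite probability_setT.
  by rewrite Rintegral_cst// P1 mulr1.
apply: le_Rintegral => //; first exact: integrable_norm.
exact: finite_measure_integrable_cst.
Qed.

Section expansion.
Variables (Y : Omega -> R).
Hypotheses (mY : measurable_fun setT Y)
  (iY2 : P.-integrable setT (EFin \o (fun w => Y w ^+ 2))).

Lemma integrable_of_sqr : P.-integrable setT (EFin \o Y).
Proof.
have i1 : P.-integrable setT (EFin \o (fun w => 1 + Y w ^+ 2)).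
  by apply: integrableD_fin => //; exact: finite_measure_integrable_cst.
apply: (le_integrable measurableT _ _ i1); first exact/measurable_EFinP.
move=> w _ /=; rewrite lee_fin [leRHS]ger0_norm ?addr_ge0 ?sqr_ge0//.
rewrite -(real_normK (num_real (Y w))); have := normr_ge0 (Y w); nra.
Qed.

Let h n : R := (Num.sqrt n%:R)^-1.

Let h2 n : n != 0%N -> h n ^+ 2 = n%:R^-1.
Proof. by move=> n0; rewrite /h exprVn sqr_sqrtr. Qed.

Let cvg_invn : (fun n => n%:R^-1) @ \oo --> (0 : R).
Proof.
apply/gtr0_cvgV0; last exact: cvgr_idn.
by near=> n; rewrite ltr0n; near: n; exists 1%N.
Unshelve. all: by end_near. Qed.

Let cvg_h : h @ \oo --> (0 : R).
Proof.
rewrite -(@sqrtr0 R) /h.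
rewrite (_ : (fun n => _) = (fun n : nat => Num.sqrt (n%:R^-1))); last first.
  by apply/funext => n; rewrite sqrtrV.
by apply: (cvg_comp _ _ cvg_invn); exact: sqrt_continuous.
Qed.

(** Dominated convergence for [n] times the Taylor remainder at scale [1 / sqrt n]: it is at most
    [Y^2 / 2], and pointwise of order [Y^4 / n]. *)
Lemma cvg_cos_expansion :
  (fun n => n%:R * (\int[P]_w cos (Y w / Num.sqrt n%:R) - 1 +
     (\int[P]_w (Y w ^+ 2)) / 2 / n%:R)) @ \oo --> (0 : R).
Proof.
pose F n w := n%:R * (cos (Y w * h n) - 1 + (Y w * h n) ^+ 2 / 2).
have mYh n : measurable_fun setT (fun w => Y w * h n) by exact: measurable_funM.
have ic n : P.-integrable setT (EFin \o (fun w => cos (Y w * h n) - 1)).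
  by apply: integrableB_fin; [exact: integrable_cos|exact: finite_measure_integrable_cst].
have iq n : P.-integrable setT (EFin \o (fun w => (Y w * h n) ^+ 2 / 2)).
  rewrite [X in integrable _ _ X](_ : _ = (fun w => (h n ^+ 2 / 2)%:E * (Y w ^+ 2)%:E)%E).
    exact: integrableZl.
  by apply/funext => w /=; rewrite -EFinM; congr EFin; ring.
have mF n : measurable_fun setT (F n).
  apply: measurable_funM => //; apply: measurable_funD.
    by apply: measurable_funB => //; exact: measurable_cos_comp.
  by apply: measurable_funM => //; exact: measurable_funX.
have i2 : P.-integrable setT (EFin \o (fun w => Y w ^+ 2 / 2)).
  exact: integrableZr_fin.
have FG n w : `|F n w| <= Y w ^+ 2 / 2.
  have [->|n0] := eqVneq n 0%N.
    by rewrite /F mul0r normr0 divr_ge0// sqr_ge0.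
  rewrite /F normrM ger0_norm//.
  apply: (@le_trans _ _ (n%:R * ((Y w * h n) ^+ 2 / 2))).
    by rewrite ler_wpM2l// norm_cos_taylor2_le2.
  rewrite exprMn h2//.
  suff -> : n%:R * (Y w ^+ 2 / n%:R / 2) = Y w ^+ 2 / 2 by [].
  by field; rewrite pnatr_eq0.
have F0 w : (fun n => F n w) @ \oo --> (0 : R).
  apply: (@cvg_dist_squeeze _ _ (fun n => Y w ^+ 4 / 2 * n%:R^-1)).
    near=> n; have n0 : n != 0%N by rewrite -lt0n; near: n; exists 1%N.
    rewrite subr0 /F normrM ger0_norm//.
    apply: (@le_trans _ _ (n%:R * ((Y w * h n) ^+ 4 / 2))).
      by rewrite ler_wpM2l// norm_cos_taylor2_le4.
    rewrite exprMn (exprM (h n) 2 2) h2//.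
    suff -> : n%:R * (Y w ^+ 4 * n%:R^-1 ^+ 2 / 2) = Y w ^+ 4 / 2 * n%:R^-1 by [].
    by field; rewrite pnatr_eq0.
  by rewrite -[X in _ --> X](mulr0 (Y w ^+ 4 / 2)); apply: cvgMr.
have := Rintegral_dominated_cvg0 mF i2 FG F0.
apply: cvg_trans; apply: near_eq_cvg; near=> n.
have n0 : n != 0%N by rewrite -lt0n; near: n; exists 1%N.
rewrite /F RintegralZl//; last first.
  exact: integrableD_fin.
rewrite RintegralD// RintegralB//; last 2 first.
  exact: integrable_cos.
  exact: finite_measure_integrable_cst.
have P1 : fine (P setT) = 1 by rewrite probability_setT.
rewrite Rintegral_cst// P1 mulr1; congr (_ * (_ + _)).
have -> : (fun w => (Y w * h n) ^+ 2 / 2) = (fun w => (n%:R^-1 / 2) * Y w ^+ 2).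
  by apply/funext => w; rewrite exprMn h2//; ring.
by rewrite RintegralZl//; ring.
Unshelve. all: by end_near. Qed.

(** Same argument after subtracting the first-order term, whose integral is zero by centering. *)
Lemma cvg_sin_expansion : \int[P]_w Y w = 0 ->
  (fun n => n%:R * \int[P]_w sin (Y w / Num.sqrt n%:R)) @ \oo --> (0 : R).
Proof.
move=> Y0.
pose F n w := n%:R * (Y w * h n - sin (Y w * h n)).
have mYh n : measurable_fun setT (fun w => Y w * h n) by exact: measurable_funM.
have iYh n : P.-integrable setT (EFin \o (fun w => Y w * h n)).
  by apply: integrableZr_fin; exact: integrable_of_sqr.
have mF n : measurable_fun setT (F n).
  apply: measurable_funM => //; apply: measurable_funB => //.
  exact: measurable_sin_comp.
have i2 : P.-integrable setT (EFin \o (fun w => 2 * Y w ^+ 2)) by exact: integrableZl_fin.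
have FG n w : `|F n w| <= 2 * Y w ^+ 2.
  have [->|n0] := eqVneq n 0%N.
    by rewrite /F mul0r normr0 mulr_ge0// sqr_ge0.
  rewrite /F normrM ger0_norm//.
  apply: (@le_trans _ _ (n%:R * (2 * (Y w * h n) ^+ 2))).
    by rewrite ler_wpM2l// norm_sub_sin_le2.
  rewrite exprMn h2//.
  suff -> : n%:R * (2 * (Y w ^+ 2 / n%:R)) = 2 * Y w ^+ 2 by [].
  by field; rewrite pnatr_eq0.
have F0 w : (fun n => F n w) @ \oo --> (0 : R).
  apply: (@cvg_dist_squeeze _ _ (fun n => `|Y w| ^+ 3 / 2 * h n)).
    near=> n; have n0 : n != 0%N by rewrite -lt0n; near: n; exists 1%N.
    rewrite subr0 /F normrM ger0_norm//.
    apply: (@le_trans _ _ (n%:R * (`|Y w * h n| ^+ 3 / 2))).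
      by rewrite ler_wpM2l// norm_sub_sin_le.
    have hn0 : 0 <= h n by rewrite invr_ge0 sqrtr_ge0.
    rewrite normrM (ger0_norm hn0) exprMn (exprSr (h n) 2) h2//.
    suff -> : n%:R * (`|Y w| ^+ 3 * (n%:R^-1 * h n) / 2) = `|Y w| ^+ 3 / 2 * h n by [].
    by field; rewrite pnatr_eq0.
  by rewrite -[X in _ --> X](mulr0 (`|Y w| ^+ 3 / 2)); apply: cvgMr.
have : (fun n => - \int[P]_w F n w) @ \oo --> (- 0 : R).
  by apply: cvgN; exact: Rintegral_dominated_cvg0 FG F0.
rewrite oppr0; apply: cvg_trans; apply: near_eq_cvg; near=> n.
rewrite /F RintegralZl//; last first.
  by apply: integrableB_fin => //; exact: integrable_sin.
rewrite RintegralB//; last exact: integrable_sin.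
rewrite RintegralZr//; last exact: integrable_of_sqr.
by rewrite Y0 mul0r sub0r mulrN opprK.
Unshelve. all: by end_near. Qed.

End expansion.

End char_expansion.

Section product_expectation.
Context (R : realType) d1 d2 (T1 : measurableType d1) (T2 : measurableType d2)
  (P1 : probability T1 R) (P2 : probability T2 R).

Lemma Rintegral_prodM (f : T1 -> R) (g : T2 -> R) (M : R) :
  measurable_fun setT f -> measurable_fun setT g ->
  (forall x, `|f x| <= M) -> (forall x, `|g x| <= M) ->
  (P1 \x P2)%E.-integrable setT (EFin \o (fun z : T1 * T2 => f z.1 * g z.2)) /\
  \int[(P1 \x P2)%E]_z (f z.1 * g z.2) = (\int[P1]_x f x) * (\int[P2]_x g x).
Proof.
move=> mf mg fM gM.
have fi := bounded_integrable P1 mf fM; have gi := bounded_integrable P2 mg gM.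
have mfg : measurable_fun setT (fun z : T1 * T2 => f z.1 * g z.2).
  apply: measurable_funM.
    exact: (measurableT_comp mf measurable_fst).
  exact: (measurableT_comp mg measurable_snd).
have bfg z : `|f z.1 * g z.2| <= M * M by rewrite normrM ler_pM.
have ifg : (P1 \x P2)%E.-integrable setT (EFin \o (fun z : T1 * T2 => f z.1 * g z.2)).
  exact: (bounded_integrable (P1 \x P2)%E mfg bfg).
split=> //.
rewrite /Rintegral -(integral12_prod_meas1 ifg) -fineM ?integrable_fin_num//.
congr fine.
have gfin := integrable_fin_num measurableT gi.
transitivity (\int[P1]_x ((f x)%:E * (\int[P2]_y (g y)%:E)))%E.
  apply: eq_integral => x _; rewrite /fubini_F/=.
  by under eq_integral => y _ do rewrite EFinM; rewrite integralZl.
by rewrite -(fineK gfin) integralZr.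
Qed.

End product_expectation.

Section central_limit.
Context (R : realType) (d d' : measure_display)
  (Omega : measurableType d) (X : measurableType d')
  (P : probability Omega R) (nu : probability X R)
  (eta : nat -> {mfun Omega >-> X}).
Hypothesis heta : iid_with_distribution P nu eta.

(** Independence and the addition formulas give the real and imaginary parts the recursion of
    complex multiplication by the characteristic function of one term, which is the setting of
    [cvg_char_powers]. *)
Lemma clt_cos_sin (h : X -> R) : measurable_fun setT h ->
  nu.-integrable setT (EFin \o (fun x => h x ^+ 2)) ->
  \int[nu]_x h x = 0 ->
  (fun n => \int[P]_w cos ((\sum_(1 <= i < n.+1) h (eta i w)) / Num.sqrt n%:R)) @ \oo -->
    expR (- ((\int[nu]_x h x ^+ 2) / 2)) /\
  (fun n => \int[P]_w sin ((\sum_(1 <= i < n.+1) h (eta i w)) / Num.sqrt n%:R)) @ \oo -->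
    (0 : R).
Proof.
move=> mh ih h0.
pose v : R := (\int[nu]_x h x ^+ 2) / 2.
have v0 : 0 <= v by rewrite divr_ge0// Rintegral_ge0// => x _; exact: sqr_ge0.
pose S k w := \sum_(1 <= i < k.+1) h (eta i w).
have mS k : measurable_fun setT (S k).
  rewrite /S; under eq_fun do rewrite big_add1/= big_mkord.
  by apply: measurable_sum => i; exact: measurableT_comp.
have mSn n k : measurable_fun setT (fun w => S k w / Num.sqrt n%:R).
  exact: measurable_funM.
have mhn n : measurable_fun setT (fun x => h x / Num.sqrt n%:R).
  exact: measurable_funM.
have mhen n k : measurable_fun setT (fun w => h (eta k w) / Num.sqrt n%:R).
  by apply: measurable_funM => //; exact: measurableT_comp.
pose C n k := \int[P]_w cos (S k w / Num.sqrt n%:R).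
pose D n k := \int[P]_w sin (S k w / Num.sqrt n%:R).
pose c n := \int[nu]_x cos (h x / Num.sqrt n%:R).
pose s n := \int[nu]_x sin (h x / Num.sqrt n%:R).
have cE n k : \int[P]_w cos (h (eta k w) / Num.sqrt n%:R) = c n.
  by rewrite /Rintegral (integral_iid heta k (integrable_cos nu (mhn n))).
have sE n k : \int[P]_w sin (h (eta k w) / Num.sqrt n%:R) = s n.
  by rewrite /Rintegral (integral_iid heta k (integrable_sin nu (mhn n))).
have mc n : measurable_fun setT (fun x : R => cos (x / Num.sqrt n%:R)).
  by apply: measurable_cos_comp; exact: measurable_funM.
have ms n : measurable_fun setT (fun x : R => sin (x / Num.sqrt n%:R)).
  by apply: measurable_sin_comp; exact: measurable_funM.
have ind k := iid_sum_independent heta.1 k mh.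
have prodE (f1 f2 : R -> R) n k : measurable_fun setT f1 -> measurable_fun setT f2 ->
    P.-integrable setT (EFin \o (fun w => f1 (S k w / Num.sqrt n%:R))) ->
    P.-integrable setT (EFin \o (fun w => f2 (h (eta k.+1 w) / Num.sqrt n%:R))) ->
    P.-integrable setT (EFin \o (fun w => f1 (S k w / Num.sqrt n%:R) *
      f2 (h (eta k.+1 w) / Num.sqrt n%:R))) /\
    \int[P]_w (f1 (S k w / Num.sqrt n%:R) * f2 (h (eta k.+1 w) / Num.sqrt n%:R)) =
    (\int[P]_w f1 (S k w / Num.sqrt n%:R)) * (\int[P]_w f2 (h (eta k.+1 w) / Num.sqrt n%:R)).
  move=> mf1 mf2.
  have m1 : measurable_fun setT (fun x : R => f1 (x / Num.sqrt n%:R)).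
    by apply: (measurableT_comp mf1); exact: measurable_funM.
  have m2 : measurable_fun setT (fun x : R => f2 (x / Num.sqrt n%:R)).
    by apply: (measurableT_comp mf2); exact: measurable_funM.
  exact: integrable_independentM (independent_pair_comp m1 m2 (ind k)).
have mcos : measurable_fun setT (@cos R).
  by apply: continuous_measurable_fun; exact: continuous_cos.
have msin : measurable_fun setT (@sin R).
  by apply: continuous_measurable_fun; exact: continuous_sin.
have SE n k w : S k.+1 w / Num.sqrt n%:R =
    S k w / Num.sqrt n%:R + h (eta k.+1 w) / Num.sqrt n%:R.
  by rewrite /S big_nat_recr//= mulrDl.
apply: (@cvg_char_powers R v c s C D) => //.
- by move=> n k; apply: norm_Rintegral_le => [|w]; [exact: measurable_cos_comp|exact: cos_max].
- by move=> n k; apply: norm_Rintegral_le => [|w]; [exact: measurable_sin_comp|exact: sin_max].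
- by move=> n; apply: norm_Rintegral_le => [|w]; [exact: measurable_cos_comp|exact: cos_max].
- move=> n; rewrite /C (_ : (fun w => _) = cst 1); last first.
    by apply/funext => w; rewrite /S big_geq// mul0r cos0.
  have P1 : fine (P setT) = 1 by rewrite probability_setT.
  by rewrite Rintegral_cst// P1 mulr1.
- move=> n; rewrite /D (_ : (fun w => _) = cst 0); last first.
    by apply/funext => w; rewrite /S big_geq// mul0r sin0.
  by rewrite Rintegral_cst// mul0r.
- move=> n k; rewrite /C /D.
  under eq_Rintegral => w _ do rewrite SE cosD.
  have [i1 e1] := prodE cos cos n k mcos mcos (integrable_cos P (mSn n k)) (integrable_cos P (mhen n k.+1)).
  have [i2 e2] := prodE sin sin n k msin msin (integrable_sin P (mSn n k)) (integrable_sin P (mhen n k.+1)).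
  by rewrite RintegralB// e1 e2 cE sE.
- move=> n k; rewrite /C /D.
  under eq_Rintegral => w _ do rewrite SE sinD.
  have [i1 e1] := prodE sin cos n k msin mcos (integrable_sin P (mSn n k)) (integrable_cos P (mhen n k.+1)).
  have [i2 e2] := prodE cos sin n k mcos msin (integrable_cos P (mSn n k)) (integrable_sin P (mhen n k.+1)).
  by rewrite RintegralD// e1 e2 cE sE.
- exact: cvg_cos_expansion.
- exact: cvg_sin_expansion.
Qed.

(** The phase lets one real statement carry both parts, in the shape of the generators of
    [trig_poly]. *)
Lemma clt_cos_shift (h : X -> R) (phi : R) : measurable_fun setT h ->
  nu.-integrable setT (EFin \o (fun x => h x ^+ 2)) ->
  \int[nu]_x h x = 0 ->
  (fun n => \int[P]_w cos ((\sum_(1 <= i < n.+1) h (eta i w)) / Num.sqrt n%:R + phi)) @ \oo -->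
    cos phi * expR (- ((\int[nu]_x h x ^+ 2) / 2)).
Proof.
move=> mh ih h0; have [cc cs] := clt_cos_sin mh ih h0.
have mS n : measurable_fun setT
    (fun w => (\sum_(1 <= i < n.+1) h (eta i w)) / Num.sqrt n%:R).
  apply: measurable_funM => //; under eq_fun do rewrite big_add1/= big_mkord.
  by apply: measurable_sum => i; exact: measurableT_comp.
have -> : (fun n => \int[P]_w cos ((\sum_(1 <= i < n.+1) h (eta i w)) / Num.sqrt n%:R + phi)) =
  (fun n => cos phi * (\int[P]_w cos ((\sum_(1 <= i < n.+1) h (eta i w)) / Num.sqrt n%:R)) -
   sin phi * (\int[P]_w sin ((\sum_(1 <= i < n.+1) h (eta i w)) / Num.sqrt n%:R))).
  apply/funext => n.
  under eq_Rintegral => w _ do rewrite cosD mulrC [X in _ - X]mulrC.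
  have i1 := integrable_cos P (mS n); have i2 := integrable_sin P (mS n).
  rewrite RintegralB//; [|exact: integrableZl_fin|exact: integrableZl_fin].
  by rewrite !RintegralZl.
rewrite -[X in _ --> X]subr0 -[X in _ - X](mulr0 (sin phi)).
by apply: cvgB; apply: cvgMr.
Qed.

End central_limit.

(** * Gaussian variables *)

Section normal_law.
Context (R : realType).
Notation mu := (@lebesgue_measure R).
Implicit Types (m s b x : R).

(** The density and the Radon-Nikodym derivative have the same integral over every measurable set,
    so they agree almost everywhere. *)
Lemma ge0_integral_normal_prob m s (f : R -> \bar R) :
  measurable_fun setT f -> (forall x, (0 <= f x)%E) ->
  (\int[normal_prob m s]_x f x = \int[mu]_x (f x * (normal_pdf m s x)%:E))%E.
Proof.
move=> mf f0.
have dom := normal_prob_dominates m s.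
rewrite -(Radon_Nikodym_SigmaFinite.change_of_variables dom f0 measurableT mf).
have intF := Radon_Nikodym_SigmaFinite.f_integrable dom.
have mp : measurable_fun setT (EFin \o normal_pdf m s).
  by apply/measurable_EFinP; exact: measurable_normal_pdf.
have mF := measurable_int _ intF.
have := integral_ae_eq measurableT intF mp.
move=> /(_ _)/wrap[A _ mA|].
  by rewrite -Radon_Nikodym_SigmaFinite.f_integral.
move=> ae; apply: ae_eq_integral => //; [exact: emeasurable_funM|exact: emeasurable_funM|].
by apply: filterS ae => x h _ /=; rewrite h.
Qed.

Lemma normal_pdf_tilt m s b x : s != 0 ->
  expR (b * x) * normal_pdf m s x =
  expR (b * m + b ^+ 2 * s ^+ 2 / 2) * normal_pdf (m + b * s ^+ 2) s x.
Proof.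
move=> s0; rewrite !normal_pdfE// mulrCA [RHS]mulrCA; congr (_ * _).
rewrite /normal_fun -!expRD; congr expR.
have -> : s ^+ 2 *+ 2 = 2 * s ^+ 2 by rewrite mulr2n; ring.
field.
by rewrite s0.
Qed.

Lemma normal_mgf m s b : s != 0 ->
  (\int[normal_prob m s]_x (expR (b * x))%:E =
   (expR (b * m + b ^+ 2 * s ^+ 2 / 2))%:E)%E.
Proof.
move=> s0; rewrite ge0_integral_normal_prob; last 2 first.
  by apply/measurable_EFinP; apply: (measurableT_comp (@measurable_expR R)).
  by move=> x; rewrite lee_fin expR_ge0.
under eq_integral => x _ do rewrite -EFinM normal_pdf_tilt// EFinM.
rewrite ge0_integralZl_EFin ?expR_ge0//; first by rewrite integral_normal_pdf mule1.
- by move=> x _; rewrite lee_fin normal_pdf_ge0.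
- by apply/measurable_EFinP; exact: measurable_normal_pdf.
Qed.

(** The density never exceeds its peak, which is at most [1 / (2 s)] because [2 pi >= 4]. *)
Lemma normal_prob_itv_le m s x y : 0 < s -> x <= y ->
  (normal_prob m s `[x, y]%classic <= ((y - x) / (2 * s))%:E)%E.
Proof.
move=> s0 xy.
have s00 : s != 0 by rewrite gt_eqF.
apply: (@le_trans _ _ (\int[mu]_(z in `[x, y]) (normal_peak s)%:E)%E).
  apply: ge0_le_integral => //.
  - by move=> z _; rewrite lee_fin normal_pdf_ge0.
  - by apply/measurable_EFinP; apply: measurable_funTS; exact: measurable_normal_pdf.
  - by move=> z _; rewrite lee_fin; exact: normal_pdf_ub.
rewrite integral_cst//= lebesgue_measure_itv/= lte_fin.
have pk : normal_peak s <= (2 * s)^-1.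
  rewrite /normal_peak lef_pV2 ?posrE ?mulr_gt0//; last first.
    by rewrite sqrtr_gt0 mulrn_wgt0// mulr_gt0// ?pi_gt0// exprn_gt0.
  have -> : 2 * s = Num.sqrt ((2 * s) ^+ 2) by rewrite sqrtr_sqr ger0_norm// mulr_ge0// ltW.
  apply: ler_wsqrtr; have := pi_ge2 R; rewrite mulr2n.
  have : 0 <= s ^+ 2 by exact: sqr_ge0.
  nra.
case: ltgtP xy => // [xy _|-> _]; last by rewrite mule0 subrr mul0r.
rewrite -EFinD -EFinM lee_fin mulrC ler_wpM2l//.
by rewrite subr_ge0 ltW.
Qed.

Lemma ge0_integral_oppr (f : R -> \bar R) :
  measurable_fun setT f -> (forall x, (0 <= f x)%E) ->
  (\int[mu]_x f (- x)%R = \int[mu]_x f x)%E.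
Proof.
move=> mf f0.
transitivity (\int[pushforward mu (-%R : measurableTypeR R -> measurableTypeR R)]_x f x)%E.
  by rewrite ge0_integral_pushforward//.
apply: eq_measure_integral => A mA _.
exact: lebesgue_measureN.
Qed.

(* Rotation of the plane by 45 degrees, the source of the functional equation
   [cos_normal_sqr] for the characteristic function. *)
Lemma normal_pdf_rotate s x y : s != 0 ->
  Num.sqrt 2 * (normal_pdf 0 s (Num.sqrt 2 * x - y) * normal_pdf 0 s y) =
  normal_pdf 0 s x * normal_pdf (x / Num.sqrt 2) (s / Num.sqrt 2) y.
Proof.
move=> s0.
have [c [c0 c2 ->]] : exists c : R, [/\ 0 < c, c ^+ 2 = 2 & Num.sqrt 2 = c].
  by exists (Num.sqrt 2); rewrite sqrtr_gt0 sqr_sqrtr.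
have sc0 : s / c != 0 by rewrite mulf_neq0// invr_eq0 gt_eqF.
rewrite !normal_pdfE//.
have pk : normal_peak (s / c) = c * normal_peak s.
  rewrite /normal_peak exprMn exprVn c2.
  have -> : s ^+ 2 / 2 * pi *+ 2 = (s ^+ 2 * pi *+ 2) / 2.
    by rewrite !mulr2n; field.
  rewrite sqrtrM; last by rewrite mulrn_wge0// mulr_ge0 ?sqr_ge0 ?pi_ge0.
  have -> : Num.sqrt (2^-1) = c^-1 :> R.
    by rewrite -c2 sqrtrV ?sqr_ge0// sqrtr_sqr ger0_norm// ltW.
  by rewrite invfM invrK mulrC.
rewrite pk.
transitivity ((c * normal_peak s * normal_peak s) *
  (normal_fun 0 s (c * x - y) * normal_fun 0 s y)); first by ring.
transitivity ((c * normal_peak s * normal_peak s) *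
  (normal_fun 0 s x * normal_fun (x / c) (s / c) y)); last by ring.
congr (_ * _); rewrite /normal_fun -!expRD; congr expR.
rewrite !exprMn !exprVn c2 !subr0.
have -> : s ^+ 2 *+ 2 = 2 * s ^+ 2 by rewrite mulr2n; ring.
have -> : s ^+ 2 / 2 *+ 2 = s ^+ 2 by rewrite mulr2n; field.
have -> : (y - x / c) ^+ 2 = y ^+ 2 - 2 * (x / c) * y + x ^+ 2 / 2.
  have -> : x ^+ 2 / 2 = x ^+ 2 / c ^+ 2 by rewrite c2.
  by field; rewrite gt_eqF.
have -> : (c * x - y) ^+ 2 = 2 * x ^+ 2 - 2 * c * x * y + y ^+ 2.
  by transitivity (c ^+ 2 * x ^+ 2 - 2 * c * x * y + y ^+ 2); [ring|rewrite c2].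
have -> : x / c = c * x / 2 by rewrite -c2; field; rewrite gt_eqF.
by field.
Qed.

End normal_law.

(** * Characteristic function of a centered normal law *)

Section normal_cf.
Context (R : realType).
Notation mu := (@lebesgue_measure R).
Variables (s : R).
Hypothesis s0 : 0 < s.
Let s00 : s != 0. Proof. by rewrite gt_eqF. Qed.
Let N : probability (measurableTypeR R) R := normal_prob 0 s.
Let p := normal_pdf 0 s.

Let p_ge0 x : 0 <= p x. Proof. exact: normal_pdf_ge0. Qed.

Let NE (f : R -> \bar R) : measurable_fun setT f -> (forall x, (0 <= f x)%E) ->
  (\int[N]_x f x = \int[mu]_x (f x * (p x)%:E))%E.
Proof. exact: ge0_integral_normal_prob. Qed.

Let mp : measurable_fun setT p. Proof. exact: measurable_normal_pdf. Qed.

Let continuous_cos_affine (b y : R) : continuous (fun x : R => 1 + cos (b * (x + y))).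
Proof.
move=> x; apply: cvgD; first exact: cvg_cst.
apply: (cvg_comp (fun x => b * (x + y)) cos); last exact: continuous_cos.
by apply: cvgMr; apply: cvgD; [exact: cvg_id|exact: cvg_cst].
Qed.

(** The density is even. Working with nonnegative integrands, the reflection exchanges [1 + sin] and
    [1 - sin]. *)
Lemma sin_normal_eq0 (b : R) : \int[N]_x sin (b * x) = 0.
Proof.
have mb : measurable_fun setT (fun x : R => b * x) by exact: measurable_funM.
have is_ := integrable_sin N mb.
have i1 (e : R) : (\int[N]_x (1 + e * sin (b * x))%:E)%E = (1 + e * \int[N]_x sin (b * x))%:E.
  have h : N.-integrable setT (EFin \o (fun x => 1 + e * sin (b * x))).
    apply: integrableD_fin; first exact: finite_measure_integrable_cst.
    exact: integrableZl_fin.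
  rewrite -(fineK (integrable_fin_num measurableT h)); congr EFin.
  rewrite -/(Rintegral _ _ _) RintegralD//; last exact: integrableZl_fin.
    have P1 : fine (N setT) = 1 by rewrite probability_setT.
    by rewrite Rintegral_cst// P1 mulr1 RintegralZl.
  exact: finite_measure_integrable_cst.
have g0 (e x : R) : `|e| <= 1 -> 0 <= 1 + e * sin (b * x).
  move=> e1; have h : `|e * sin (b * x)| <= 1.
    by rewrite normrM mulr_ile1// sin_max.
  by move: h; rewrite ler_norml => /andP[h _]; lra.
have m1 (e : R) : measurable_fun setT (fun x : R => (1 + e * sin (b * x))%:E).
  apply/measurable_EFinP; apply: measurable_funD => //.
  by apply: measurable_funM => //; exact: measurable_sin_comp.
have : (\int[N]_x (1 + 1 * sin (b * x))%:E = \int[N]_x (1 + -1 * sin (b * x))%:E)%E.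
  have g1 x : (0 <= (1 + 1 * sin (b * x))%:E)%E by rewrite lee_fin g0// normr1.
  have g2 x : (0 <= (1 + -1 * sin (b * x))%:E)%E by rewrite lee_fin g0// normrN1.
  rewrite (NE (m1 1) g1) (NE (m1 (-1)) g2).
  rewrite -[LHS]ge0_integral_oppr; last 2 first.
    apply: emeasurable_funM => //; exact/measurable_EFinP.
    by move=> x; rewrite mule_ge0// lee_fin ?g0 ?normr1//; exact: p_ge0.
  apply: eq_integral => x _; congr (_%:E * _%:E)%E.
    by rewrite mulrN sinN mul1r mulN1r.
  by rewrite /p !normal_pdfE// /normal_fun !subr0 sqrrN.
by rewrite !i1 => -[]; lra.
Qed.

(** The integral of [1 + cos (b (x + y))] against two independent copies is computed twice. The
    addition formula gives [1] plus the square, the sine part being zero. Substituting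
    [sqrt 2 * x - y] for the first variable and applying [normal_pdf_rotate], the second variable
    integrates out to 1. The added 1 keeps all integrands nonnegative. *)
Lemma cos_normal_sqr (b : R) :
  (\int[N]_x cos (b * x)) ^+ 2 = \int[N]_x cos (b * Num.sqrt 2 * x).
Proof.
pose c : R := Num.sqrt 2.
have c0 : 0 < c by rewrite sqrtr_gt0.
have mb (a : R) : measurable_fun setT (fun x : R => a * x) by exact: measurable_funM.
have i1 (a : R) : (\int[N]_x (1 + cos (a * x))%:E)%E = (1 + \int[N]_x cos (a * x))%:E.
  have ic := integrable_cos N (mb a).
  have i1 : N.-integrable setT (EFin \o cst 1) by exact: finite_measure_integrable_cst.
  have h := integrableD_fin i1 ic.
  rewrite -(fineK (integrable_fin_num measurableT h)); congr EFin.
  rewrite -/(Rintegral _ _ _) RintegralD//.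
  have P1 : fine (N setT) = 1 by rewrite probability_setT.
  by rewrite Rintegral_cst// P1 mulr1.
have mcos2 : measurable_fun setT (fun z : R * R => (1 + cos (b * (z.1 + z.2)))%:E).
  apply/measurable_EFinP; apply: measurable_funD => //; apply: measurable_cos_comp.
  by apply: measurable_funM => //; exact: measurable_funD.
have lhs : (\int[(N \x N)%E]_z (1 + cos (b * (z.1 + z.2)))%:E =
    (1 + (\int[N]_x cos (b * x)) ^+ 2)%:E)%E.
  have mc : measurable_fun setT (fun x : R => cos (b * x)) by exact: measurable_cos_comp.
  have ms : measurable_fun setT (fun x : R => sin (b * x)) by exact: measurable_sin_comp.
  have [ic ec] := Rintegral_prodM N N mc mc (fun x => cos_max _) (fun x => cos_max _).
  have [iss es] := Rintegral_prodM N N ms ms (fun x => sin_max _) (fun x => sin_max _).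
  move: es; rewrite sin_normal_eq0 mul0r => es.
  have ib := integrableB_fin ic iss.
  have i0 : (N \x N)%E.-integrable setT (EFin \o cst 1).
    apply: (bounded_integrable (N \x N)%E (M := 1)) => // z; by rewrite normr1.
  have h := integrableD_fin i0 ib.
  under eq_integral => z _ do rewrite mulrDr cosD.
  rewrite -(fineK (integrable_fin_num measurableT h)); congr EFin.
  rewrite -/(Rintegral _ _ _) RintegralD// RintegralB// ec es subr0 Rintegral_cst//.
  have P1 : fine ((N \x N)%E setT) = 1 by rewrite probability_setT.
  by rewrite P1 mulr1 expr2.
have rhs : (\int[(N \x N)%E]_z (1 + cos (b * (z.1 + z.2)))%:E =
    \int[N]_x (1 + cos (b * c * x))%:E)%E.
  rewrite fubini_tonelli2//.
  have inner y : (fubini_G N (fun z : R * R => (1 + cos (b * (z.1 + z.2)))%:E) y =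
      \int[mu]_z (c%:E * ((1 + cos (b * c * z)) * p (c * z - y))%:E))%E.
    rewrite /fubini_G/= NE; last 2 first.
    - exact: (measurable_fun_pair1 y mcos2).
    - by move=> x; rewrite lee_fin.
    under eq_integral => x _ do rewrite -EFinM.
    have dF : (fun x : R => c * x - y)^`()%classic = cst c.
      apply/funext => x; rewrite derive1E.
      have h : is_derive x (1 : R) (fun x : R => c * x - y) c.
        by apply: is_derive_eq; rewrite /GRing.scale/=; ring.
      exact: derive_val.
    have subst := @increasing_ge0_integration_by_substitutionT R (fun x => c * x - y)
      (fun x => (1 + cos (b * (x + y))) * p x).
    transitivity (\int[mu]_x ((((fun x => (1 + cos (b * (x + y))) * p x) \o
        (fun x => c * x - y)) * (fun x : R => c * x - y)^`()%classic) x)%:E)%E; last first.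
      apply: eq_integral => x _; rewrite dF !fctE /= -EFinM; congr EFin.
      by rewrite subrK mulrC -mulrA [b * (c * x)]mulrA.
    apply: subst.
    - by move=> u v uv; rewrite ltrD2r ltr_pM2l.
    - by rewrite dF; exact: cst_continuous.
    - by rewrite dF; exact: is_cvg_cst.
    - by rewrite dF; exact: is_cvg_cst.
    - by move=> x; exact: ex_derive.
    - apply/cvgrNyPle => A; near=> x.
      have : x <= (A + y) / c by near: x; apply: nbhs_ninfty_le; exact: num_real.
      by rewrite ler_pdivlMr// mulrC; lra.
    - apply/cvgryPge => A; near=> x.
      have : (A + y) / c <= x by near: x; apply: nbhs_pinfty_ge; exact: num_real.
      by rewrite ler_pdivrMr// mulrC; lra.
    - move=> x; apply: cvgM; first exact: continuous_cos_affine.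
      exact: continuous_normal_pdf.
    - by move=> x; rewrite mulr_ge0.
  pose G1 (z : R * R) := (c%:E * ((1 + cos (b * c * z.1)) * p (c * z.1 - z.2))%:E)%E.
  have mG1 : measurable_fun setT G1.
    apply: emeasurable_funM => //; apply/measurable_EFinP; apply: measurable_funM.
      apply: measurable_funD => //; apply: measurable_cos_comp.
      exact: measurable_funM.
    apply: (measurableT_comp mp); apply: measurable_funB => //.
    exact: measurable_funM.
  have G10 z : (0 <= G1 z)%E by rewrite /G1 -EFinM lee_fin !mulr_ge0// ltW.
  have mG : measurable_fun setT (fun z : R * R => (G1 z * (p z.2)%:E)%E).
    apply: emeasurable_funM => //.
    by apply/measurable_EFinP; apply: (measurableT_comp mp).
  have G0 z : (0 <= G1 z * (p z.2)%:E)%E by rewrite mule_ge0// lee_fin.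
  transitivity (\int[N]_y \int[mu]_z G1 (z, y))%E.
    by apply: eq_integral => y _; exact: inner.
  have mI : measurable_fun (setT : set (measurableTypeR R)) (fubini_G mu G1).
    by apply: measurable_fun_fubini_tonelli_G.
  have I0 y : (0 <= fubini_G mu G1 y)%E.
    by apply: integral_ge0 => z _; exact: (G10 (z, y)).
  rewrite (NE mI I0).
  transitivity (\int[mu]_y \int[mu]_z (G1 (z, y) * (p y)%:E))%E.
    apply: eq_integral => y _; rewrite ge0_integralZr//.
    - exact: (measurable_fun_pair1 y mG1).
    - by rewrite lee_fin.
  rewrite -(@fubini_tonelli _ _ _ _ _ mu mu (fun z : R * R => (G1 z * (p z.2)%:E)%E))//.
  rewrite NE; last 2 first.
  - apply/measurable_EFinP; apply: measurable_funD => //; exact: measurable_cos_comp.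
  - by move=> x; rewrite lee_fin.
  apply: eq_integral => z _ /=.
  under eq_integral => y _.
    rewrite /G1/= -!EFinM.
    rewrite (_ : c * _ * _ = ((1 + cos (b * c * z)) * p z) * normal_pdf (z / c) (s / c) y); last first.
      rewrite -[RHS]mulrA /p -normal_pdf_rotate// -/c; ring.
    rewrite EFinM; over.
  rewrite ge0_integralZl_EFin//.
  - by rewrite integral_normal_pdf mule1 EFinM.
  - by move=> y _; rewrite lee_fin normal_pdf_ge0.
  - by apply/measurable_EFinP; exact: measurable_normal_pdf.
  - by rewrite mulr_ge0.
by have := lhs; rewrite rhs i1 => -[]; lra.
Unshelve. all: by end_near. Qed.

(** Iterating [cos_normal_sqr], the value at [b] equals, for every [k], the power [2^k] of the value
    at [b / sqrt (2^k)]; the second-order expansion gives the limit of these powers. The second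
    moment appears as an integral and is never evaluated. *)
Lemma cos_normal (b : R) : N.-integrable setT (EFin \o (fun x : R => x ^+ 2)) ->
  \int[N]_x cos (b * x) = expR (- (b ^+ 2 * (\int[N]_x (x ^+ 2)) / 2)).
Proof.
move=> i2.
have mb (a : R) : measurable_fun setT (fun x : R => a * x) by exact: measurable_funM.
have i2b : N.-integrable setT (EFin \o (fun x : R => (b * x) ^+ 2)).
  under eq_fun do rewrite exprMn.
  exact: integrableZl_fin.
have Vb : \int[N]_x ((b * x) ^+ 2) = b ^+ 2 * \int[N]_x (x ^+ 2).
  under eq_Rintegral do rewrite exprMn.
  by rewrite RintegralZl.
pose c n := \int[N]_x cos (b * x / Num.sqrt n%:R).
pose v := b ^+ 2 * (\int[N]_x (x ^+ 2)) / 2.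
have v0 : 0 <= v.
  by rewrite divr_ge0// mulr_ge0 ?sqr_ge0// Rintegral_ge0// => x _; exact: sqr_ge0.
have c1 n : `|c n| <= 1.
  apply: norm_Rintegral_le => [|w]; last exact: cos_max.
  by apply: measurable_cos_comp; exact: measurable_funM.
have := @cvg_cos_expansion R _ (measurableTypeR R) N (fun x => b * x) (mb b) i2b; rewrite Vb -/v => cc.
have [lim _] : (fun n => c n ^+ n) @ \oo --> expR (- v) /\ (fun n : nat => 0) @ \oo --> (0 : R).
  apply: (@cvg_char_powers R v c (fun=> 0) (fun n k => c n ^+ k) (fun _ _ => 0)) => //.
  - by move=> n k; rewrite normrX exprn_ile1.
  - by move=> n k; rewrite normr0.
  - by move=> n k; rewrite exprSr mul0r subr0.
  - by move=> n k; rewrite mul0r mulr0 addr0.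
  - under eq_fun do rewrite mulr0.
    exact: cvg_cst.
have key k : \int[N]_x cos (b * x) = c (2 ^ k)%N ^+ (2 ^ k).
  elim: k => [|k IH].
    by rewrite expn0 expr1 /c; under [RHS]eq_Rintegral do rewrite sqrtr1 divr1.
  rewrite IH expnSr exprM [in RHS]exprAC; congr (_ ^+ _); rewrite -expnSr.
  have := cos_normal_sqr (b / Num.sqrt (2 ^ k.+1)%:R).
  have e1 : (fun x : R => cos (b / Num.sqrt (2 ^ k.+1)%:R * x)) =
            (fun x : R => cos (b * x / Num.sqrt (2 ^ k.+1)%:R)).
    by apply/funext => x; rewrite mulrAC.
  rewrite e1 -/(c (2 ^ k.+1)%N) => ->.
  apply: eq_Rintegral => x _; congr cos.
  have -> : Num.sqrt (2 ^ k.+1)%:R = Num.sqrt 2 * Num.sqrt (2 ^ k)%:R :> R.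
    by rewrite expnS natrM sqrtrM.
  have h1 : Num.sqrt 2 != 0 :> R by rewrite gt_eqF// sqrtr_gt0.
  have h2 : Num.sqrt (2 ^ k)%:R != 0 :> R by rewrite gt_eqF// sqrtr_gt0 ltr0n expn_gt0.
  by field; rewrite h1 h2.
apply/eqP; rewrite -subr_eq0 -normr_le0; apply/ler_addgt0Pl => e e0; rewrite addr0.
move/cvgrPdist_le : lim => /(_ e e0)[n _ /(_ (2 ^ n)%N)].
by rewrite /= -key distrC => h; apply: h; exact: ltnW (ltn_expl n (ltnSn 1)).
Qed.

End normal_cf.

Section law_transfer.
Context (R : realType) d (Omega : measurableType d) (P : probability Omega R).
Variables (L : {measure set (measurableTypeR R) -> \bar R}) (Y : Omega -> R).
Hypotheses (mY : measurable_fun setT Y)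
  (YL : forall A : set R, measurable A -> P (Y @^-1` A) = L A).

Let mY' : measurable_fun setT (Y : Omega -> measurableTypeR R). Proof. exact: mY. Qed.
Let Y' : {mfun Omega >-> measurableTypeR R} := @mfun_Sub _ _ Omega (measurableTypeR R) Y (mem_set mY').

Lemma ge0_integral_law (f : R -> \bar R) : measurable_fun setT f ->
  (forall x, (0 <= f x)%E) -> (\int[P]_w f (Y w) = \int[L]_x f x)%E.
Proof.
move=> mf f0.
rewrite -(@ge0_integral_distribution _ _ _ _ _ P Y' f mf f0).
by apply: eq_measure_integral => A mA _; exact: YL.
Qed.

Lemma Rintegral_law (f : R -> R) : measurable_fun setT f ->
  P.-integrable setT (EFin \o (f \o Y)) ->
  L.-integrable setT (EFin \o f) /\ \int[P]_w f (Y w) = \int[L]_x f x.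
Proof.
move=> mf fi; have mfE : measurable_fun setT (EFin \o f) by exact/measurable_EFinP.
split.
  apply/integrableP; split => //.
  rewrite -(@ge0_integral_law (fun x => `|(f x)%:E|%E))//; last exact: measurableT_comp.
  by case/integrableP : fi.
rewrite /Rintegral; congr fine.
rewrite -(@integral_distribution _ _ _ _ _ P Y' _ mfE fi).
by apply: eq_measure_integral => A mA _; exact: YL.
Qed.

End law_transfer.

Section gaussian_variables.
Context (R : realType) d (Omega : measurableType d) (P : probability Omega R).
Variable Y : Omega -> R.
Hypotheses (gY : gaussian_variable P Y)
  (iY2 : P.-integrable setT (EFin \o (fun w => Y w ^+ 2)))
  (Y0 : \int[P]_w Y w = 0).

Let mY : measurable_fun setT Y. Proof. by case: gY. Qed.

Let iY : P.-integrable setT (EFin \o Y). Proof. exact: integrable_of_sqr. Qed.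

Let msqr : measurable_fun setT (fun x : R => x ^+ 2). Proof. exact: exprn_measurable. Qed.

(** In the nondegenerate case [m = 0] follows from exponential moments: [exp (b Y) >= 1 + b Y] and
    centering give [b m + b^2 s^2 / 2 >= 0] for all [b], and the minimiser [b = - m / s^2] forces
    [m^2 <= 0]. *)
Lemma centered_gaussian_law :
  (exists2 s : R, 0 < s & forall A : set R, measurable A ->
     P (Y @^-1` A) = normal_prob 0 s A) \/
  (forall A : set R, measurable A -> P (Y @^-1` A) = \d_(0 : R) A).
Proof.
case: gY => _ [[m [s [s0 YN]]]|[m Ym]]; [left; exists s => //|right].
  have s00 : s != 0 by rewrite gt_eqF.
  suff m0 : m = 0 by move=> A mA; rewrite -m0; exact: YN.
  have h (b : R) : (0 <= b * m + b ^+ 2 * s ^+ 2 / 2).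
    have : (1%:E <= \int[P]_w (expR (b * Y w))%:E)%E.
      have -> : (1 = \int[P]_w (1 + b * Y w)%:E)%E.
        have i1 : P.-integrable setT (EFin \o cst 1) by exact: finite_measure_integrable_cst.
        have h := integrableD_fin i1 (integrableZl_fin b iY).
        rewrite -(fineK (integrable_fin_num measurableT h)); congr EFin.
        rewrite -/(Rintegral _ _ _) RintegralD//; last exact: integrableZl_fin.
        have P1 : fine (P setT) = 1 by rewrite probability_setT.
        by rewrite RintegralZl// Y0 mulr0 addr0 Rintegral_cst// P1 mulr1.
      have i1 : P.-integrable setT (EFin \o cst 1) by exact: finite_measure_integrable_cst.
      apply: le_integral => //; first exact: (integrableD_fin i1 (integrableZl_fin b iY)).
        apply/integrableP; split.
          apply/measurable_EFinP; apply: (measurableT_comp (@measurable_expR R)).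
          exact: measurable_funM.
        under eq_integral do rewrite gee0_abs ?lee_fin ?expR_ge0//.
        rewrite (@ge0_integral_law _ _ _ P (normal_prob m s) Y mY YN (fun x => (expR (b * x))%:E)).
        - by rewrite normal_mgf// ltry.
        - by apply/measurable_EFinP; apply: (measurableT_comp (@measurable_expR R)).
        - by move=> x; rewrite lee_fin expR_ge0.
      by move=> w _; rewrite lee_fin expR_ge1Dx.
    rewrite (@ge0_integral_law _ _ _ P (normal_prob m s) Y mY YN (fun x => (expR (b * x))%:E)).
    - by rewrite normal_mgf// lee_fin -[X in X <= _]expR0 ler_expR.
    - by apply/measurable_EFinP; apply: (measurableT_comp (@measurable_expR R)).
    - by move=> x; rewrite lee_fin expR_ge0.
  have := h (- m / s ^+ 2).
  rewrite (_ : _ + _ = - (m ^+ 2 / s ^+ 2 / 2)); last by field.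
  rewrite oppr_ge0 pmulr_lle0// pmulr_lle0 ?invr_gt0 ?exprn_gt0//.
  by move=> m2; apply/eqP; rewrite -sqrf_eq0 eq_le m2 sqr_ge0.
suff m0 : m = 0 by move=> A mA; rewrite Ym// m0.
have [_] := @Rintegral_law _ _ _ P (\d_(m : measurableTypeR R)) Y mY Ym id (@measurable_id _ _ _) iY.
by rewrite Y0 /Rintegral integral_dirac//= indicE in_setT mul1r.
Qed.

Lemma gaussian_cos_shift (phi : R) :
  \int[P]_w cos (Y w + phi) = cos phi * expR (- ((\int[P]_w (Y w ^+ 2)) / 2)).
Proof.
have mphi : measurable_fun setT (fun x : R => x + phi) by exact: measurable_funD.
have mcphi : measurable_fun setT (fun x : R => cos (x + phi)) by exact: measurable_cos_comp.
have mYphi : measurable_fun setT (fun w => Y w + phi) by exact: measurable_funD.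
have [[s s0 YN]|Y0'] := centered_gaussian_law.
  pose N : probability (measurableTypeR R) R := normal_prob 0 s.
  have [_ ->] := @Rintegral_law _ _ _ P N Y mY YN _ mcphi (integrable_cos P mYphi).
  have [i2 ->] := @Rintegral_law _ _ _ P N Y mY YN _ msqr iY2.
  have mid : measurable_fun setT (fun x : R => 1 * x) by exact: measurable_funM.
  transitivity (\int[N]_x (cos phi * cos (1 * x) - sin phi * sin (1 * x))).
    by apply: eq_Rintegral => x _; rewrite mul1r cosD mulrC [X in _ - X]mulrC.
  have ic := integrable_cos N mid; have is_ := integrable_sin N mid.
  rewrite RintegralB//; [|exact: integrableZl_fin|exact: integrableZl_fin].
  rewrite !RintegralZl// (sin_normal_eq0 s0) mulr0 subr0.
  by rewrite (cos_normal s0)// expr1n mul1r.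
have [_ ->] := @Rintegral_law _ _ _ P (\d_(0 : measurableTypeR R)) Y mY Y0' _ mcphi (integrable_cos P mYphi).
have [_ ->] := @Rintegral_law _ _ _ P (\d_(0 : measurableTypeR R)) Y mY Y0' _ msqr iY2.
rewrite /Rintegral !integral_dirac//=; [|exact/measurable_EFinP|exact/measurable_EFinP].
by rewrite !indicE !in_setT !mul1r expr0n/= mul0r oppr0 expR0 mulr1 add0r.
Qed.

(** The parameter [s] is compared with the second moment without computing the latter: Chebyshev
    gives mass at least 3/4 to [|Y| <= 2 v], while the bound on the density allows at most
    [2 v / s]. *)
Let normal_scale_le (s v : R) : 0 < s -> 0 < v ->
  (forall A : set R, measurable A -> P (Y @^-1` A) = normal_prob 0 s A) ->
  \int[P]_w (Y w ^+ 2) <= v ^+ 2 -> s <= 3 * v.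
Proof.
move=> s0 v0 YN Vv.
pose I : set R := `[- (2 * v), 2 * v]%classic.
have mI : measurable I by exact: measurable_itv.
have mA : measurable (Y @^-1` I) by rewrite -[_ @^-1` _]setTI; exact: mY.
have PA : (P (Y @^-1` I) <= (2 * v / s)%:E)%E.
  rewrite YN//; apply: (le_trans (normal_prob_itv_le 0 s0 _)); first by lra.
  rewrite lee_fin (_ : (2 * v - - (2 * v)) / (2 * s) = 2 * v / s)//.
  by field; rewrite gt_eqF.
have lb : 3 / 4 <= 2 * v / s.
  rewrite -lee_fin; apply: le_trans PA.
  have i1 : P.-integrable setT (EFin \o cst 1) by exact: finite_measure_integrable_cst.
  have i2 := integrableB_fin i1 (integrableZr_fin (4 * v ^+ 2)^-1 iY2).
  have iA : P.-integrable setT (EFin \o \1_(Y @^-1` I)) by exact: integrable_indic.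
  apply: (@le_trans _ _ (\int[P]_w (1 - Y w ^+ 2 / (4 * v ^+ 2))%:E)%E).
    rewrite -(fineK (integrable_fin_num measurableT i2)) lee_fin.
    rewrite -/(Rintegral _ _ _) RintegralB//; last exact: integrableZr_fin.
    have P1 : fine (P setT) = 1 by rewrite probability_setT.
    rewrite RintegralZr// Rintegral_cst// P1 mulr1.
    have : (\int[P]_w (Y w ^+ 2)) / (4 * v ^+ 2) <= 1 / 4.
      rewrite ler_pdivrMr ?mulr_gt0 ?exprn_gt0//; lra.
    lra.
  rewrite -(_ : (\int[P]_w (\1_(Y @^-1` I) w)%:E)%E = P (Y @^-1` I)); last first.
    by rewrite integral_indic// setIT.
  apply: le_integral => // w _; rewrite lee_fin indicE.
  have [wA|wA] := boolP (w \in Y @^-1` I).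
    have : 0 <= Y w ^+ 2 / (4 * v ^+ 2) by rewrite divr_ge0 ?sqr_ge0// mulr_ge0// sqr_ge0.
    by rewrite mulr1n /cst; lra.
  have {}wA : 2 * v < `|Y w|.
    rewrite ltNge; apply: contra wA => h; rewrite inE /I/= in_itv/=.
    by move: h; rewrite ler_norml.
  have : 1 <= Y w ^+ 2 / (4 * v ^+ 2).
    rewrite ler_pdivlMr ?mulr_gt0 ?exprn_gt0// mul1r -(real_normK (num_real (Y w))).
    nra.
  by rewrite mulr0n /cst; lra.
rewrite ler_pdivlMr// in lb; lra.
Qed.

(** With [l = sqrt p / s], [|x|^p] is at most [(sqrt p * s)^p] times [exp (l x) + exp (- l x)], and
    each exponential moment is [exp (p / 2)]. Then [2 exp (p / 2) <= 4^p] and [s <= 3 v] give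
    [12 = 4 * 3]. *)
Lemma gaussian_moment (p v : R) : 2 <= p -> 0 < v ->
  \int[P]_w (Y w ^+ 2) <= v ^+ 2 ->
  (\int[P]_w (`|Y w| `^ p)%:E <= ((12 * Num.sqrt p * v) `^ p)%:E)%E.
Proof.
move=> p2 v0 Vv.
have p0 : 0 < p by lra.
have sp0 : 0 < Num.sqrt p by rewrite sqrtr_gt0.
have sp2 : Num.sqrt p ^+ 2 = p by rewrite sqr_sqrtr// ltW.
have mp : measurable_fun setT (fun x : R => (`|x| `^ p)%:E).
  by apply/measurable_EFinP; apply: (measurableT_comp (measurable_powR p)).
have np (x : R) : (0 <= (`|x| `^ p)%:E :> \bar R)%E by rewrite lee_fin powR_ge0.
have [[s s0 YN]|Y0'] := centered_gaussian_law; last first.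
  rewrite (@ge0_integral_law _ _ _ P (\d_(0 : measurableTypeR R)) Y mY Y0' _ mp np).
  rewrite integral_dirac// normr0 powR0 ?gt_eqF// mule0.
  by rewrite lee_fin powR_ge0.
have sv : s <= 3 * v by exact: normal_scale_le Vv.
have s00 : s != 0 by rewrite gt_eqF.
pose N : probability (measurableTypeR R) R := normal_prob 0 s.
rewrite (@ge0_integral_law _ _ _ P N Y mY YN _ mp np).
pose l := Num.sqrt p / s.
have l0 : 0 < l by rewrite divr_gt0.
have mexp (b : R) : measurable_fun setT (fun x : R => (expR (b * x))%:E).
  by apply/measurable_EFinP; apply: (measurableT_comp (@measurable_expR R)).
have e0 (b x : R) : (0 <= (expR (b * x))%:E)%E by rewrite lee_fin expR_ge0.
have pw (x : R) : `|x| `^ p <= (Num.sqrt p * s) `^ p * (expR (l * x) + expR (- l * x)).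
  apply: (@le_trans _ _ ((Num.sqrt p * s) `^ p * expR (l * `|x|))); last first.
    rewrite ler_wpM2l ?powR_ge0//.
    have [x0|x0] := leP 0 x.
      by rewrite ger0_norm// lerDl expR_ge0.
    by rewrite ltr0_norm// mulrN mulNr lerDr expR_ge0.
  have -> : expR (l * `|x|) = expR (l * `|x| / p) `^ p.
    by rewrite -expRM divfK// gt_eqF.
  rewrite -powRM ?expR_ge0//; last by rewrite mulr_ge0// ltW.
  apply: ge0_ler_powR; rewrite ?nnegrE//; first exact: ltW.
    by rewrite !mulr_ge0// ?expR_ge0// ltW.
  apply: (@le_trans _ _ (Num.sqrt p * s * (l * `|x| / p))).
    suff -> : Num.sqrt p * s * (l * `|x| / p) = `|x| by [].
    by rewrite /l -[in X in _ / X]sp2; field; rewrite s00 gt_eqF.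
  rewrite ler_wpM2l//; first by rewrite mulr_ge0// ltW.
  by have := expR_ge1Dx (l * `|x| / p); lra.
apply: (@le_trans _ _ (\int[N]_x (((Num.sqrt p * s) `^ p)%:E *
    ((expR (l * x))%:E + (expR (- l * x))%:E)))%E).
  apply: ge0_le_integral => //.
  - by apply: emeasurable_funM => //; apply: emeasurable_funD; exact: mexp.
  - by move=> x _; rewrite -EFinD -EFinM lee_fin; exact: pw.
rewrite ge0_integralZl_EFin ?powR_ge0//; last 2 first.
  by move=> x _; rewrite adde_ge0.
  by apply: emeasurable_funD; exact: mexp.
rewrite ge0_integralD//; [|exact: mexp|exact: mexp].
rewrite !normal_mgf// !mulr0 !add0r sqrrN -EFinD -EFinM lee_fin.
have -> : l ^+ 2 * s ^+ 2 / 2 = p / 2.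
  by rewrite /l exprMn exprVn sp2; field.
apply: (@le_trans _ _ ((Num.sqrt p * s) `^ p * 4 `^ p)).
  rewrite ler_wpM2l ?powR_ge0//.
  have e12 : expR (2^-1) <= 2 :> R.
    have h : 2^-1 <= 1 :> R by lra.
    have := expR_le_quadratic h; lra.
  have e1 : expR (p / 2) <= 2 `^ p.
    rewrite mulrC expRM; apply: ge0_ler_powR; rewrite ?nnegrE ?expR_ge0//; lra.
  have e2 : 2 <= 2 `^ p :> R.
    rewrite -[leLHS]powRr1//; apply: ler_powR; lra.
  have -> : 4 = 2 * 2 :> R by ring.
  rewrite powRM//; have := expR_ge0 (p / 2); nra.
rewrite -powRM//; last by rewrite mulr_ge0// ltW.
apply: ge0_ler_powR; rewrite ?nnegrE; first exact: ltW.
- by rewrite !mulr_ge0// ltW.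
- by rewrite !mulr_ge0// ltW.
nra.
Qed.

End gaussian_variables.

(** * Comparison of finite-dimensional distributions *)

Section trigonometric_polynomials.
Context (R : realType) (n : nat).
Implicit Types (f g : ('I_n -> R) -> R).

(** Products are not constructors: closure under them comes from the product-to-sum formula, so
    convergence of integrals, which is linear, has to be checked on single cosines only. *)
Inductive trig_poly : (('I_n -> R) -> R) -> Prop :=
| trig_cos (a : 'I_n -> R) (phi : R) :
    trig_poly (fun v => cos (\sum_i a i * v i + phi))
| trig_add f g : trig_poly f -> trig_poly g -> trig_poly (fun v => f v + g v)
| trig_scale (c : R) f : trig_poly f -> trig_poly (fun v => c * f v).

Lemma trig_cst (c : R) : trig_poly (fun=> c).
Proof.
have -> : (fun=> c) = (fun v : 'I_n -> R => c * cos (\sum_i (fun=> 0) i * v i + 0)).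
  apply/funext => v; rewrite big1 ?addr0 ?cos0 ?mulr1// => i _; exact: mul0r.
exact/trig_scale/trig_cos.
Qed.

Lemma trig_mul f g : trig_poly f -> trig_poly g -> trig_poly (fun v => f v * g v).
Proof.
move=> tf; elim: tf g => [a phi g tg|f1 f2 _ h1 _ h2 g tg|c f1 _ h g tg].
- elim: tg => [b psi|g1 g2 _ h1 _ h2|c g1 _ h].
  + have -> : (fun v => cos (\sum_i a i * v i + phi) * cos (\sum_i b i * v i + psi)) =
      (fun v => 2^-1 * (cos (\sum_i (fun j => a j + b j) i * v i + (phi + psi)) +
                        cos (\sum_i (fun j => a j - b j) i * v i + (phi - psi)))).
      apply/funext => v.
      have -> : \sum_i (fun j => a j + b j) i * v i + (phi + psi) =
          (\sum_i a i * v i + phi) + (\sum_i b i * v i + psi).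
        by under eq_bigr do rewrite mulrDl; rewrite big_split/=; ring.
      have -> : \sum_i (fun j => a j - b j) i * v i + (phi - psi) =
          (\sum_i a i * v i + phi) - (\sum_i b i * v i + psi).
        by under eq_bigr do rewrite mulrBl; rewrite sumrB; ring.
      move: (_ + phi) (_ + psi) => x y.
      by rewrite cosD cosB; field.
    by apply: trig_scale; apply: trig_add; exact: trig_cos.
  + under eq_fun do rewrite mulrDr.
    exact: trig_add.
  + under eq_fun do rewrite mulrCA.
    exact: trig_scale.
- under eq_fun do rewrite mulrDl.
  by apply: trig_add; [exact: h1|exact: h2].
- under eq_fun do rewrite -mulrA.
  by apply: trig_scale; exact: h.
Qed.

Lemma trig_exp f k : trig_poly f -> trig_poly (fun v => f v ^+ k).
Proof.
move=> tf; elim: k => [|k IH].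
  by under eq_fun do rewrite expr0; exact: trig_cst.
by under eq_fun do rewrite exprS; exact: trig_mul.
Qed.

Lemma trig_prod (I : Type) (r : seq I) (F : I -> ('I_n -> R) -> R) :
  (forall i, trig_poly (F i)) -> trig_poly (fun v => \prod_(i <- r) F i v).
Proof.
move=> tF; elim: r => [|i r IH].
  by under eq_fun do rewrite big_nil; exact: trig_cst.
by under eq_fun do rewrite big_cons; exact: trig_mul.
Qed.

Lemma trig_sin_coord (j : 'I_n) (a b : R) : trig_poly (fun v => sin (a * (v j - b))).
Proof.
have -> : (fun v : 'I_n -> R => sin (a * (v j - b))) =
    (fun v => cos (\sum_i (fun i => if i == j then a else 0) i * v i + (- (a * b) - pi / 2))).
  apply/funext => v; rewrite (bigD1 j)//= eqxx big1 ?addr0; last first.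
    by move=> i /negbTE ->; rewrite mul0r.
  by rewrite addrA cosBpihalf mulrBr.
exact: trig_cos.
Qed.

End trigonometric_polynomials.

(** * Steps and boxes approximated by trigonometric polynomials *)

Section step_approximation.
Context (R : realType).
Implicit Types (x u e L eps : R).

Lemma onemX_ge x m : 0 <= x <= 1 -> 1 - m%:R * x <= (1 - x) ^+ m.
Proof.
move=> /andP[x0 x1]; elim: m => [|m IH]; first by rewrite mul0r subr0 expr0.
rewrite exprS; apply: (@le_trans _ _ ((1 - x) * (1 - m%:R * x))).
  rewrite -natr1; have : 0 <= m%:R * x * x by rewrite !mulr_ge0.
  nra.
by rewrite ler_wpM2l// subr_ge0.
Qed.

Lemma onepX_ge x m : 0 <= x -> 1 + m%:R * x <= (1 + x) ^+ m.
Proof.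
move=> x0; elim: m => [|m IH]; first by rewrite mul0r addr0 expr0.
rewrite exprS; apply: (@le_trans _ _ ((1 + x) * (1 + m%:R * x))).
  rewrite -natr1; have : 0 <= m%:R * x * x by rewrite !mulr_ge0.
  nra.
by rewrite ler_wpM2l// addr_ge0.
Qed.

Lemma onemX_le x m : 0 <= x <= 1 -> (1 - x) ^+ m * (1 + m%:R * x) <= 1.
Proof.
move=> /andP[x0 x1].
apply: (@le_trans _ _ ((1 - x) ^+ m * (1 + x) ^+ m)).
  by rewrite ler_wpM2l ?exprn_ge0 ?subr_ge0//; exact: onepX_ge.
rewrite -exprMn exprn_ile1//; nra.
Qed.

(** As long as [a * (x - u)] stays where the sine increases, the fraction crosses 1/2 at [x = u],
    and there the value drops from near 1 to near 0. *)
Definition soft_step (N : nat) (a u x : R) : R :=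
  (1 - ((1 + sin (a * (x - u))) / 2) ^+ N) ^+ (2 ^ N).

Let s01 (y : R) : 0 <= (1 + sin y) / 2 <= 1.
Proof. by have := sin_geN1 y; have := sin_le1 y; lra. Qed.

Lemma soft_step_ge0 N a u x : 0 <= soft_step N a u x.
Proof.
rewrite exprn_ge0// subr_ge0; have /andP[h0 h1] := s01 (a * (x - u)).
exact: exprn_ile1.
Qed.

Lemma soft_step_le1 N a u x : soft_step N a u x <= 1.
Proof.
have /andP[h0 h1] := s01 (a * (x - u)).
rewrite exprn_ile1//; first by rewrite subr_ge0 exprn_ile1.
Qed.

(* The Brosowski-Deutsch trick: [(1 - s^N)^(2^N)] separates [s < 1/2] from [s > 1/2]. *)
Lemma soft_step_approx u e L eps : 0 < e -> 0 < L -> 0 < eps ->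
  exists N : nat, exists a : R,
    (forall x, `|x| <= L -> x <= u - e -> 1 - eps <= soft_step N a u x) /\
    (forall x, `|x| <= L -> u + e <= x -> soft_step N a u x <= eps).
Proof.
move=> e0 L0 eps0.
(* So small that [a * (x - u)] stays within [pi / 2] on [|x| <= L], where the sine is increasing. *)
pose a := (L + `|u| + e + 1)^-1.
have den : 0 < L + `|u| + e + 1 by have := normr_ge0 u; lra.
have a0 : 0 < a by rewrite invr_gt0.
have p1 := pihalf_ge1 R.
pose sg := sin (a * e).
have ae : 0 < a * e < pi / 2.
  rewrite mulr_gt0//=; apply: (@lt_le_trans _ _ 1) => //.
  by rewrite /a mulrC ltr_pdivrMr// mul1r; have := normr_ge0 u; lra.
have sg0 : 0 < sg by exact: sin_gt0_pihalf.
have bnd x : `|x| <= L -> - (pi / 2) <= a * (x - u) <= pi / 2.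
  move=> xL; have h : `|a * (x - u)| <= 1.
    rewrite normrM gtr0_norm// /a mulrC ler_pdivrMr// mul1r.
    apply: (le_trans (ler_normB _ _)); lra.
  by move: h; rewrite ler_norml => /andP[h1 h2]; apply/andP; split; lra.
have mono y z : - (pi / 2) <= y <= pi / 2 -> - (pi / 2) <= z <= pi / 2 -> y <= z ->
    sin y <= sin z.
  move=> hy hz; rewrite le_eqVlt => /predU1P[->//|yz].
  by apply: ltW; rewrite ltr_sin// in_itv/=.
have aeb : - (pi / 2) <= a * e <= pi / 2 by case/andP: ae => h1 h2; apply/andP; split; lra.
have aebN : - (pi / 2) <= - (a * e) <= pi / 2 by case/andP: ae => h1 h2; apply/andP; split; lra.
(* [N] is chosen for [eps * (1 + sg)^N >= 1], an inequality that serves on both sides of [u]. *)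
have [N hN] : exists N : nat, (eps * sg)^-1 < N%:R.
  by exists (Num.truncn (eps * sg)^-1).+1; exact: truncnS_gt.
have epsN : 1 <= eps * (1 + sg) ^+ N.
  have h := onepX_ge N (ltW sg0).
  have h2 : 1 < N%:R * (eps * sg).
    by rewrite -ltr_pdivrMr ?mulr_gt0// mul1r.
  have : eps * (1 + N%:R * sg) <= eps * (1 + sg) ^+ N by rewrite ler_pM2l.
  nra.
have two N' : (2 ^ N')%:R = 2 ^+ N' :> R by rewrite natrX.
exists N, a; split => x xL xu.
- have h : sin (a * (x - u)) <= - sg.
    rewrite /sg -sinN; apply: mono => //; first exact: bnd.
    by rewrite -mulrN ler_pM2l//; lra.
  set s := (1 + sin (a * (x - u))) / 2.
  have /andP[s0 s1] := s01 (a * (x - u)).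
  have sN : 0 <= s ^+ N <= 1 by rewrite exprn_ge0// exprn_ile1.
  apply: le_trans (onemX_ge (2 ^ N) sN).
  rewrite two -exprMn lerD2l lerN2.
  have s2 : 2 * s <= 1 - sg by rewrite /s; lra.
  have s20 : 0 <= 2 * s by rewrite mulr_ge0.
  have hs : (2 * s) * (1 + sg) <= 1 by nra.
  rewrite -[leRHS]mulr1; apply: (@le_trans _ _ ((2 * s) ^+ N * (eps * (1 + sg) ^+ N))).
    by rewrite ler_peMr// exprn_ge0.
  have h1 : (2 * s) ^+ N * (1 + sg) ^+ N <= 1.
    by rewrite -exprMn exprn_ile1// mulr_ge0//; lra.
  by rewrite mulrCA ler_wpM2l// ltW.
- have h : sg <= sin (a * (x - u)).
    apply: mono => //; first exact: bnd.
    by rewrite ler_pM2l//; lra.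
  set s := (1 + sin (a * (x - u))) / 2.
  have /andP[s0 s1] := s01 (a * (x - u)).
  have sN : 0 <= s ^+ N <= 1 by rewrite exprn_ge0// exprn_ile1.
  have := onemX_le (2 ^ N) sN; rewrite two -exprMn.
  rewrite /soft_step -/s; set q := (1 - s ^+ N) ^+ (2 ^ N) => hq.
  have q0 : 0 <= q by rewrite exprn_ge0// subr_ge0; case/andP: sN.
  have s2 : 1 + sg <= 2 * s by rewrite /s; lra.
  have hs : (1 + sg) ^+ N <= (2 * s) ^+ N by rewrite lerXn2r ?nnegrE//; lra.
  have q1 : q * (1 + sg) ^+ N <= 1.
    apply: le_trans hq; rewrite ler_wpM2l//; lra.
  have G0 : 0 < (1 + sg) ^+ N by rewrite exprn_gt0//; lra.
  by rewrite -(ler_pM2r G0); apply: (le_trans q1).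
Qed.

End step_approximation.

Section box_approximation.
Context (R : realType) (n : nat).

Lemma prodr_ge_onem (I : Type) (r : seq I) (F : I -> R) (eps : R) : 0 <= eps <= 1 ->
  (forall i, 1 - eps <= F i <= 1) -> 1 - (size r)%:R * eps <= \prod_(i <- r) F i <= 1.
Proof.
move=> /andP[e0 e1] hF; elim: r => [|i r IH].
  by rewrite big_nil mul0r subr0 lexx.
rewrite big_cons/= -natr1.
have /andP[h1 h2] := hF i; have /andP[h3 h4] := IH.
have s0 : 0 <= (size r)%:R :> R by [].
have p0 : 0 <= \prod_(j <- r) F j.
  by apply: prodr_ge0 => j _; have /andP[+ _] := hF j; lra.
apply/andP; split; last by nra.
have : (1 - eps) * \prod_(j <- r) F j <= F i * \prod_(j <- r) F j by rewrite ler_wpM2r.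
nra.
Qed.

Lemma box_approx (u e L eps : R) : 0 < e -> 0 < L -> 0 < eps ->
  exists tau : ('I_n -> R) -> R, trig_poly tau /\ forall v : 'I_n -> R,
    [/\ 0 <= tau v <= 1,
      (forall j, `|v j| <= L) -> (forall j, v j <= u - e) -> 1 - eps <= tau v &
      forall j, `|v j| <= L -> u + e <= v j -> tau v <= eps].
Proof.
move=> e0 L0 eps0.
(* A product of [n] factors at least [1 - eps1] is at least [1 - n * eps1]; the minimum with 1 keeps
   [1 - eps1] nonnegative. *)
pose eps1 := Num.min 1 eps / n.+1%:R.
have n0 : 0 < n.+1%:R :> R by rewrite ltr0n.
have m0 : 0 < Num.min 1 eps by rewrite lt_min ltr01.
have n1 : 1 <= n.+1%:R :> R by rewrite ler1n.
have eps10 : 0 < eps1 by rewrite divr_gt0.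
have eps11 : eps1 <= Num.min 1 eps by rewrite ler_pdivrMr// ler_peMr// ltW.
have eps1l : eps1 <= 1 by rewrite (le_trans eps11)// ge_min lexx.
have eps1e : eps1 <= eps by rewrite (le_trans eps11)// ge_min lexx orbT.
have [N [a [h1 h2]]] := soft_step_approx u e0 L0 eps10.
exists (fun v => \prod_j soft_step N a u (v j)); split.
  apply: trig_prod => j; apply: trig_exp.
  have -> : (fun v : 'I_n -> R => 1 - ((1 + sin (a * (v j - u))) / 2) ^+ N) =
      (fun v => 1 + -1 * (2^-1 * (1 + sin (a * (v j - u)))) ^+ N).
    by apply/funext => v; rewrite mulN1r [_ / 2]mulrC.
  apply: trig_add; first exact: trig_cst.
  apply: trig_scale; apply: trig_exp; apply: trig_scale.
  by apply: trig_add; [exact: trig_cst|exact: trig_sin_coord].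
move=> v; split.
- rewrite prodr_ge0 /=; last by move=> j _; exact: soft_step_ge0.
  have h01 : 0 <= (1 : R) <= 1 by rewrite ler01 lexx.
  have hh (j : 'I_n) : 1 - 1 <= soft_step N a u (v j) <= 1.
    by rewrite subrr soft_step_ge0 soft_step_le1.
  by have /andP[] := prodr_ge_onem (index_enum 'I_n) h01 hh.
- move=> vL vu.
  have h01 : 0 <= eps1 <= 1 by rewrite (ltW eps10).
  have hh (j : 'I_n) : 1 - eps1 <= soft_step N a u (v j) <= 1.
    by rewrite soft_step_le1 h1.
  have /andP[+ _] := prodr_ge_onem (index_enum 'I_n) h01 hh.
  apply: le_trans; rewrite lerD2l lerN2.
  have -> : size (index_enum 'I_n) = n.
    by rewrite -[index_enum _]enumT size_enum_ord.
  apply: (@le_trans _ _ (n.+1%:R * eps1)).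
    by rewrite ler_wpM2r ?(ltW eps10)// ler_nat.
  by rewrite /eps1 mulrC divfK ?gt_eqF// ge_min lexx orbT.
- move=> j vL vu; rewrite (bigD1 j)//=.
  have : \prod_(i < n | i != j) soft_step N a u (v i) <= 1.
    by apply: prodr_ile1 => // i _; rewrite soft_step_ge0 soft_step_le1.
  have : 0 <= \prod_(i < n | i != j) soft_step N a u (v i).
    by apply: prodr_ge0 => i _; exact: soft_step_ge0.
  have := h2 _ vL vu; have := soft_step_ge0 N a u (v j).
  nra.
Qed.

End box_approximation.

Section distribution_comparison.
Context (R : realType) (n : nat).

Lemma trig_integrable d (Omega : measurableType d) (P : probability Omega R)
    (V : 'I_n -> Omega -> R) tau :
  (forall i, measurable_fun setT (V i)) -> trig_poly tau ->
  P.-integrable setT (EFin \o (fun w => tau (fun i => V i w))).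
Proof.
move=> mV; elim=> [a phi|f g _ h1 _ h2|c f _ h].
- apply: integrable_cos; apply: measurable_funD => //.
  by apply: measurable_sum => i; exact: measurable_funM.
- exact: integrableD_fin.
- exact: integrableZl_fin.
Qed.

Lemma trig_cvg d d' (Omega : measurableType d) (P : probability Omega R)
    (Omega' : measurableType d') (P' : probability Omega' R)
    (V : nat -> 'I_n -> Omega -> R) (W : 'I_n -> Omega' -> R) tau :
  (forall m i, measurable_fun setT (V m i)) ->
  (forall i, measurable_fun setT (W i)) ->
  (forall (a : 'I_n -> R) phi,
    (fun m => \int[P]_w cos (\sum_i a i * V m i w + phi)) @ \oo -->
      \int[P']_w cos (\sum_i a i * W i w + phi)) ->
  trig_poly tau ->
  (fun m => \int[P]_w tau (fun i => V m i w)) @ \oo -->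
    \int[P']_w tau (fun i => W i w).
Proof.
move=> mV mW cf; elim=> [a phi|f g tf h1 tg h2|c f tf h]; first exact: cf.
- rewrite RintegralD//; [|exact: trig_integrable|exact: trig_integrable].
  rewrite (_ : (fun m => _) = (fun m => \int[P]_w f (fun i => V m i w) +
      \int[P]_w g (fun i => V m i w))); first exact: cvgD.
  by apply/funext => m; rewrite RintegralD//; exact: trig_integrable.
- rewrite RintegralZl//; last exact: trig_integrable.
  rewrite (_ : (fun m => _) = (fun m => c * \int[P]_w f (fun i => V m i w))).
    exact: cvgMr.
  by apply/funext => m; rewrite RintegralZl//; exact: trig_integrable.
Qed.

Lemma Rintegral_indic_prob d (Omega : measurableType d) (P : probability Omega R)
  (A : set Omega) : measurable A -> \int[P]_w \1_A w = fine (P A).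
Proof. by move=> mA; rewrite /Rintegral integral_indic// setIT. Qed.

Lemma measurable_box d (Omega : measurableType d) (V : 'I_n -> Omega -> R) (u : R) :
  (forall i, measurable_fun setT (V i)) ->
  measurable [set w | forall j, V j w <= u].
Proof.
move=> mV; rewrite (_ : [set w | _] = \bigcap_(j in [set: 'I_n]) [set w | V j w <= u]).
  apply: fin_bigcap_measurable => // j _.
  rewrite (_ : [set w | _] = setT `&` V j @^-1` `]-oo, u]%classic).
    exact: mV.
  by apply/seteqP; split=> w /=; rewrite in_itv/= => // -[].
by apply/seteqP; split=> w /= h j; [move=> _; exact: h|exact: h].
Qed.

(** [tau] imitates the indicator of the box only on the cube of half-width [L]; the second moments
    control the rest. [tau] depends on their bound [B] but is chosen before the probability space,
    so one polynomial serves all the fields compared. *)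
Lemma trig_box_compare (u e B eps : R) : 0 < e -> 0 <= B -> 0 < eps ->
  exists2 tau : ('I_n -> R) -> R, trig_poly tau &
  forall d (Omega : measurableType d) (P : probability Omega R)
    (V : 'I_n -> Omega -> R),
  (forall i, measurable_fun setT (V i)) ->
  (forall i, P.-integrable setT (EFin \o (fun w => V i w ^+ 2))) ->
  (forall i, \int[P]_w (V i w ^+ 2) <= B) ->
  fine (P [set w | forall j, V j w <= u - e]) <= \int[P]_w tau (fun i => V i w) + eps /\
  \int[P]_w tau (fun i => V i w) <= fine (P [set w | forall j, V j w <= u + e]) + eps.
Proof.
move=> e0 B0 eps0.
pose L := 1 + 2 * n%:R * B / eps.
have q0 : 0 <= 2 * n%:R * B / eps by rewrite divr_ge0 ?(ltW eps0)// mulr_ge0.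
have L1 : 1 <= L by rewrite /L lerDl.
have L0 : 0 < L by lra.
have eps20 : 0 < eps / 2 by lra.
have LB : n%:R * B / L ^+ 2 <= eps / 2.
  rewrite ler_pdivrMr ?exprn_gt0//.
  have : 2 * n%:R * B <= eps * L by rewrite /L mulrDr mulr1 [eps * _]mulrC divfK ?gt_eqF// lerDr ltW.
  have : eps * L <= eps * L ^+ 2 by rewrite ler_pM2l// expr2 ler_peMr// ltW.
  lra.
have [tau [ttau htau]] := box_approx n u e0 L0 eps20.
exists tau => // d Omega P V mV iV VB.
(* Pointwise Chebyshev: [Q] is at least 1 off the cube, and [L] was chosen to make its integral at
   most [eps / 2]. *)
pose Q w := \sum_i V i w ^+ 2 * (L ^+ 2)^-1.
have [iQ EQ] := Rintegral_sum_fin (index_enum 'I_n)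
  (fun i => integrableZr_fin (L ^+ 2)^-1 (iV i)).
have QB : \int[P]_w Q w <= eps / 2.
  apply: le_trans LB; rewrite EQ.
  under eq_bigr => i _ do rewrite RintegralZr//.
  apply: (@le_trans _ _ (\sum_(i < n) B * (L ^+ 2)^-1)).
    by apply: ler_sum => i _; rewrite ler_wpM2r// invr_ge0 sqr_ge0.
  by rewrite sumr_const card_ord -[_ *+ n]mulr_natl mulrA.
have Q0 w : 0 <= Q w.
  by apply: sumr_ge0 => i _; rewrite mulr_ge0 ?sqr_ge0// invr_ge0 sqr_ge0.
have Q1 w j : L < `|V j w| -> 1 <= Q w.
  move=> LV; rewrite /Q (bigD1 j)//=.
  have : 1 <= V j w ^+ 2 * (L ^+ 2)^-1.
    rewrite ler_pdivlMr ?exprn_gt0// mul1r -(real_normK (num_real (V j w))).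
    by rewrite lerXn2r ?nnegrE ?(ltW L0) ?(ltW LV) ?normr_ge0.
  have : 0 <= \sum_(i < n | i != j) V i w ^+ 2 * (L ^+ 2)^-1.
    by apply: sumr_ge0 => i _; rewrite mulr_ge0 ?sqr_ge0// invr_ge0 sqr_ge0.
  lra.
have it := trig_integrable P mV ttau.
have ic : P.-integrable setT (EFin \o cst (eps / 2)) by exact: finite_measure_integrable_cst.
have P1 : fine (P setT) = 1 by rewrite probability_setT.
have Ec : \int[P]_w cst (eps / 2) w = eps / 2 by rewrite Rintegral_cst// P1 mulr1.
have iQc := integrableD_fin iQ ic.
have EQc : \int[P]_w (Q w + cst (eps / 2) w) <= eps.
  by rewrite RintegralD// Ec; lra.
have mB c := measurable_box c mV.
have iB c : P.-integrable setT (EFin \o \1_[set w | forall j, V j w <= c]).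
  exact: integrable_indic.
split.
- rewrite -Rintegral_indic_prob//.
  apply: (@le_trans _ _ (\int[P]_w (tau (fun i => V i w) + (Q w + cst (eps / 2) w)))).
    apply: le_Rintegral => //; first exact: integrableD_fin.
    move=> w _; rewrite indicE /cst.
    have [t01 t1 t2] := htau (fun i => V i w); have /andP[t0 _] := t01.
    have q := Q0 w.
    have [wB|wB] := boolP (w \in _); last by rewrite mulr0n; lra.
    rewrite mulr1n.
    have [/forallP h|/forallPn[j]] := boolP [forall j, `|V j w| <= L].
      have := t1 h; have {}wB := set_mem wB => /(_ wB); lra.
    rewrite -ltNge => /Q1; lra.
  by rewrite RintegralD// lerD2l.
- rewrite -[fine _](Rintegral_indic_prob P (mB _)).
  apply: (@le_trans _ _ (\int[P]_w (\1_[set w | forall j, V j w <= u + e] w +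
      (Q w + cst (eps / 2) w)))).
    apply: le_Rintegral => //; first exact: integrableD_fin.
    move=> w _; rewrite indicE /cst.
    have [/andP[t0 t01] t1 t2] := htau (fun i => V i w).
    have q := Q0 w.
    have [wB|wB] := boolP (w \in _); first by rewrite mulr1n; lra.
    rewrite mulr0n add0r.
    have [/forallP h|/forallPn[j]] := boolP [forall j, `|V j w| <= L]; last first.
      rewrite -ltNge => /Q1; lra.
    have [j vj] : exists j, u + e < V j w.
      apply/not_existsP => hn; move/negP : wB; apply; rewrite inE /= => j.
      by rewrite leNgt; apply/negP; exact: hn.
    have := t2 j (h j) (ltW vj); lra.
  by rewrite RintegralD// lerD2l.
Qed.

Lemma box_cvg d d' (Omega : measurableType d) (P : probability Omega R)
    (Omega' : measurableType d') (P' : probability Omega' R)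
    (V : nat -> 'I_n -> Omega -> R) (W : 'I_n -> Omega' -> R) (u e B eps : R) :
  0 < e -> 0 < eps ->
  (forall m i, measurable_fun setT (V m i)) ->
  (forall i, measurable_fun setT (W i)) ->
  (forall m i, P.-integrable setT (EFin \o (fun w => V m i w ^+ 2))) ->
  (forall m i, \int[P]_w (V m i w ^+ 2) <= B) ->
  (forall i, P'.-integrable setT (EFin \o (fun w => W i w ^+ 2))) ->
  (forall i, \int[P']_w (W i w ^+ 2) <= B) ->
  (forall (a : 'I_n -> R) phi,
    (fun m => \int[P]_w cos (\sum_i a i * V m i w + phi)) @ \oo -->
      \int[P']_w cos (\sum_i a i * W i w + phi)) ->
  \forall m \near \oo,
    fine (P [set w | forall j, V m j w <= u - e]) <=
      fine (P' [set w | forall j, W j w <= u + e]) + eps /\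
    fine (P' [set w | forall j, W j w <= u - e]) <=
      fine (P [set w | forall j, V m j w <= u + e]) + eps.
Proof.
move=> e0 eps0 mV mW iV VB iW WB cf.
have B0 : 0 <= Num.max 0 B by rewrite le_max lexx.
have eps30 : 0 < eps / 3 by lra.
have [tau tt htau] := trig_box_compare u e0 B0 eps30.
have := trig_cvg mV mW cf tt.
move=> /cvgrPdist_le/(_ _ eps30) h.
have BB (x : R) : x <= B -> x <= Num.max 0 B by move=> xB; rewrite le_max xB orbT.
near=> m.
have [v1 v2] := htau _ _ P (V m) (mV m) (iV m) (fun i => BB _ (VB m i)).
have [w1 w2] := htau _ _ P' W mW iW (fun i => BB _ (WB i)).
have : `|\int[P']_w tau (fun i => W i w) - \int[P]_w tau (fun i => V m i w)| <= eps / 3.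
  by near: m.
rewrite ler_norml => /andP[k1 k2].
split; lra.
Unshelve. all: by end_near. Qed.

End distribution_comparison.

(** * Chaining *)

Section mean_bounds.
Context d (R : realType) (Omega : measurableType d) (P : probability Omega R).
Implicit Types (f g : Omega -> R) (a b c lambda p B : R).

(** Maxima are handled through such majorants: only explicit sums are integrated, and the bounds add
    up. *)
Definition mean_le f c := [/\ measurable_fun setT f, forall w, 0 <= f w &
  (\int[P]_w (f w)%:E <= c%:E)%E].

Lemma mean_le_cst c : 0 <= c -> mean_le (cst c) c.
Proof.
move=> c0; split=> //; have -> : (\int[P]_w (cst c w)%:E = \int[P]_w cst c%:E w)%E by [].
by rewrite (integral_cst P measurableT) [X in (c%:E * X)%E](probability_setT P) mule1.
Qed.

Lemma mean_leD f g a b : mean_le f a -> mean_le g b ->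
  mean_le (fun w => f w + g w) (a + b).
Proof.
move=> [mf f0 fa] [mg g0 gb]; split.
- exact: measurable_funD.
- by move=> w; rewrite addr_ge0.
- under eq_integral do rewrite EFinD.
  rewrite ge0_integralD//; [|by move=> w _; rewrite lee_fin|exact/measurable_EFinP|
    by move=> w _; rewrite lee_fin|exact/measurable_EFinP].
  by rewrite EFinD leeD.
Qed.

Lemma mean_leZ k f a : 0 <= k -> mean_le f a -> mean_le (fun w => k * f w) (k * a).
Proof.
move=> k0 [mf f0 fa]; split.
- exact: measurable_funM.
- by move=> w; rewrite mulr_ge0.
- under eq_integral do rewrite EFinM.
  rewrite ge0_integralZl//; [|exact/measurable_EFinP|by move=> w _; rewrite lee_fin].
  by rewrite EFinM lee_wpmul2l// lee_fin.
Qed.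

Lemma mean_le_sum (I : Type) (r : seq I) (F : I -> Omega -> R) (C : I -> R) :
  (forall i, mean_le (F i) (C i)) ->
  mean_le (fun w => \sum_(i <- r) F i w) (\sum_(i <- r) C i).
Proof.
move=> h; elim: r => [|i r IH].
  rewrite big_nil (_ : (fun w => _) = cst 0); first exact: mean_le_cst.
  by apply/funext => w; rewrite big_nil.
rewrite big_cons (_ : (fun w => _) = (fun w => F i w + \sum_(j <- r) F j w)).
  exact: mean_leD.
by apply/funext => w; rewrite big_cons.
Qed.

Lemma mean_leW f a b : a <= b -> mean_le f a -> mean_le f b.
Proof.
by move=> ab [mf f0 fa]; split=> //; apply: (le_trans fa); rewrite lee_fin.
Qed.

(** Truncation at [lambda]: above it, write [x] as [x^(1 - p) * x^p] and use [1 - p <= 0]. This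
    pointwise form of the maximal inequality for moments can be summed before integrating. *)
Lemma le_add_powR lambda p x : 0 < lambda -> 1 <= p -> 0 <= x ->
  x <= lambda + lambda `^ (1 - p) * x `^ p.
Proof.
move=> l0 p1 x0.
have [xl|lx] := leP x lambda.
  by apply: (le_trans xl); rewrite lerDl mulr_ge0// powR_ge0.
have {}x0 : 0 < x by apply: lt_trans lx.
have h : x = x `^ (1 - p) * x `^ p by rewrite -powRD ?(gt_eqF x0) ?implybT// subrK powRr1// ltW.
apply: (@le_trans _ _ (lambda `^ (1 - p) * x `^ p)); last by rewrite lerDr ltW.
rewrite {1}h ler_wpM2r ?powR_ge0//.
have -> : 1 - p = - (p - 1) by rewrite opprB.
rewrite !powRN lef_pV2 ?posrE ?powR_gt0//.
by rewrite ge0_ler_powR ?nnegrE ?(ltW l0) ?(ltW x0) ?(ltW lx)// subr_ge0.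
Qed.

(* Pointwise, the function below dominates every [f i]: a bound for their maximum. *)
Lemma mean_le_max (I : Type) (r : seq I) (f : I -> Omega -> R) lambda p B :
  0 < lambda -> 1 <= p -> (size r)%:R * B `^ p <= lambda `^ p ->
  (forall i, measurable_fun setT (f i)) ->
  (forall i, \int[P]_w (`|f i w| `^ p)%:E <= (B `^ p)%:E)%E ->
  mean_le (fun w => lambda + lambda `^ (1 - p) * \sum_(i <- r) `|f i w| `^ p) (2 * lambda).
Proof.
move=> l0 p1 hB mf fB.
have hs : mean_le (fun w => \sum_(i <- r) `|f i w| `^ p) (\sum_(i <- r) B `^ p).
  apply: (@mean_le_sum _ r (fun i w => `|f i w| `^ p) (fun=> B `^ p)) => i; split=> //.
  - by apply: (measurableT_comp (measurable_powR p)); exact: measurableT_comp.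
apply: (mean_leW _ (mean_leD (mean_le_cst (ltW l0)) (mean_leZ (powR_ge0 _ _) hs))).
have -> : \sum_(i <- r) B `^ p = (size r)%:R * B `^ p.
  by rewrite big_const_seq count_predT iter_addr addr0 mulr_natl.
have : lambda `^ (1 - p) * ((size r)%:R * B `^ p) <= lambda.
  apply: (@le_trans _ _ (lambda `^ (1 - p) * lambda `^ p)).
    by rewrite ler_wpM2l ?powR_ge0.
  by rewrite -powRD ?(gt_eqF l0) ?implybT// subrK powRr1// ltW.
lra.
Qed.

Lemma mean_le_markov f c (e : R) (A : set Omega) : 0 < e -> mean_le f c -> measurable A ->
  (forall w, A w -> e <= f w) -> (P A <= (c / e)%:E)%E.
Proof.
move=> e0 [mf f0 fc] mA Af.
rewrite -(@lee_pmul2l _ e%:E)// -EFinM mulrCA divff ?gt_eqF// mulr1.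
apply: le_trans fc.
rewrite -[X in (_ * P X)%E]setIT -(integral_indic P)// -ge0_integralZl//; last 2 first.
- by apply/measurable_EFinP; exact: measurable_indic.
- by rewrite lee_fin ltW.
apply: ge0_le_integral => //.
- by move=> w _; rewrite -EFinM lee_fin mulr_ge0// ltW.
- by under eq_fun do rewrite -EFinM; apply/measurable_EFinP; exact: measurable_funM.
- exact/measurable_EFinP.
- move=> w _; rewrite -EFinM lee_fin indicE.
  by have [/set_mem/Af|] := boolP (w \in A); rewrite ?mulr1n ?mulr1// mulr0n mulr0.
Qed.

End mean_bounds.

(** * Chaining along dyadic nets, with one exponent per scale *)

Section chaining.
Context (R : realType) (T : Type) (gamma : T -> T -> \bar R).
Variables (K : R -> R) (supp : R -> Prop).
Hypothesis K2_ge0 : 0 <= K 2.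
Hypothesis supp2 : supp 2.

(** Bounds are required for every real [r > 0] above [gamma t s], because [gamma] is extended-valued
    and may vanish between distinct points. *)
Definition moment_class d (Omega : measurableType d) (P : probability Omega R)
    (Y : T -> Omega -> R) :=
  (forall t, measurable_fun setT (Y t)) /\
  forall t s r p, 0 < r -> (gamma t s <= r%:E)%E -> 2 <= p -> supp p ->
    (\int[P]_w (`|Y t w - Y s w| `^ p)%:E <= ((K p * r) `^ p)%:E)%E.

Variables (N : nat -> nat) (c : nat -> nat -> T) (p L : nat -> R).
Hypothesis net : forall j t, exists i, (i < N j)%N /\ (gamma (c j i) t <= (2^-1 ^+ j)%:E)%E.
Hypothesis L_gt0 : forall j, 0 < L j.
Hypothesis L_summable : exists C : R, forall n, \sum_(j < n) L j <= C.
Hypothesis p_ge2 : forall j, 2 <= p j.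
Hypothesis supp_p : forall j, supp (p j).
Hypothesis entropy_bound : forall j,
  (N j.+1)%:R * (K (p j) * 2^-1 ^+ j) `^ p j <= L j `^ p j.

Lemma summable_tail (e : R) : 0 < e -> exists k, forall n, \sum_(j < n) L (k + j)%N <= e.
Proof.
move=> e0; have [C hC] := L_summable.
have nd : nondecreasing_seq (fun n => \sum_(j < n) L j).
  by apply/nondecreasing_seqP => n; rewrite big_ord_recr/= lerDl ltW.
have ub : has_ubound (range (fun n => \sum_(j < n) L j)).
  by exists C => _ [n _ <-].
have := nondecreasing_cvgn nd ub => /cvgrPdist_le/(_ _ e0)[k _ /(_ k (leqnn _))].
set l := sup _ => hk; exists k => n.
have h1 : \sum_(j < k + n) L j <= l by apply: ub_le_sup => //; exists (k + n)%N.
move: h1; rewrite big_split_ord/= => h1.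
move: hk; rewrite ler_norml => /andP[_]; lra.
Qed.

Let parent_ex : exists f : nat -> nat -> nat, forall j i,
  (f j i < N j)%N /\ (gamma (c j (f j i)) (c j.+1 i) <= (2^-1 ^+ j)%:E)%E.
Proof.
have [f hf] := choice (fun ji : nat * nat => net ji.1 (c ji.1.+1 ji.2)).
by exists (fun j i => f (j, i)) => j i; exact: hf (j, i).
Qed.

Let parent := projT1 (cid parent_ex).
Let parentP := projT2 (cid parent_ex).

Fixpoint ancestor k n i := if n is n'.+1 then ancestor k n' (parent (k + n') i) else i.

Let K21 : 0 < K 2 + 1. Proof. by rewrite ltr_wpDl. Qed.

Lemma ancestor_lt k n i : (i < N (k + n))%N -> (ancestor k n i < N k)%N.
Proof.
elim: n i => [|n IH] i /=; first by rewrite addn0.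
by move=> _; apply: IH; exact: (parentP _ _).1.
Qed.

Section one_field.
Context d (Omega : measurableType d) (P : probability Omega R) (Y : T -> Omega -> R).
Hypothesis hY : moment_class P Y.

(** Simultaneous majorant of all links from level [j.+1] to level [j]; its mean is at most [2 * L j]
    by [entropy_bound]. *)
Let dominator j w := L j + L j `^ (1 - p j) *
  \sum_(i < N j.+1) `|Y (c j (parent j i)) w - Y (c j.+1 i) w| `^ p j.

Lemma increment_measurable t s : measurable_fun setT (fun w => Y t w - Y s w).
Proof. by apply: measurable_funB; exact: hY.1. Qed.

Let dominator_mean j : mean_le P (dominator j) (2 * L j).
Proof.
apply: (@mean_le_max _ _ _ P _ (index_enum 'I_(N j.+1))
  (fun i w => Y (c j (parent j i)) w - Y (c j.+1 i) w) (L j) (p j) (K (p j) * 2^-1 ^+ j)) => //.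
- by have := p_ge2 j; lra.
- by rewrite -[index_enum _]enumT size_enum_ord.
- by move=> i; exact: increment_measurable.
- by move=> i; apply: hY.2 => //; exact: (parentP _ _).2.
Qed.

Let dominatorP j i w : (i < N j.+1)%N ->
  `|Y (c j (parent j i)) w - Y (c j.+1 i) w| <= dominator j w.
Proof.
move=> iN; apply: (le_trans (@le_add_powR _ (L j) (p j) _ (L_gt0 j) _ _)) => //.
  by have := p_ge2 j; lra.
rewrite lerD2l ler_wpM2l ?powR_ge0// (bigD1 (Ordinal iN))//= lerDl.
by apply: sumr_ge0 => l _; exact: powR_ge0.
Qed.

Let ancestor_dist k n i w : (i < N (k + n))%N ->
  `|Y (c k (ancestor k n i)) w - Y (c (k + n)%N i) w| <= \sum_(j < n) dominator (k + j) w.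
Proof.
elim: n i => [|n IH] i iN /=; first by rewrite addn0 subrr normr0 big_ord0.
rewrite big_ord_recr/=.
have h1 := IH _ (parentP (k + n) i).1.
move: iN; rewrite addnS => /(@dominatorP _ _ w) h2.
have := ler_normD (Y (c k (ancestor k n (parent (k + n) i))) w - Y (c (k + n)%N (parent (k + n) i)) w)
  (Y (c (k + n)%N (parent (k + n) i)) w - Y (c (k + n).+1 i) w).
rewrite addrA subrK; lra.
Qed.

(** For the increments outside the nets the exponent 2 is enough: there are finitely many, and their
    cost is absorbed by the depth of the chain or by [delta]. The [+ 1] makes the truncation level
    positive. *)
Let two_point t s (r : R) : 0 < r -> (gamma t s <= r%:E)%E ->
  exists2 f, mean_le P f (2 * ((K 2 + 1) * r)) & forall w, `|Y t w - Y s w| <= f w.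
Proof.
move=> r0 ts.
have l0 : 0 < (K 2 + 1) * r by rewrite mulr_gt0.
exists (fun w => (K 2 + 1) * r + ((K 2 + 1) * r) `^ (1 - 2) *
    \sum_(i <- [:: tt]) `|Y t w - Y s w| `^ 2).
  apply: (@mean_le_max _ _ _ P _ [:: tt] (fun=> fun w => Y t w - Y s w) _ _ (K 2 * r)) => //.
  - by rewrite ler1n.
  - by rewrite /= mul1r ge0_ler_powR ?nnegrE ?(ltW l0)// ?mulr_ge0 ?(ltW r0)// ler_wpM2r ?(ltW r0)// lerDl.
  - by move=> i; exact: increment_measurable.
  - by move=> _; exact: hY.2.
by move=> w; rewrite big_seq1; apply: le_add_powR => //; lra.
Qed.

(** Each [s i] is attached to a center of level [k + n] and chained down to level [k]. Two close
    points then communicate with the bridge chosen for their two cells through four chains, whence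
    [4 * E]. The mean bound does not involve [m]. *)
Lemma finite_modulus k (delta : R) m (s : 'I_m -> T) (theta : R) : 0 < delta -> 0 < theta ->
  (forall n, \sum_(j < n) L (k + j)%N <= theta) ->
  exists2 G, mean_le P G (16 * theta + 2 * (N k)%:R ^+ 2 * (K 2 + 1) * delta) &
  forall i j w, (gamma (s i) (s j) < delta%:E)%E -> `|Y (s i) w - Y (s j) w| <= G w.
Proof.
move=> d0 th0 tail.
pose M := m%:R * (K 2 + 1).
have M0 : 0 <= M by rewrite mulr_ge0// ltW.
(* A depth at which the [m] last links cost at most [theta] in total; it depends on [m], the final
   bound does not. *)
have [n hn] : exists n, M * 2^-1 ^+ (k + n) <= theta.
  have h0 : (fun n => M * 2^-1 ^+ n) @ \oo --> (0 : R).
    rewrite -(mulr0 M); apply: cvgMr; apply: cvg_expr.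
    by rewrite gtr0_norm//; lra.
  have := h0 => /cvgrPdist_le/(_ _ th0)[n _ hn].
  exists n; have := hn (k + n)%N; rewrite /= leq_addl => /(_ isT).
  by rewrite sub0r normrN ger0_norm// mulr_ge0// exprn_ge0.
have [a ha] := choice (fun i : 'I_m => net (k + n) (s i)).
have h2 i := @two_point _ (s i) _ _ (ha i).2.
have pw : 0 < 2^-1 ^+ (k + n) :> R by rewrite exprn_gt0.
have /choice[f hf] : forall i, exists f, mean_le P f (2 * ((K 2 + 1) * 2^-1 ^+ (k + n))) /\
    forall w, `|Y (c (k + n)%N (a i)) w - Y (s i) w| <= f w.
  by move=> i; have [f f1 f2] := h2 pw i; exists f.
pose b i : 'I_(N k) := Ordinal (ancestor_lt (ha i).1).
(* One close pair is kept per pair of cells, so that there are at most [(N k)^2] bridges however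
   many points there are. *)
pose bridge (x : 'I_(N k) * 'I_(N k)) :=
  [pick ij : 'I_m * 'I_m | (b ij.1 == x.1) && (b ij.2 == x.2) && (gamma (s ij.1) (s ij.2) < delta%:E)%E].
have /choice[h hh] : forall x, exists h, mean_le P h (2 * ((K 2 + 1) * delta)) /\
    forall ij w, bridge x = Some ij -> `|Y (s ij.1) w - Y (s ij.2) w| <= h w.
  move=> x; rewrite /bridge; case: pickP => [ij /andP[_ /ltW hij]|_].
    have [h h1 h3] := two_point d0 hij; exists h; split=> // _ w [<-]; exact: h3.
  exists (cst 0); split=> //; apply: mean_leW (mean_le_cst P (lexx 0)).
  by rewrite mulr_ge0// mulr_ge0 ?(ltW d0)// ltW.
pose E w := \sum_i f i w + \sum_(j < n) dominator (k + j) w.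
have close i w : `|Y (c k (b i)) w - Y (s i) w| <= E w.
  have := ancestor_dist w (ha i).1; have := (hf i).2 w.
  have := ler_normD (Y (c k (b i)) w - Y (c (k + n)%N (a i)) w)
    (Y (c (k + n)%N (a i)) w - Y (s i) w).
  rewrite addrA subrK /E (bigD1 i)//=.
  have : 0 <= \sum_(l < m | l != i) f l w.
    by apply: sumr_ge0 => l _; have [[_ +] _] := hf l; exact.
  lra.
have Emean : mean_le P E (4 * theta).
  have hS := mean_leD (mean_le_sum (index_enum 'I_m) (fun i => (hf i).1))
    (mean_le_sum (index_enum 'I_n) (fun j : 'I_n => dominator_mean (k + j))).
  apply: mean_leW hS; rewrite -!mulr_sumr sumr_const card_ord -[_ *+ m]mulr_natl.
  have := tail n; move: hn; rewrite /M -mulrA; lra.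
exists (fun w => 4 * E w + \sum_x h x w).
  apply: (mean_leW _ (mean_leD (mean_leZ _ Emean)
    (mean_le_sum (index_enum _) (fun x => (hh x).1)))) => //.
  rewrite sumr_const card_prod card_ord -[_ *+ (_ * _)]mulr_natl natrM; nra.
move=> i j w ij; rewrite (bigD1 (b i, b j))//=.
have : 0 <= \sum_(x | x != (b i, b j)) h x w.
  by apply: sumr_ge0 => x _; have [[_ +] _] := hh x; exact.
have [_] := hh (b i, b j); rewrite /bridge; case: pickP => [[i0 j0]/=|/(_ (i, j))/=]; last first.
  by rewrite !eqxx ij.
move=> /andP[/andP[/eqP bi /eqP bj] _] /(_ (i0, j0) w erefl)/=.
have := close i w; have := close j w; have := close i0 w; have := close j0 w.
rewrite bi bj.
move: (E w) (Y (c k (b i)) w) (Y (c k (b j)) w) => e y1 y2.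
rewrite !ler_norml => /andP[? ?] /andP[? ?] /andP[? ?] /andP[? ?] /andP[? ?] ?.
by apply/andP; split; lra.
Qed.

End one_field.

(* Since [delta] depends neither on [P] nor on [Y] nor on [s], this gives the asymptotic
   equicontinuity of the empirical processes. *)
Lemma chaining_modulus (e eta : R) : 0 < e -> 0 < eta -> exists2 delta : R, 0 < delta &
  forall d (Omega : measurableType d) (P : probability Omega R) (Y : T -> Omega -> R)
    (s : nat -> T), moment_class P Y ->
    measurable [set w | exists i j, (gamma (s i) (s j) < delta%:E)%E /\
      e < `|Y (s i) w - Y (s j) w|] /\
    (P [set w | exists i j, (gamma (s i) (s j) < delta%:E)%E /\
      (e < `|Y (s i) w - Y (s j) w|)%R] <= eta%:E)%E.
Proof.
move=> e0 eta0.
(* Markov allows a mean of [e * eta]: the chains spend [16 * theta], one half, and the choice of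
   [delta] leaves the other half to the bridges. *)
pose theta := e * eta / 32.
have th0 : 0 < theta by rewrite divr_gt0// mulr_gt0.
have [k tail] := summable_tail th0.
pose M := 4 * (N k)%:R ^+ 2 * (K 2 + 1) + 1.
have M0 : 0 < M.
  by rewrite ltr_wpDl// mulr_ge0 ?(ltW K21)// mulr_ge0 ?sqr_ge0.
exists (e * eta / M); first by rewrite divr_gt0// mulr_gt0.
move=> d Omega P Y s hY; set delta := e * eta / M.
have d0 : 0 < delta by rewrite divr_gt0// mulr_gt0.
pose A i j := [set w | e < `|Y (s i) w - Y (s j) w|].
have mA i j : measurable (A i j).
  rewrite (_ : A i j = setT `&` (fun w => `|Y (s i) w - Y (s j) w|) @^-1` `]e, +oo[%classic).
    have m1 : measurable_fun setT (fun w => `|Y (s i) w - Y (s j) w|).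
      by apply: measurableT_comp => //; exact: (increment_measurable hY).
    exact: m1.
  by apply/seteqP; split=> w; rewrite /A/= in_itv/= andbT// => -[].
(* The finite bound being uniform in [m], continuity of [P] along increasing events extends it to
   the whole sequence. *)
pose F m := [set w | exists i j : 'I_m, (gamma (s i) (s j) < delta%:E)%E /\
      e < `|Y (s i) w - Y (s j) w|].
have mF m : measurable (F m).
  rewrite (_ : F m = \bigcup_(i in [set: 'I_m]) \bigcup_(j in [set: 'I_m])
      (if (gamma (s i) (s j) < delta%:E)%E then A i j else set0)).
    by do 2 (apply: fin_bigcup_measurable => // ? _); case: ifP.
  apply/seteqP; split=> w /=.
    by move=> [i [j [g1 g2]]]; exists i => //; exists j => //; rewrite g1.
  by move=> [i _ [j _]]; case: ifP => // g1 g2; exists i, j.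
have ndF : nondecreasing_seq F.
  move=> m m' mm'; apply/subsetPset => w [i [j h]].
  by exists (widen_ord mm' i), (widen_ord mm' j).
rewrite (_ : [set w | _] = \bigcup_m F m); last first.
  apply/seteqP; split=> w /=.
    move=> [i [j h]].
    have im : (i < (maxn i j).+1)%N by rewrite ltnS leq_maxl.
    have jm : (j < (maxn i j).+1)%N by rewrite ltnS leq_maxr.
    by exists (maxn i j).+1 => //; exists (Ordinal im), (Ordinal jm).
  by move=> [m _ [i [j h]]]; exists i, j.
have mU : measurable (\bigcup_m F m) by exact: bigcup_measurable.
split=> //.
have cv := nondecreasing_cvg_mu (mu := P) mF mU ndF.
rewrite -(cvg_lim _ cv)//; apply: lime_le; first by apply/cvg_ex; exists (P (\bigcup_m F m)).
apply: nearW => m /=.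
have [G Gm hG] := finite_modulus hY (fun i : 'I_m => s i) d0 th0 tail.
apply: (le_trans (@mean_le_markov _ _ _ P _ _ e (F m) e0 Gm (mF m) _)).
  by move=> w [i [j [g1 /ltW g2]]]; apply: (le_trans g2); exact: hG.
rewrite lee_fin ler_pdivrMr//.
have -> : 16 * theta = e * eta / 2 by rewrite /theta; lra.
have : 2 * (N k)%:R ^+ 2 * (K 2 + 1) * delta <= e * eta / 2.
  have : M * delta = e * eta by rewrite /delta mulrC divfK ?gt_eqF.
  rewrite /M; nra.
rewrite [eta * e]mulrC; lra.
Qed.

End chaining.

(** * Metric entropy and Grand Lebesgue distances *)

Local Open Scope ereal_scope.

(** * From the entropy integral to dyadic sums *)

Section dyadic_sums.
Context (R : realType) (f : R -> \bar R).
Hypothesis f_ge0 : forall x, 0 <= f x.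
Hypothesis f_anti : forall x y, (x <= y)%R -> f y <= f x.

Lemma antitone_measurable (D : set R) : measurable D -> measurable_fun D f.
Proof.
move=> mD.
apply: (measurability (@ErealGenCInfty.G R)) => [|/= _ [_] [r] -> <-].
  exact: ErealGenCInfty.measurableE.
apply: measurableI => //; apply: is_interval_measurable => s t/=.
rewrite !in_itv/= !andbT => fs ft u /andP[su ut].
by rewrite in_itv/= andbT (le_trans ft)// f_anti.
Qed.

Let mu := @lebesgue_measure R.

(** On each dyadic interval the integrand is at least its value at the right end. Keeping the
    integral over the remaining interval is what makes the induction pass. *)
Lemma dyadic_le_integral n :
  \int[mu]_(x in `[0%R, (2^-1 ^+ n)%R]) f x +
  \sum_(j < n) (2^-1 ^+ j.+1)%:E * f (2^-1 ^+ j)%R <= \int[mu]_(x in `[0%R, 1%R]) f x.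
Proof.
elim: n => [|n IH]; first by rewrite big_ord0 adde0 expr0.
apply: le_trans IH; rewrite big_ord_recr/= [X in _ + X]addeC addeA leeD2r//.
have p1 : (0 < 2^-1 ^+ n.+1 :> R)%R by rewrite exprn_gt0.
have p2 : (2^-1 ^+ n.+1 < 2^-1 ^+ n :> R)%R.
  by rewrite exprS gtr_pMl ?exprn_gt0//; lra.
have mf D : measurable D -> measurable_fun D f := @antitone_measurable D.
rewrite (_ : `[0%R, (2^-1 ^+ n)%R]%classic =
    `[0%R, (2^-1 ^+ n.+1)%R]%classic `|` `](2^-1 ^+ n.+1)%R, (2^-1 ^+ n)%R]%classic); last first.
  by rewrite -itv_bndbnd_setU ?bnd_simp ?ltW.
rewrite ge0_integral_setU//; last 2 first.
- by apply: mf; exact: measurableU.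
- apply/disj_setPS => x /= [].
  by rewrite !in_itv/= => /andP[_ h1] /andP[h2 _]; have := lt_le_trans h2 h1; rewrite ltxx.
rewrite leeD2l//.
apply: (@le_trans _ _ (\int[mu]_(x in `](2^-1 ^+ n.+1)%R, (2^-1 ^+ n)%R]) cst (f (2^-1 ^+ n)%R) x)).
  have mI : mu `](2^-1 ^+ n.+1)%R, (2^-1 ^+ n)%R]%classic = (2^-1 ^+ n.+1)%:E.
    rewrite /mu lebesgue_measure_itv/= lte_fin p2 -EFinD; congr EFin.
    by rewrite exprS; field.
  by rewrite integral_cst// [X in _ <= _ * X]mI muleC.
apply: (@ge0_le_integral _ (measurableTypeR R) R mu) => //.
- by move=> x _; exact: f_ge0.
- exact: mf.
by move=> x /=; rewrite in_itv/= => /andP[_ h]; exact: f_anti.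
Qed.

Lemma antitone_dyadic_sum : \int[mu]_(x in `[0%R, 1%R]) f x < +oo ->
  (forall j, f (2^-1 ^+ j)%R \is a fin_num) /\
  exists C : R, forall n, (\sum_(j < n) 2^-1 ^+ j * fine (f (2^-1 ^+ j)%R) <= C)%R.
Proof.
move=> fy.
have I0 D : 0 <= \int[mu]_(x in D) f x by exact: integral_ge0.
have fin j : f (2^-1 ^+ j)%R \is a fin_num.
  rewrite ge0_fin_numE//.
  have h : (2^-1 ^+ j.+1)%:E * f (2^-1 ^+ j)%R < +oo.
    apply: le_lt_trans fy; apply: le_trans (dyadic_le_integral j.+1).
    rewrite big_ord_recr/= addeA leeDr// adde_ge0//.
    by apply: sume_ge0 => i _; rewrite mule_ge0// lee_fin exprn_ge0.
  have p1 : (0 < 2^-1 ^+ j.+1 :> R)%R by rewrite exprn_gt0.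
  move: h; rewrite !ltey; apply: contra => /eqP ->.
  by rewrite gt0_muley ?lte_fin.
split=> //; exists (2 * fine (\int[mu]_(x in `[0%R, 1%R]) f x))%R => n.
have If : \int[mu]_(x in `[0%R, 1%R]) f x \is a fin_num by rewrite ge0_fin_numE.
rewrite -lee_fin EFinM fineK//.
have -> : (\sum_(j < n) 2^-1 ^+ j * fine (f (2^-1 ^+ j)%R))%:E =
    2%:E * \sum_(j < n) (2^-1 ^+ j.+1)%:E * f (2^-1 ^+ j)%R.
  rewrite ge0_sume_distrr; last first.
    by move=> i _; rewrite mule_ge0// lee_fin exprn_ge0.
  rewrite -sumEFin; apply: eq_bigr => i _.
  rewrite -[in RHS](fineK (fin i)) -!EFinM; congr EFin.
  by rewrite exprS; field.
rewrite lee_wpmul2l ?lee_fin//; apply: le_trans (dyadic_le_integral n).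
by rewrite leeDr.
Qed.

End dyadic_sums.

Section entropy.
Context (R : realType).
Implicit Types (psi : R -> \bar R) (x y : \bar R).

Lemma v_star_le psi x y : x <= y -> v_star psi x <= v_star psi y.
Proof.
move=> xy; apply: le_ereal_inf_tmp => _ [z /= z01 <-].
apply: (@le_trans _ _ (x * z%:E + lne (psi z^-1%R))).
  by apply: ereal_inf_lbound; exists z.
rewrite leeD2r// lee_wpmul2r// lee_fin.
by move: z01; rewrite in_itv/= => /andP[/ltW].
Qed.

(** The infimum need not be attained, hence the strict bound. The inverse of the witness is the
    exponent used at that scale. *)
Lemma v_star_witness psi x (a : R) : (0 < a)%R ->
  expeR (v_star psi x) < a%:E ->
  exists2 z : R, (0 < z < 1)%R & x * z%:E + lne (psi z^-1%R) < (ln a)%:E.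
Proof.
move=> a0; have -> : a%:E = expeR (ln a)%:E by rewrite /= lnK ?posrE.
rewrite lte_expeR => /ereal_inf_lt[_ [z /= z01 <-] h].
by exists z => //; move: z01; rewrite in_itv.
Qed.

Context (T : Type) (rho : T -> T -> \bar R).

Lemma covering_number_le (e e' : R) : (e <= e')%R ->
  covering_number rho e' <= covering_number rho e.
Proof.
move=> ee'; apply: le_ereal_inf_tmp => _ [n [c hc] <-].
apply: ereal_inf_lbound; exists n => //; exists c => t.
have [i hi] := hc t; exists i; apply: (le_trans hi); by rewrite lee_fin.
Qed.

Lemma covering_number_ge0 (e : R) : 0 <= covering_number rho e.
Proof. by apply: le_ereal_inf_tmp => _ [n _ <-]; rewrite lee_fin. Qed.

Lemma covering_number_attained (e : R) : covering_number rho e < +oo ->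
  exists n (c : 'I_n -> T), covering_number rho e = n%:R%:E /\
    forall t, exists i, rho (c i) t <= e%:E.
Proof.
move=> /ereal_inf_lt[_ [n0 hn0 _] _].
pose A := fun n : nat => `[< exists c : 'I_n -> T, forall t : T, exists i : 'I_n, rho (c i) t <= e%:E >].
have exA : exists n, A n by exists n0; exact/asboolP.
have [n /asboolP[c hc] nmin] := ex_minnP exA.
exists n, c; split=> //; apply/eqP; rewrite eq_le; apply/andP; split.
  by apply: ereal_inf_lbound; exists n => //; exists c.
apply: le_ereal_inf_tmp => _ [m hm <-]; rewrite lee_fin ler_nat.
by apply: nmin; exact/asboolP.
Qed.

Lemma metric_entropy_le (e e' : R) : (e <= e')%R ->
  metric_entropy rho e' <= metric_entropy rho e.
Proof.
move=> ee'; rewrite /metric_entropy lee_lne ?in_itv/= ?leey ?andbT ?covering_number_ge0//.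
exact: covering_number_le.
Qed.

Lemma sqrt_mul_ln_le (p : R) : (1 <= p)%R -> (Num.sqrt p * ln p <= 2 * p)%R.
Proof.
move=> p1; have p0 : (0 < p)%R by lra.
have s0 : (0 < Num.sqrt p)%R by rewrite sqrtr_gt0.
have hp : (Num.sqrt p ^+ 2 = p)%R by rewrite sqr_sqrtr// ltW.
have -> : ln p = (ln (Num.sqrt p) *+ 2)%R by rewrite -lnXn// hp.
have : (Num.sqrt p * ln (Num.sqrt p) <= Num.sqrt p ^+ 2)%R.
  by rewrite expr2 ler_pM2l// ltW// ln_sublinear.
rewrite hp mulr2n; lra.
Qed.

(** With [p = 1 / y] and entropy [ln n], multiplying the inequality of the witness by [p] and
    exponentiating gives [n * B^p <= a^p], where [B] is the value of [psi_bar] at [p]. The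
    comparison of [sqrt p] with [p / ln p] then introduces [2 * C0]. *)
Lemma entropy_net (C0 : R) psi (t0 : T) (e a : R) :
  (0 < C0)%R -> (0 <= e)%R -> (0 < a)%R -> (forall p, 0 <= psi p) ->
  (forall p, (2 <= p)%R -> psi p = 0 -> forall t s, rho t s <= 0) ->
  expeR (v_star (psi_bar C0 psi) (metric_entropy rho e)) < a%:E ->
  exists n (c : nat -> T) p, [/\ (2 <= p)%R, psi p < +oo, (psi p = 0 -> n = 1%N),
    (n%:R * (Num.sqrt p * fine (psi p)) `^ p <= (2 * C0 * a) `^ p)%R &
    forall t, exists i, (i < n)%N /\ rho (c i) t <= e%:E].
Proof.
move=> C00 e0 a0 psi0 rho0 /(v_star_witness a0)[y /andP[y0 y1]].
set p := (y^-1)%R.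
have p0 : (0 < p)%R by rewrite invr_gt0.
have H0 : 0 <= metric_entropy rho e.
  rewrite /metric_entropy lne_ge0; apply: le_ereal_inf_tmp => _ [n [c hc] <-].
  by rewrite lee_fin ler1n; have [[i ni] _] := hc t0; rewrite (leq_ltn_trans _ ni).
have Hy : 0 <= metric_entropy rho e * y%:E by rewrite mule_ge0// lee_fin ltW.
(* Off its domain [psi_bar] is infinite, against the finite bound of the witness: so [p >= 2] and
   [psi p] is finite. *)
rewrite /psi_bar; case: ifPn => [/andP[p2 ppsi]|_ /=]; last first.
  by rewrite addey ?ltNge ?leey//; apply: contraTneq Hy => ->; rewrite leNgt ltNy0.
(* When [psi p = 0] the logarithm is -oo and the witness says nothing about the covering number; but
   the distance is then zero and one ball covers. *)
have [ps0 _|psn0] := eqVneq (psi p) 0.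
  exists 1%N, (fun=> t0), p; split=> //.
    by rewrite ps0/= mulr0 powR0 ?gt_eqF// mulr0 powR_ge0.
  by move=> t; exists 0%N; split=> //; rewrite (le_trans (rho0 p p2 ps0 _ _))// lee_fin.
have [q qE] : exists q, psi p = q%:E.
  by exists (fine (psi p)); rewrite fineK// ge0_fin_numE.
have q0 : (0 < q)%R by rewrite -lte_fin -qE lt0e psn0 psi0.
have l0 : (0 < ln p)%R by rewrite ln_gt0; lra.
set B := (C0^-1 * p / ln p * q)%R.
have B0 : (0 < B)%R by rewrite !mulr_gt0// invr_gt0.
rewrite qE -EFinM -/B lne_EFin// => hV.
have Cy : covering_number rho e < +oo.
  rewrite ltey; apply/eqP => CE; move: hV.
  by rewrite /metric_entropy CE /= gt0_mulye ?lte_fin// addye// ltNge leey.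
have [n [c [nE hc]]] := covering_number_attained Cy.
have n0 : (0 < n)%N by have [[i ni] _] := hc t0; rewrite (leq_ltn_trans _ ni).
have n0R : (0 < n%:R :> R)%R by rewrite ltr0n.
move: hV; rewrite /metric_entropy nE lne_EFin// -EFinM -EFinD lte_fin => hV.
have key : (n%:R * B `^ p <= a `^ p)%R.
  rewrite /powR !gt_eqF// -[X in (X * _ <= _)%R](@lnK _ n%:R) ?posrE// -expRD ler_expR.
  have : (p * (ln n%:R * y + ln B) <= p * ln a)%R by rewrite ler_pM2l// ltW.
  by rewrite mulrDr [(ln n%:R * y)%R]mulrC mulrA /p mulVf ?gt_eqF// mul1r.
exists n, (fun i => if insub i is Some o then c o else t0), p; split=> //.
- by move=> h; rewrite h eqxx in psn0.
- rewrite qE/=; apply: (@le_trans _ _ (n%:R * (2 * C0 * B) `^ p)%R).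
    have h0 : (0 <= Num.sqrt p * q)%R by rewrite mulr_ge0 ?sqrtr_ge0// ltW.
    have h1 : (0 <= 2 * C0 * B)%R by apply: mulr_ge0 (ltW B0); apply: mulr_ge0 (ltW C00).
    have h2 : (Num.sqrt p * q <= 2 * C0 * B)%R.
      have -> : (2 * C0 * B = 2 * p / ln p * q)%R.
        by rewrite /B; move: (ln p) l0 => l l0; field; rewrite !gt_eqF.
      rewrite ler_wpM2r ?(ltW q0)// ler_pdivlMr//; apply: sqrt_mul_ln_le; lra.
    by rewrite ler_wpM2l// ge0_ler_powR ?nnegrE// ltW.
  have c0 : (0 <= 2 * C0)%R by rewrite mulr_ge0// ltW.
  by rewrite (powRM _ c0 (ltW B0)) (powRM _ c0 (ltW a0)) mulrCA ler_wpM2l// powR_ge0.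
- move=> t; have [i hi] := hc t; exists i; split=> //.
  by rewrite (valK i).
Qed.

(* The factor [17 * sqrt p] is the growth of the moments of Gaussian variables.  Where [psi p]
   vanishes so does the distance, and any positive value will do. *)
Definition chain_scale psi (p : R) : R :=
  if psi p == 0 then 1%R else (17 * Num.sqrt p * fine (psi p))%R.

Lemma entropy_nets (C0 : R) psi (t0 : T) :
  (0 < C0)%R -> (forall p, 0 <= psi p) ->
  (forall p, (2 <= p)%R -> psi p = 0 -> forall t s, rho t s <= 0) ->
  \int[lebesgue_measure]_(e in `[0%R, 1%R])
     expeR (v_star (psi_bar C0 psi) (metric_entropy rho e)) < +oo ->
  exists (N : nat -> nat) (c : nat -> nat -> T) (p L : nat -> R),
  [/\ forall j t, exists i, (i < N j)%N /\ rho (c j i) t <= (2^-1 ^+ j)%:E,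
      (forall j, 0 < L j)%R /\ exists C : R, forall n, (\sum_(j < n) L j <= C)%R,
      forall j, (2 <= p j)%R,
      forall j, psi (p j) < +oo &
      forall j, ((N j.+1)%:R * (chain_scale psi (p j) * 2^-1 ^+ j) `^ p j <= L j `^ p j)%R].
Proof.
move=> C00 psi0 rho0.
set f := fun e => expeR _ => fy.
have f0 e : 0 <= f e by exact: expeR_ge0.
have fanti (x y : R) : (x <= y)%R -> f y <= f x.
  by move=> xy; rewrite /f lee_expeR; apply: v_star_le; exact: metric_entropy_le.
have [ffin [C hC]] := antitone_dyadic_sum f0 fanti fy.
(* The [+ 1] provides the strict inequality required of a witness; it adds a geometric series to the
   sum. *)
pose a j := (fine (f (2^-1 ^+ j)%R) + 1)%R.
have a0 j : (0 < a j)%R by rewrite ltr_wpDl// fine_ge0.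
have w0 j : (0 <= 2^-1 ^+ j :> R)%R by rewrite exprn_ge0.
have h j := @entropy_net C0 psi t0 (2^-1 ^+ j) (a j) C00 (w0 j) (a0 j) psi0 rho0.
have {}h j : exists x : nat * (nat -> T) * R, [/\ (2 <= x.2)%R, psi x.2 < +oo, (psi x.2 = 0 -> x.1.1 = 1%N),
    (x.1.1%:R * (Num.sqrt x.2 * fine (psi x.2)) `^ x.2 <= (2 * C0 * a j) `^ x.2)%R &
    forall t, exists i, (i < x.1.1)%N /\ rho (x.1.2 i) t <= (2^-1 ^+ j)%:E].
  have [|n [c [p hp]]] := h j _.
    by rewrite -[X in X < _]/(f _) -(fineK (ffin j)) lte_fin /a ltrDl.
  by exists (n, c, p).
have /choice[x hx] := h.
(* Links from level [j.+1] to level [j] have length [2^-1 ^+ j] but are counted by the net of level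
   [j.+1], whence the shift in [a]. The factor 34 is [17 * 2], from [chain_scale] and [entropy_net];
   the [+ 1] covers the case where [chain_scale] is 1. *)
pose L j := (2^-1 ^+ j * (34 * C0 * a j.+1 + 1))%R.
have b0 j : (0 <= 34 * C0 * a j)%R by rewrite !mulr_ge0 ?(ltW C00) ?(ltW (a0 _)).
have L0 j : (0 < L j)%R by rewrite /L mulr_gt0 ?exprn_gt0// ltr_wpDl.
exists (fun j => (x j).1.1), (fun j => (x j).1.2), (fun j => (x j.+1).2), L; split.
- by move=> j; have [_ _ _ _] := hx j.
- split=> //.
  have geo n : (\sum_(j < n) 2^-1 ^+ j <= 2 :> R)%R.
    have -> : (\sum_(j < n) 2^-1 ^+ j = 2 - 2 * 2^-1 ^+ n :> R)%R.
      elim: n => [|n IH]; first by rewrite big_ord0 expr0; lra.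
      by rewrite big_ord_recr/= IH exprS; field.
    by rewrite gerBl mulr_ge0// exprn_ge0.
  exists (68 * C0 * C + 68 * C0 + 2)%R => n.
  have -> : (\sum_(j < n) L j = 68 * C0 * \sum_(j < n) 2^-1 ^+ j.+1 * fine (f (2^-1 ^+ j.+1)) +
      (34 * C0 + 1) * \sum_(j < n) 2^-1 ^+ j)%R.
    rewrite !mulr_sumr -big_split/=; apply: eq_bigr => j _.
    by rewrite /L /a exprS; field.
  have h1 : (\sum_(j < n) 2^-1 ^+ j.+1 * fine (f (2^-1 ^+ j.+1)) <= C)%R.
    apply: le_trans (hC n.+1); rewrite big_ord_recl lerDr mulr_ge0 ?exprn_ge0//.
    exact: fine_ge0.
  have h2 := geo n.
  have : (68 * C0 * \sum_(j < n) 2^-1 ^+ j.+1 * fine (f (2^-1 ^+ j.+1)) <= 68 * C0 * C)%R.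
    by rewrite ler_wpM2l// mulr_ge0// ltW.
  have : ((34 * C0 + 1) * \sum_(j < n) 2^-1 ^+ j <= (34 * C0 + 1) * 2)%R.
    by rewrite ler_wpM2l// addr_ge0// mulr_ge0// ltW.
  lra.
- by move=> j; have [] := hx j.+1.
- by move=> j; have [] := hx j.+1.
- move=> j; have [] := hx j.+1.
  move: (x j.+1).2 (x j.+1).1.1 => p n p2 psiy psi1 hn _.
  have p0 : (0 <= p)%R by lra.
  rewrite /chain_scale; case: eqP => [/psi1 ->|_].
    rewrite !mul1r ge0_ler_powR ?nnegrE ?(ltW (L0 j))// /L ler_peMr//.
    by rewrite lerDr.
  have s0 : (0 <= Num.sqrt p * fine (psi p))%R by rewrite mulr_ge0 ?sqrtr_ge0// fine_ge0.
  have -> : (17 * Num.sqrt p * fine (psi p) * 2^-1 ^+ j =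
      (17 * 2^-1 ^+ j) * (Num.sqrt p * fine (psi p)))%R by ring.
  rewrite (powRM _ _ s0) ?mulr_ge0// mulrCA.
  apply: (@le_trans _ _ ((17 * 2^-1 ^+ j) `^ p * (2 * C0 * a j.+1) `^ p)%R).
    by rewrite ler_wpM2l// powR_ge0.
  have c0 : (0 <= 2 * C0 * a j.+1)%R by rewrite !mulr_ge0 ?(ltW C00) ?(ltW (a0 _)).
  have e0 : (0 <= 17 * 2^-1 ^+ j :> R)%R by rewrite mulr_ge0.
  rewrite -(powRM _ e0 c0); apply: ge0_ler_powR; rewrite ?nnegrE ?(ltW (L0 j))//.
    by rewrite mulr_ge0.
  have -> : (17 * 2^-1 ^+ j * (2 * C0 * a j.+1) = 2^-1 ^+ j * (34 * C0 * a j.+1))%R by ring.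
  by rewrite /L ler_wpM2l// lerDl.
Qed.

End entropy.

Section grand_lebesgue_distance.
Context d (R : realType) (Omega : measurableType d) (P : probability Omega R).
Context (T : Type) (xi : T -> Omega -> R).
Hypothesis mxi : forall t, measurable_fun setT (xi t).

Let psi := moment_function P xi.
Let gamma := gls_distance P psi xi.

Lemma moment_function_ge0 (t0 : T) p : 0 <= psi p.
Proof.
apply: (@le_trans _ _ ('N[P]_(p%:E)[EFin \o xi t0])); first exact: Lnorm_ge0.
by apply: ereal_sup_ubound; exists t0.
Qed.

(** All the [xi t] then vanish almost surely, so the increments are null at every order, not only at
    [p]. *)
Lemma moment_function_eq0 p t s : (0 < p)%R -> psi p = 0 ->
  ae_eq P setT (EFin \o (fun w => xi t w - xi s w)%R) (cst 0).
Proof.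
move=> p0 p0E.
have N0 t' : EFin \o xi t' = \0 %[ae P].
  apply: (@Lnorm_eq0_eq0 _ _ _ _ _ p%:E); [exact/measurable_EFinP|by rewrite lte_fin|].
  apply/eqP; rewrite eq_le Lnorm_ge0 andbT -p0E.
  by apply: ereal_sup_ubound; exists t'.
near=> w => _ /=.
have : EFin (xi t w) = 0 by near: w; apply: filterS (N0 t) => w; exact.
have : EFin (xi s w) = 0 by near: w; apply: filterS (N0 s) => w; exact.
by move=> [->] [->]; rewrite subrr.
Unshelve. all: by end_near. Qed.

Lemma Lnorm_ae0 (f : Omega -> R) q : (0 < q)%R -> measurable_fun setT f ->
  ae_eq P setT (EFin \o f) (cst 0) -> 'N[P]_(q%:E)[EFin \o f] = 0.
Proof.
move=> q0 mf f0; apply: (@poweR_eq0_eq0 _ _ q); first exact: Lnorm_ge0.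
rewrite poweR_Lnorm ?gt_eqF// (ae_eq_integral (cst 0))//.
- by rewrite integral0.
- apply/measurable_EFinP; apply: (measurableT_comp (measurable_powR q)).
  exact: measurableT_comp.
- by apply: filterS f0 => w /(_ I)/= [fw0] _ /=; rewrite fw0 normr0 powR0 ?gt_eqF.
Qed.

Lemma gls_distance_le0 p t s : (0 < p)%R -> psi p = 0 -> gamma t s <= 0.
Proof.
move=> p0 p0E; apply: ge_ereal_sup => _ [q [q1 _] <-].
rewrite (Lnorm_ae0 _ _ (moment_function_eq0 _ _ p0 p0E)) ?mul0e//; first lra.
exact: measurable_funB.
Qed.

Lemma gls_distance_moment p t s (r : R) : (1 <= p)%R -> psi p < +oo ->
  (0 <= r)%R -> gamma t s <= r%:E ->
  \int[P]_w (`|xi t w - xi s w| `^ p)%:E <= ((fine (psi p) * r) `^ p)%:E.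
Proof.
move=> p1 py r0 gr.
have p0 : (0 < p)%R by lra.
have psi0 : 0 <= psi p := moment_function_ge0 t p.
have qE : psi p = (fine (psi p))%:E by rewrite fineK// ge0_fin_numE.
have N_le : 'N[P]_(p%:E)[EFin \o (fun w => xi t w - xi s w)%R] <= (fine (psi p) * r)%:E.
  have [p0E|pn0] := eqVneq (psi p) 0.
    rewrite (Lnorm_ae0 _ _ (moment_function_eq0 _ _ p0 p0E))//; last exact: measurable_funB.
    by rewrite p0E mul0r.
  have q0 : (0 < fine (psi p))%R by rewrite -lte_fin -qE lt0e pn0 psi0.
  have : 'N[P]_(p%:E)[EFin \o (fun w => xi t w - xi s w)%R] * (psi p)^-1 <= r%:E.
    by apply: le_trans gr; apply: ereal_sup_ubound; exists p.
  by rewrite {1}qE inver (gt_eqF q0) lee_pdivrMr// EFinM muleC.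
have -> : \int[P]_w (`|xi t w - xi s w| `^ p)%:E =
    'N[P]_(p%:E)[EFin \o (fun w => xi t w - xi s w)%R] `^ p.
  by rewrite poweR_Lnorm ?gt_eqF.
rewrite -poweR_EFin gt0_ler_poweR ?(ltW p0)// in_itv/= ?Lnorm_ge0 ?leey//.
by rewrite lee_fin mulr_ge0// fine_ge0.
Qed.

Lemma gls_distance_sym t s : gamma t s = gamma s t.
Proof.
rewrite /gamma /gls_distance /gls_norm; congr (ereal_sup (_ @` _)).
apply/funext => p; congr (_ * _); rewrite -oppe_Lnorm; congr (Lnorm _ _ _).
by apply/funext => w; rewrite /= opprB.
Qed.

Lemma gls_distance_triangle t s r : gamma t r <= gamma t s + gamma s r.
Proof.
apply: ge_ereal_sup => _ [p [p1 py] <-].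
have psi0 := moment_function_ge0 t p.
have mink := minkowski_EFin P (measurable_funB (mxi t) (mxi s)) (measurable_funB (mxi s) (mxi r)) p1.
have E : EFin \o (fun w => xi t w - xi r w)%R =
    EFin \o ((fun w => xi t w - xi s w) \+ (fun w => xi s w - xi r w))%R.
  by apply/funext => w /=; rewrite addrA subrK.
rewrite E; apply: (le_trans (lee_wpmul2r _ mink)); first by rewrite inve_ge0.
rewrite ge0_muleDl ?Lnorm_ge0//.
by apply: leeD; apply: ereal_sup_ubound; exists p.
Qed.

End grand_lebesgue_distance.

Local Close Scope ereal_scope.

(** * Suprema of Gaussian fields *)

Section square_integrable.
Context (R : realType) d (Omega : measurableType d) (P : probability Omega R).
Implicit Types (f g : Omega -> R).

Definition square_integrable f :=
  measurable_fun setT f /\ P.-integrable setT (EFin \o (fun w => f w ^+ 2)).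

Lemma square_integrableM f g : square_integrable f -> square_integrable g ->
  P.-integrable setT (EFin \o (fun w => f w * g w)).
Proof.
move=> [mf f2] [mg g2].
apply: (le_integrable measurableT _ _ (integrableD_fin f2 g2)).
  by apply/measurable_EFinP; exact: measurable_funM.
move=> w _ /=; rewrite lee_fin [leRHS]ger0_norm ?addr_ge0 ?sqr_ge0//.
rewrite normrM -(real_normK (num_real (f w))) -(real_normK (num_real (g w))).
have := normr_ge0 (f w); have := normr_ge0 (g w); have := sqr_ge0 (`|f w| - `|g w|).
nra.
Qed.

Lemma square_integrableZ (k : R) f : square_integrable f ->
  square_integrable (fun w => k * f w).
Proof.
move=> [mf f2]; split; first exact: measurable_funM.
have := integrableZl_fin (k ^+ 2) f2; apply: eq_integrable => // w _ /=.
by rewrite exprMn.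
Qed.

Lemma square_integrableD f g : square_integrable f -> square_integrable g ->
  square_integrable (fun w => f w + g w).
Proof.
move=> hf hg; split; first exact: measurable_funD hf.1 hg.1.
have := integrableD_fin (integrableD_fin hf.2 (integrableZl_fin 2 (square_integrableM hf hg))) hg.2.
by apply: eq_integrable => // w _ /=; congr EFin; ring.
Qed.

Lemma square_integrable_sum (I : Type) (r : seq I) (F : I -> Omega -> R) :
  (forall i, square_integrable (F i)) -> square_integrable (fun w => \sum_(i <- r) F i w).
Proof.
move=> hF; elim: r => [|i r IH].
  under eq_fun do rewrite big_nil; split; first exact: measurable_cst.
  rewrite expr2 mulr0; exact: integrable0.
under eq_fun do rewrite big_cons.
exact: square_integrableD.
Qed.

Lemma square_integrable1 f : square_integrable f -> P.-integrable setT (EFin \o f).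
Proof. by move=> [mf f2]; exact: integrable_of_sqr. Qed.

End square_integrable.

Section product_moments.
Context (R : realType) d1 d2 (T1 : measurableType d1) (T2 : measurableType d2).
Context (P1 : probability T1 R) (P2 : probability T2 R).

Lemma ge0_integral_fst (f : T1 -> R) : measurable_fun setT f -> (forall x, 0 <= f x) ->
  (\int[(P1 \x P2)%E]_z (f z.1)%:E = \int[P1]_x (f x)%:E)%E.
Proof.
move=> mf f0; rewrite fubini_tonelli1//; last 2 first.
- by apply/measurable_EFinP; exact: (measurableT_comp mf measurable_fst).
- by move=> z; rewrite lee_fin.
apply: eq_integral => x _; rewrite /fubini_F/= integral_cst//.
by rewrite [X in (_ * X)%E](probability_setT P2) mule1.
Qed.

Lemma ge0_integral_snd (f : T2 -> R) : measurable_fun setT f -> (forall x, 0 <= f x) ->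
  (\int[(P1 \x P2)%E]_z (f z.2)%:E = \int[P2]_x (f x)%:E)%E.
Proof.
move=> mf f0; rewrite fubini_tonelli1//; last 2 first.
- by apply/measurable_EFinP; exact: (measurableT_comp mf measurable_snd).
- by move=> z; rewrite lee_fin.
transitivity (\int[P1]_x cst (\int[P2]_y (f y)%:E)%E x)%E => //.
by rewrite integral_cst// [X in (_ * X)%E](probability_setT P1) mule1.
Qed.

Lemma square_integrable_fst (f : T1 -> R) : square_integrable P1 f ->
  square_integrable (P1 \x P2)%E (fun z => f z.1).
Proof.
move=> [mf /integrableP[_ f2]].
have mf1 : measurable_fun setT (fun z : T1 * T2 => f z.1) by exact: (measurableT_comp mf measurable_fst).
split=> //; apply/integrableP; split.
  by apply/measurable_EFinP; exact: measurable_funX.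
under eq_integral do rewrite /= ger0_norm ?sqr_ge0//.
rewrite (@ge0_integral_fst (fun x => f x ^+ 2)); [|exact: measurable_funX|by move=> x; exact: sqr_ge0].
by move: f2; under eq_integral do rewrite /= ger0_norm ?sqr_ge0//.
Qed.

Lemma square_integrable_snd (f : T2 -> R) : square_integrable P2 f ->
  square_integrable (P1 \x P2)%E (fun z => f z.2).
Proof.
move=> [mf /integrableP[_ f2]].
have mf1 : measurable_fun setT (fun z : T1 * T2 => f z.2) by exact: (measurableT_comp mf measurable_snd).
split=> //; apply/integrableP; split.
  by apply/measurable_EFinP; exact: measurable_funX.
under eq_integral do rewrite /= ger0_norm ?sqr_ge0//.
rewrite (@ge0_integral_snd (fun x => f x ^+ 2)); [|exact: measurable_funX|by move=> x; exact: sqr_ge0].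
by move: f2; under eq_integral do rewrite /= ger0_norm ?sqr_ge0//.
Qed.

End product_moments.

(** * Anticoncentration of maxima of Gaussian vectors *)

Section anticoncentration.
Context (R : realType) d (Omega : measurableType d) (P : probability Omega R).
Variable C : Omega -> R.
Hypotheses (gC : gaussian_variable P C) (C2 : square_integrable P C)
  (C0 : \int[P]_w C w = 0) (Cvar : 0 < \int[P]_w (C w ^+ 2)).

Let v := \int[P]_w (C w ^+ 2).

(** Positive variance excludes the Dirac case, and a nondegenerate normal law has a bounded
    density. *)
Lemma gaussian_interval_le : exists2 kappa : R, 0 <= kappa &
  forall x y, x <= y -> fine (P (C @^-1` `[x, y])) <= kappa * (y - x).
Proof.
have [[s s0 CN]|CD] := centered_gaussian_law gC C2.2 C0.
  exists (2 * s)^-1; first by rewrite invr_ge0 mulr_ge0// ltW.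
  move=> x y xy; rewrite CN// mulrC -lee_fin fineK; first exact: normal_prob_itv_le.
  exact: (@fin_num_measure _ (measurableTypeR R) R (normal_prob 0 s)).
have msqr : measurable_fun setT (fun x : R => x ^+ 2) by exact: exprn_measurable.
have [_ CE] := @Rintegral_law _ _ _ P (\d_(0 : measurableTypeR R)) C C2.1 CD _ msqr C2.2.
exfalso; move: Cvar; rewrite CE /Rintegral integral_dirac//=; last exact/measurable_EFinP.
by rewrite indicE in_setT mul1r expr0n ltxx.
Qed.

Section gaussian_vector.
Variables (n : nat) (V : 'I_n -> Omega -> R).
Hypotheses (V2 : forall i, square_integrable P (V i))
  (V0 : forall i, \int[P]_w V i w = 0)
  (gV : forall (a : 'I_n -> R) b, gaussian_variable P (fun w => \sum_i a i * V i w + b * C w)).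

(** Regression coefficient of [V i] on [C]: the difference [V i - h i * C] is uncorrelated with
    [C]. *)
Let h i := (\int[P]_w (V i w * C w)) / v.

(* Replacing the component of [V i] along [C] by an independent copy of that component does
   not change the law of the vector. *)
Let W i (z : Omega * Omega) := (V i z.1 - h i * C z.1) + h i * C z.2.

Let sum2 (a : 'I_n -> R) : square_integrable P (fun w => \sum_i a i * V i w).
Proof. by apply: square_integrable_sum => i; exact: square_integrableZ. Qed.

Let sum0 (a : 'I_n -> R) : \int[P]_w (\sum_i a i * V i w) = 0.
Proof.
have [_ ->] := Rintegral_sum_fin (index_enum 'I_n)
  (fun i => square_integrable1 (square_integrableZ (a i) (V2 i))).
rewrite big1// => i _; rewrite RintegralZl ?V0 ?mulr0//; exact: square_integrable1.
Qed.

Let lin2 (a : 'I_n -> R) (b : R) : square_integrable P (fun w => \sum_i a i * V i w + b * C w).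
Proof. by apply: square_integrableD => //; exact: square_integrableZ. Qed.

Let lin0 (a : 'I_n -> R) (b : R) : \int[P]_w (\sum_i a i * V i w + b * C w) = 0.
Proof.
have iS := square_integrable1 (sum2 a).
have iC := square_integrable1 (square_integrableZ b C2).
rewrite RintegralD// sum0 add0r RintegralZl ?C0 ?mulr0//; exact: square_integrable1.
Qed.

Let sum_cov (a : 'I_n -> R) :
  P.-integrable setT (EFin \o (fun w => (\sum_i a i * V i w) * C w)) /\
  \int[P]_w ((\sum_i a i * V i w) * C w) = (\sum_i a i * h i) * v.
Proof.
have iVC i := integrableZl_fin (a i) (square_integrableM (V2 i) C2).
have [h1 h2] := Rintegral_sum_fin (index_enum 'I_n) iVC.
have E w : (\sum_i a i * V i w) * C w = \sum_i a i * (V i w * C w).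
  by rewrite mulr_suml; apply: eq_bigr => i _; rewrite mulrA.
split; first by under eq_fun do rewrite E.
under eq_Rintegral do rewrite E.
rewrite h2 mulr_suml; apply: eq_bigr => i _.
rewrite RintegralZl//; last exact: square_integrableM.
by rewrite /h -mulrA divfK// gt_eqF.
Qed.

Let residual_variance (a : 'I_n -> R) (b := \sum_i a i * h i) :
  \int[P]_w ((\sum_i a i * V i w + - b * C w) ^+ 2) =
  \int[P]_w ((\sum_i a i * V i w) ^+ 2) - b ^+ 2 * v.
Proof.
have [iSC SC] := sum_cov a.
have E w : (\sum_i a i * V i w + - b * C w) ^+ 2 =
  ((\sum_i a i * V i w) ^+ 2 + (- 2 * b) * ((\sum_i a i * V i w) * C w)) + b ^+ 2 * (C w ^+ 2).
  by ring.
have iS2 := (sum2 a).2.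
have i1 := integrableZl_fin (- 2 * b) iSC; have i2 := integrableZl_fin (b ^+ 2) C2.2.
under eq_Rintegral do rewrite E.
rewrite RintegralD//; last exact: integrableD_fin.
rewrite RintegralD// !RintegralZl//; last exact: C2.2.
rewrite SC -/v -/b; ring.
Qed.

(** Characteristic functions make it unnecessary to prove that uncorrelated Gaussian components are
    independent: on the product space the exponent involves the variance of the residual plus
    [b^2 * v], which [residual_variance] identifies with the original variance. *)
Let copy_cos (a : 'I_n -> R) phi :
  \int[(P \x P)%E]_z cos (\sum_i a i * W i z + phi) =
  \int[P]_w cos (\sum_i a i * V i w + phi).
Proof.
pose b := \sum_i a i * h i.
pose A w := (\sum_i a i * V i w + - b * C w) + phi.
have E z : cos (\sum_i a i * W i z + phi) =
    cos (A z.1) * cos (b * C z.2) - sin (A z.1) * sin (b * C z.2).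
  rewrite -cosD; congr cos; rewrite /A /b !mulNr !mulr_suml.
  rewrite addrAC; congr (_ + _); rewrite -sumrB -big_split/=.
  by apply: eq_bigr => i _; rewrite /W; ring.
have mA : measurable_fun setT A.
  by apply: measurable_funD => //; exact: (lin2 a (- b)).1.
have mB : measurable_fun setT (fun w => b * C w) by apply: measurable_funM => //; exact: C2.1.
have cos1 (x : R) : `|cos x| <= 1 by rewrite ler_norml cos_geN1 cos_le1.
have sin1 (x : R) : `|sin x| <= 1 by rewrite ler_norml sin_geN1 sin_le1.
have [i1 I1] := Rintegral_prodM P P (measurable_cos_comp mA) (measurable_cos_comp mB)
  (fun w => cos1 (A w)) (fun w => cos1 (b * C w)).
have [i2 I2] := Rintegral_prodM P P (measurable_sin_comp mA) (measurable_sin_comp mB)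
  (fun w => sin1 (A w)) (fun w => sin1 (b * C w)).
under eq_Rintegral do rewrite E.
rewrite RintegralB// I1 I2.
have gB : gaussian_variable P (fun w => b * C w).
  have := gV (fun=> 0) b.
  rewrite (_ : (fun w => _) = (fun w => b * C w))//.
  by apply/funext => w; rewrite big1 ?add0r// => i _; rewrite mul0r.
have B0 : \int[P]_w (b * C w) = 0.
  by rewrite RintegralZl ?C0 ?mulr0//; exact: square_integrable1.
have B2 := square_integrableZ b C2.
have cB := gaussian_cos_shift gB B2.2 B0 0.
have sB := gaussian_cos_shift gB B2.2 B0 (- (pi / 2)).
have -> : \int[P]_w sin (b * C w) = 0.
  under eq_Rintegral do rewrite -cosBpihalf.
  by rewrite sB cosN cos_pihalf mul0r.
have -> : \int[P]_w cos (b * C w) = expR (- ((b ^+ 2 * v) / 2)).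
  under eq_Rintegral do rewrite -[b * C _]addr0.
  rewrite cB cos0 mul1r; congr (expR (- (_ / 2))).
  under eq_Rintegral do rewrite exprMn.
  by rewrite RintegralZl//; exact: C2.2.
rewrite mulr0 subr0 /A (gaussian_cos_shift (gV a (- b)) (lin2 a (- b)).2 (lin0 a (- b))).
have gS : gaussian_variable P (fun w => \sum_i a i * V i w).
  have := gV a 0.
  rewrite (_ : (fun w => _) = (fun w => \sum_i a i * V i w))//.
  by apply/funext => w; rewrite mul0r addr0.
rewrite (gaussian_cos_shift gS (sum2 a).2 (sum0 a)) residual_variance.
rewrite -[LHS]mulrA -expRD; congr (_ * expR _); by rewrite /b; field.
Qed.

Hypothesis hcov : forall i, v / 2 <= \int[P]_w (V i w * C w).

Let h_ge i : 2^-1 <= h i.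
Proof. by rewrite /h ler_pdivlMr// mulrC. Qed.

Let W2 i : square_integrable (P \x P)%E (W i).
Proof.
apply: square_integrableD.
  apply: (@square_integrable_fst _ _ _ _ _ P P (fun w => V i w - h i * C w)).
  under eq_fun do rewrite -mulNr; apply: square_integrableD => //.
  exact: square_integrableZ.
apply: (@square_integrable_snd _ _ _ _ _ P P (fun w => h i * C w)).
exact: square_integrableZ.
Qed.

(* For a fixed first coordinate the maximum of the [W i] grows with slope at least 1/2
   in the second one. *)
Let copy_box kappa alpha beta : 0 <= kappa ->
  (forall x y, x <= y -> fine (P (C @^-1` `[x, y])) <= kappa * (y - x)) ->
  alpha <= beta ->
  fine ((P \x P)%E [set z | forall i, W i z <= beta]) <=
  fine ((P \x P)%E [set z | forall i, W i z <= alpha]) + 4 * kappa * (beta - alpha).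
Proof.
move=> k0 hk ab.
have mb c := measurable_box c (fun i => (W2 i).1).
set A := [set z | forall i, W i z <= alpha]; set B := [set z | forall i, W i z <= beta].
have AB : A `<=` B by move=> z h1 i; exact: le_trans ab.
have mD : measurable (B `\` A) := measurableD (mb beta) (mb alpha).
have hD : ((P \x P)%E (B `\` A) <= (4 * kappa * (beta - alpha))%:E)%E.
  have k1 : 0 <= 4 * kappa * (beta - alpha) by rewrite !mulr_ge0// subr_ge0.
  apply: (@le_trans _ _ (\int[P]_w cst (4 * kappa * (beta - alpha))%:E w)%E); last first.
    by rewrite integral_cst// [X in (_ * X)%E](probability_setT P) mule1.
  rewrite [leLHS](_ : _ = \int[P]_w P (xsection (B `\` A) w))%E//.
  apply: ge0_le_integral => //.
    exact: measurable_fun_xsection.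
  move=> w _ /=.
  have mX : measurable (xsection (B `\` A) w) by exact: measurable_xsection.
  have [->|/set0P[w1]] := eqVneq (xsection (B `\` A) w) set0; first by rewrite measure0 lee_fin.
  rewrite xsectionE/= => -[B1 A1].
  (* As every [h i] is at least 1/2, two points of one section have values of [C] within [del]. The
     section thus lies in an interval of length [2 * del], which gives [4 * kappa]. *)
  pose del := 2 * (beta - alpha).
  apply: (@le_trans _ _ (P (C @^-1` `[C w1 - del, C w1 + del]))).
    rewrite le_measure ?inE//; first by move: mX; rewrite xsectionE.
      by have := C2.1 measurableT _ (measurable_itv `[C w1 - del, C w1 + del]); rewrite setTI.
    move=> w2 [B2 A2].
    have hb w3 w4 : (forall i, W i (w, w3) <= beta) -> ~ (forall i, W i (w, w4) <= alpha) ->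
        C w3 - C w4 <= del.
      move=> b3 /existsNP[i /negP]; rewrite -ltNge => a4.
      have := b3 i; have := h_ge i; move: a4; rewrite /W /del /=; nra.
    rewrite /= in_itv/=; have := hb _ _ B1 A2; have := hb _ _ B2 A1.
    by move=> ? ?; apply/andP; split; lra.
  rewrite -(fineK (fin_num_measure P _ _)); last first.
    by rewrite -[_ @^-1` _]setTI; exact: C2.1.
  rewrite lee_fin; apply: (le_trans (hk _ _ _)); first by rewrite /del; lra.
  by rewrite /del; have := k0; nra.
have mA : measurable A := mb alpha.
pose Q : probability (Omega * Omega)%type R := (P \x P)%E.
have fA : (P \x P)%E A \is a fin_num by exact: (fin_num_measure Q).
have fD : (P \x P)%E (B `\` A) \is a fin_num by exact: (fin_num_measure Q).
rewrite -(setDUK AB) measureU ?setDIK// fineD// lerD2l.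
by rewrite -lee_fin fineK.
Qed.

(** The vectors [V] and [W] are compared by [box_cvg] on a constant sequence, at the price of shifts
    [e] on each side. With [e = beta - alpha] the interval grows to five times its length, turning 4
    into 20. *)
Lemma max_anticoncentration kappa alpha beta eps : 0 <= kappa ->
  (forall x y, x <= y -> fine (P (C @^-1` `[x, y])) <= kappa * (y - x)) ->
  alpha < beta -> 0 < eps ->
  fine (P [set w | forall i, V i w <= beta]) <=
  fine (P [set w | forall i, V i w <= alpha]) + 20 * kappa * (beta - alpha) + eps.
Proof.
move=> k0 hk ab eps0.
pose e := beta - alpha; have e0 : 0 < e by rewrite subr_gt0.
pose b := \sum_i (\int[P]_w (V i w ^+ 2) + \int[(P \x P)%E]_z (W i z ^+ 2)).
have nn (d' : measure_display) (T' : measurableType d') (Q : probability T' R) f :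
  0 <= \int[Q]_w (f w ^+ 2) by apply: Rintegral_ge0 => w _; exact: sqr_ge0.
have hb i : \int[P]_w (V i w ^+ 2) + \int[(P \x P)%E]_z (W i z ^+ 2) <= b.
  rewrite /b (bigD1 i)//= lerDl; apply: sumr_ge0 => j _; rewrite addr_ge0//; exact: nn.
have Vb i : \int[P]_w (V i w ^+ 2) <= b.
  by apply: le_trans (hb i); rewrite lerDl; exact: nn.
have Wb i : \int[(P \x P)%E]_z (W i z ^+ 2) <= b.
  by apply: le_trans (hb i); rewrite lerDr; exact: nn.
have eps2 : 0 < eps / 2 by lra.
have cf (a : 'I_n -> R) phi :
    (fun m : nat => \int[P]_w cos (\sum_i a i * V i w + phi)) @ \oo -->
    \int[(P \x P)%E]_z cos (\sum_i a i * W i z + phi).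
  by rewrite copy_cos; exact: cvg_cst.
have [m1 _ /(_ m1 (leqnn _))[h1 _]] := @box_cvg R n _ _ _ P _ (P \x P)%E (fun=> V) W
  (beta + e) e b (eps / 2) e0 eps2 (fun _ i => (V2 i).1) (fun i => (W2 i).1)
  (fun _ i => (V2 i).2) (fun _ => Vb) (fun i => (W2 i).2) Wb cf.
have [m2 _ /(_ m2 (leqnn _))[_ h2]] := @box_cvg R n _ _ _ P _ (P \x P)%E (fun=> V) W
  (alpha - e) e b (eps / 2) e0 eps2 (fun _ i => (V2 i).1) (fun i => (W2 i).1)
  (fun _ i => (V2 i).2) (fun _ => Vb) (fun i => (W2 i).2) Wb cf.
move: h1 h2; rewrite addrK subrK => h1 h2.
have h3 : alpha - e - e <= beta + e + e by lra.
have := copy_box k0 hk h3.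
rewrite (_ : 4 * kappa * _ = 20 * kappa * e); last by rewrite /e; ring.
rewrite -/e; lra.
Qed.

End gaussian_vector.
End anticoncentration.

Section probability_facts.
Context (R : realType) d (Omega : measurableType d) (P : probability Omega R).

Lemma measurable_forall (Q : nat -> Prop) (A : nat -> set Omega) :
  (forall i, measurable (A i)) -> measurable [set w | forall i, Q i -> A i w].
Proof.
move=> mA; rewrite (_ : [set w | _] = \bigcap_i (if `[< Q i >] then A i else setT)).
  by apply: bigcapT_measurable => i; case: ifP.
apply/seteqP; split=> w /= h i; first by move=> _; case: asboolP => // /h.
by move=> Qi; have := h i I; case: asboolP.
Qed.

Lemma measurable_exists (Q : nat -> Prop) (A : nat -> set Omega) :
  (forall i, measurable (A i)) -> measurable [set w | exists i, Q i /\ A i w].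
Proof.
move=> mA; rewrite (_ : [set w | _] = \bigcup_i (if `[< Q i >] then A i else set0)).
  by apply: bigcup_measurable => i _; case: ifP.
apply/seteqP; split=> w /=; first by move=> [i [Qi Ai]]; exists i => //; case: asboolP.
by move=> [i _]; case: asboolP => // Qi Ai; exists i.
Qed.

Lemma measurable_le (f : Omega -> R) (u : R) : measurable_fun setT f ->
  measurable [set w | f w <= u].
Proof.
move=> mf; rewrite (_ : [set w | _] = setT `&` f @^-1` `]-oo, u]%classic); first exact: mf.
by apply/seteqP; split=> w /=; rewrite in_itv/= => // -[].
Qed.

Lemma measurable_ge (f : Omega -> R) (u : R) : measurable_fun setT f ->
  measurable [set w | u <= f w].
Proof.
move=> mf; rewrite (_ : [set w | _] = setT `&` f @^-1` `[u, +oo[%classic); first exact: mf.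
by apply/seteqP; split=> w /=; rewrite in_itv/= andbT// => -[].
Qed.

Lemma measurable_gt (f : Omega -> R) (u : R) : measurable_fun setT f ->
  measurable [set w | u < f w].
Proof.
move=> mf; rewrite (_ : [set w | _] = setT `&` f @^-1` `]u, +oo[%classic); first exact: mf.
by apply/seteqP; split=> w /=; rewrite in_itv/= andbT// => -[].
Qed.

Lemma fine_prob_le (A B : set Omega) : measurable A -> measurable B -> A `<=` B ->
  fine (P A) <= fine (P B).
Proof. by move=> mA mB AB; rewrite fine_le ?fin_num_measure// le_measure ?inE. Qed.

Lemma fine_probU_le (A B : set Omega) : measurable A -> measurable B ->
  fine (P (A `|` B)) <= fine (P A) + fine (P B).
Proof.
move=> mA mB; rewrite -fineD ?fin_num_measure// fine_le ?fin_num_measure//.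
- exact: measurableU.
- by rewrite fin_numD !fin_num_measure.
- exact: measureU2.
Qed.

Lemma fine_prob_bigU_le n (A : 'I_n -> set Omega) : (forall i, measurable (A i)) ->
  fine (P (\big[setU/set0]_i A i)) <= \sum_i fine (P (A i)).
Proof.
elim: n A => [|n IH] A mA; first by rewrite !big_ord0 measure0.
rewrite !big_ord_recr/=; apply: (le_trans (fine_probU_le _ _)) => //.
  by apply: bigsetU_measurable => i _.
by rewrite lerD2r; exact: IH.
Qed.

Lemma fine_probD_le (A B : set Omega) x : measurable A -> measurable B -> A `<=` B ->
  fine (P B) <= fine (P A) + x -> fine (P (B `\` A)) <= x.
Proof.
move=> mA mB AB; rewrite -{1}(setDUK AB) measureU ?setDIK//; last exact: measurableD.
by rewrite fineD ?fin_num_measure ?lerD2l//; exact: measurableD.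
Qed.

End probability_facts.

Section gaussian_fields.
Context (R : realType) (T : Type).
Context d (Omega : measurableType d) (P : probability Omega R).

Definition centered_gaussian_field (Z : T -> Omega -> R) :=
  [/\ forall t, square_integrable P (Z t), forall t, \int[P]_w Z t w = 0 &
      gaussian_field P Z].

Lemma centered_gaussian_fieldN Z : centered_gaussian_field Z ->
  centered_gaussian_field (fun t w => - Z t w).
Proof.
move=> [Z2 Z0 gZ]; split.
- by move=> t; under eq_fun do rewrite -mulN1r; exact: square_integrableZ.
- move=> t; under eq_Rintegral do rewrite -mulN1r.
  by rewrite RintegralZl ?Z0 ?mulr0//; exact: square_integrable1.
- move=> n t a; have := gZ n t (fun i => - a i).
  by under eq_fun do under eq_bigr do rewrite mulNr -mulrN.
Qed.

Lemma gaussian_fieldS Z n (t : 'I_n -> T) c (a : 'I_n -> R) b : gaussian_field P Z ->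
  gaussian_variable P (fun w => \sum_i a i * Z (t i) w + b * Z c w).
Proof.
move=> gZ.
have := gZ n.+1 (fun i => if unlift ord_max i is Some j then t j else c)
  (fun i => if unlift ord_max i is Some j then a j else b).
rewrite (_ : (fun w => _) = (fun w => \sum_i a i * Z (t i) w + b * Z c w))//.
apply/funext => w; rewrite big_ord_recr/= unlift_none; congr (_ + _).
apply: eq_bigr => i _.
have -> : widen_ord (leqnSn n) i = lift ord_max i.
  by apply: ord_inj; rewrite lift_max.
by rewrite liftK.
Qed.

(** [kappa] depends on [c] alone, neither on the number of indices nor on the levels. *)
Lemma group_anticoncentration Z c : centered_gaussian_field Z ->
  0 < \int[P]_w (Z c w ^+ 2) ->
  exists2 kappa : R, 0 <= kappa & forall n (t : 'I_n -> T) (alpha beta eps : R),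
    (forall i, (\int[P]_w (Z c w ^+ 2)) / 2 <= \int[P]_w (Z (t i) w * Z c w)) ->
    alpha < beta -> 0 < eps ->
    fine (P [set w | forall i, Z (t i) w <= beta]) <=
    fine (P [set w | forall i, Z (t i) w <= alpha]) + 20 * kappa * (beta - alpha) + eps.
Proof.
move=> [Z2 Z0 gZ] v0.
have gc : gaussian_variable P (Z c).
  have := @gaussian_fieldS Z 0 (fun=> c) c (fun=> 0) 1 gZ.
  rewrite (_ : (fun w => _) = Z c)//.
  by apply/funext => w; rewrite big_ord0 add0r mul1r.
have [kappa k0 hk] := gaussian_interval_le gc (Z2 c) (Z0 c) v0.
exists kappa => // n t alpha beta eps hcov ab e0.
apply: (@max_anticoncentration _ _ _ P (Z c) (Z2 c) (Z0 c) v0 n (fun i => Z (t i))) => //.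
by move=> a b; exact: gaussian_fieldS.
Qed.

(** Expanding the square: twice the mixed moment is the sum of the two second moments minus that of
    the increment. *)
Lemma covariance_ge Z t c : centered_gaussian_field Z ->
  \int[P]_w ((Z t w - Z c w) ^+ 2) <= \int[P]_w (Z t w ^+ 2) ->
  (\int[P]_w (Z c w ^+ 2)) / 2 <= \int[P]_w (Z t w * Z c w).
Proof.
move=> [Z2 _ _].
have E w : (Z t w - Z c w) ^+ 2 = (Z t w ^+ 2 + (-2) * (Z t w * Z c w)) + Z c w ^+ 2 by ring.
have itc := square_integrableM (Z2 t) (Z2 c).
have i1 := integrableZl_fin (-2) itc.
under eq_Rintegral do rewrite E.
rewrite RintegralD//; [|exact: integrableD_fin (Z2 t).2 i1|exact: (Z2 c).2].
rewrite RintegralD//; [|exact: (Z2 t).2].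
rewrite RintegralZl//; lra.
Qed.

Lemma filtered_box (Z : T -> Omega -> R) (s : nat -> T) (Q : nat -> Prop) m x
    (r := [seq i <- iota 0 m | `[< Q i >]]) :
  [set w | forall j : 'I_(size r), Z (s (nth 0%N r j)) w <= x] =
  [set w | forall i, (i < m)%N /\ Q i -> Z (s i) w <= x].
Proof.
have rP i : (i \in r) <-> (i < m)%N /\ Q i.
  rewrite mem_filter mem_iota add0n leq0n/=; split; first by move=> /andP[/asboolP].
  by move=> [im Qi]; apply/andP; split=> //; exact/asboolP.
apply/seteqP; split=> w /= h.
  move=> i /rP ir; have := h (Ordinal (etrans (index_mem i r) ir)).
  by rewrite /= nth_index.
by move=> j; apply: h; apply/rP; exact: mem_nth.
Qed.

Lemma filtered_anticoncentration Z (s : nat -> T) (Q : nat -> Prop) i0 :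
  centered_gaussian_field Z -> 0 < \int[P]_w (Z (s i0) w ^+ 2) ->
  (forall i, Q i -> \int[P]_w ((Z (s i) w - Z (s i0) w) ^+ 2) <= \int[P]_w (Z (s i) w ^+ 2)) ->
  exists2 kappa : R, 0 <= kappa & forall m (alpha beta eps : R),
    alpha < beta -> 0 < eps ->
    fine (P [set w | forall i, (i < m)%N /\ Q i -> Z (s i) w <= beta]) <=
    fine (P [set w | forall i, (i < m)%N /\ Q i -> Z (s i) w <= alpha]) +
    20 * kappa * (beta - alpha) + eps.
Proof.
move=> gZ v0 hQ; have [kappa k0 hk] := group_anticoncentration gZ v0.
exists kappa => // m alpha beta eps ab e0.
rewrite -(filtered_box Z s Q m beta) -(filtered_box Z s Q m alpha).
pose r := [seq i <- iota 0 m | `[< Q i >]].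
apply: (hk _ (fun j : 'I_(size r) => s (nth 0%N r j))) => // j.
apply: covariance_ge => //; apply: hQ.
have : nth 0%N r j \in r by exact: mem_nth.
by rewrite mem_filter => /andP[/asboolP].
Qed.

End gaussian_fields.

Section absolute_boxes.
Context (R : realType) d (Omega : measurableType d) (P : probability Omega R).

Lemma measurable_abs_box (V : nat -> Omega -> R) m x : (forall i, measurable_fun setT (V i)) ->
  measurable [set w | forall i, (i < m)%N -> `|V i w| <= x].
Proof.
move=> mV.
apply: (@measurable_forall _ _ (fun i => (i < m)%N) (fun i => [set w | `|V i w| <= x])) => i.
by apply: measurable_le; exact: measurableT_comp.
Qed.

Lemma measurable_abs_box_all (V : nat -> Omega -> R) x : (forall i, measurable_fun setT (V i)) ->
  measurable [set w | forall i, `|V i w| <= x].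
Proof.
move=> mV; rewrite (_ : [set w | _] = [set w | forall i, True -> `|V i w| <= x]).
  apply: (@measurable_forall _ _ (fun=> True) (fun i => [set w | `|V i w| <= x])) => i.
  by apply: measurable_le; exact: measurableT_comp.
by apply/seteqP; split=> w /= h i //; exact: h.
Qed.

Lemma prob_bigcap_approx (F : nat -> set Omega) (eta : R) : (forall m, measurable (F m)) ->
  (forall n m, (n <= m)%N -> F m `<=` F n) -> 0 < eta ->
  exists m, fine (P (F m)) <= fine (P (\bigcap_m F m)) + eta.
Proof.
move=> mF dF eta0.
have mI : measurable (\bigcap_m F m) by exact: bigcapT_measurable.
have F0 : (P (F 0%N) < +oo)%E by rewrite -ge0_fin_numE ?fin_num_measure.
have nF : {homo F : n m / (n <= m)%N >-> (m <= n)%O}.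
  by move=> n m nm; apply/subsetPset; exact: dF.
have := nonincreasing_cvg_mu F0 mF mI nF.
rewrite -[X in _ --> X](fineK (fin_num_measure P _ mI)) => /fine_cvg/cvgrPdist_le.
move=> /(_ _ eta0)[m _ /(_ m (leqnn _))/= h]; exists m.
by move: h; rewrite ler_norml => /andP[+ _]; lra.
Qed.

Lemma abs_box_finite_approx (V : nat -> Omega -> R) (x eta : R) :
  (forall i, measurable_fun setT (V i)) -> 0 < eta -> exists m,
  fine (P [set w | forall i, (i < m)%N -> `|V i w| <= x]) <=
  fine (P [set w | forall i, `|V i w| <= x]) + eta.
Proof.
move=> mV eta0.
have -> : [set w | forall i, `|V i w| <= x] =
    \bigcap_m [set w | forall i, (i < m)%N -> `|V i w| <= x].
  apply/seteqP; split=> w /= h; first by move=> m _ i _; exact: h.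
  by move=> i; apply: (h i.+1 I).
apply: prob_bigcap_approx => //; first by move=> m; exact: measurable_abs_box.
by move=> n m nm w h i im; apply: h; exact: leq_trans nm.
Qed.

Lemma abs_box_right_approx (V : nat -> Omega -> R) (x eta : R) :
  (forall i, measurable_fun setT (V i)) -> 0 < eta -> exists2 e : R, 0 < e &
  fine (P [set w | forall i, `|V i w| <= x + e]) <=
  fine (P [set w | forall i, `|V i w| <= x]) + eta.
Proof.
move=> mV eta0.
have -> : [set w | forall i, `|V i w| <= x] =
    \bigcap_m [set w | forall i, `|V i w| <= x + m.+1%:R^-1].
  apply/seteqP; split=> w /= h.
    by move=> m _ i; apply: (le_trans (h i)); rewrite lerDl.
  move=> i; apply/ler_addgt0Pr => e e0.
  have [m hm] : exists m : nat, m.+1%:R^-1 <= e.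
    exists (Num.truncn e^-1); rewrite -[leRHS]invrK lef_pV2 ?posrE ?invr_gt0 ?ltr0n//.
    by apply: ltW; exact: truncnS_gt.
  by apply: (le_trans (h m I i)); rewrite lerD2l.
have [|m1 m2 h12 w h i|m hm] := prob_bigcap_approx
    (F := fun m => [set w | forall i, `|V i w| <= x + m.+1%:R^-1]) _ _ eta0.
- by move=> m; exact: measurable_abs_box_all.
- by apply: (le_trans (h i)); rewrite lerD2l lef_pV2 ?posrE ?ltr0n// ler_nat.
- by exists m.+1%:R^-1 => //; rewrite invr_gt0 ltr0n.
Qed.

End absolute_boxes.

(** * Suprema and continuity along a countable set of indices *)

Section supremum.
Context (R : realType) (T : Type) (gamma : T -> T -> \bar R).
Variables (K : R -> R) (supp : R -> Prop) (N : nat -> nat) (c : nat -> nat -> T).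
Hypotheses (K2_ge0 : 0 <= K 2) (supp2 : supp 2).
Hypothesis gamma_sym : forall t s, gamma t s = gamma s t.
Hypothesis gamma_tri : forall t s r, (gamma t r <= gamma t s + gamma s r)%E.
Hypothesis net : forall j t, exists i, (i < N j)%N /\ (gamma (c j i) t <= (2^-1 ^+ j)%:E)%E.
Hypothesis modulus : forall e eta : R, 0 < e -> 0 < eta -> exists2 delta : R, 0 < delta &
  forall d (Omega : measurableType d) (P : probability Omega R) (Y : T -> Omega -> R)
    (s : nat -> T), moment_class gamma K supp P Y ->
    measurable [set w | exists i j, (gamma (s i) (s j) < delta%:E)%E /\
      e < `|Y (s i) w - Y (s j) w|] /\
    (P [set w | exists i j, (gamma (s i) (s j) < delta%:E)%E /\
      (e < `|Y (s i) w - Y (s j) w|)%R] <= eta%:E)%E.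

(** The label of [i] is the number of a center of a fine net close to [s i]; equal labels mean a
    common center, and the triangle inequality concludes. *)
Lemma cells (delta : R) (s : nat -> T) : 0 < delta ->
  exists n (q : nat -> nat), forall i, (q i < n)%N /\
    forall j, q i = q j -> (gamma (s i) (s j) < delta%:E)%E.
Proof.
move=> d0.
have [J hJ] : exists J, 2 * 2^-1 ^+ J < delta.
  have h0 : (fun n => 2 * 2^-1 ^+ n) @ \oo --> (0 : R).
    rewrite -(mulr0 2); apply: cvgMr; apply: cvg_expr.
    by rewrite gtr0_norm//; lra.
  have d2 : 0 < delta / 2 by lra.
  have := h0 => /cvgrPdist_le/(_ _ d2)[n _ /(_ n (leqnn _))].
  rewrite sub0r normrN ger0_norm ?mulr_ge0 ?exprn_ge0// => h.
  by exists n; lra.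
have [q hq] := choice (fun i => net J (s i)).
exists (N J), q => i; split; first exact: (hq i).1.
move=> j qij; apply: (le_lt_trans (gamma_tri _ (c J (q i)) _)).
apply: (@le_lt_trans _ _ ((2^-1 ^+ J)%:E + (2^-1 ^+ J)%:E)%E).
  by apply: leeD; [rewrite gamma_sym; exact: (hq i).2|rewrite qij; exact: (hq j).2].
by rewrite -EFinD lte_fin; lra.
Qed.

Section one_field.
Context d (Omega : measurableType d) (P : probability Omega R).

Lemma moment_class_sqr Y t s (r : R) : moment_class gamma K supp P Y ->
  0 < r -> (gamma t s <= r%:E)%E ->
  (\int[P]_w ((Y t w - Y s w) ^+ 2)%:E <= ((K 2 * r) ^+ 2)%:E)%E.
Proof.
move=> [mY hY] r0 ts.
have := hY t s r 2 r0 ts (lexx _) supp2.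
rewrite -[2]/(2%:R) powR_mulrn ?mulr_ge0 ?(ltW r0)//.
by under eq_integral do rewrite powR_mulrn// real_normK ?num_real//.
Qed.

Variable Z : T -> Omega -> R.
Hypotheses (gZ : centered_gaussian_field P Z) (hZ : moment_class gamma K supp P Z).
Variable s : nat -> T.

Let v i := \int[P]_w (Z (s i) w ^+ 2).

Let mZ i : measurable_fun setT (Z (s i)). Proof. exact: hZ.1. Qed.

Let mnZ i : measurable_fun setT (fun w => `|Z (s i) w|).
Proof. exact: measurableT_comp. Qed.

Let vE i : (\int[P]_w (Z (s i) w ^+ 2)%:E)%E = (v i)%:E.
Proof.
have [Z2 _ _] := gZ.
by rewrite /v /Rintegral fineK//; exact: (integrable_fin_num measurableT (Z2 (s i)).2).
Qed.

(** A union bound is possible only over finitely many indices: one representative per cell, taken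
    among the indices of small variance, is treated by Chebyshev at level [u / 2], and the modulus
    controls the distance to it by another [u / 2]. *)
Let small_variance (u eta : R) : 0 < u -> 0 < eta -> exists2 tau : R, 0 < tau &
  fine (P [set w | exists i, v i <= tau /\ u < `|Z (s i) w|]) <= eta.
Proof.
move=> u0 eta0.
have u2 : 0 < u / 2 by lra.
have eta2 : 0 < eta / 2 by lra.
have [delta d0 hd] := modulus u2 eta2.
have [mB PB] := hd _ _ P Z s hZ.
have [n [q hq]] := cells s d0.
pose tau := eta / 2 * (u / 2) ^+ 2 / n.+1%:R.
have tau0 : 0 < tau by rewrite !mulr_gt0// ?invr_gt0 ?ltr0n ?exprn_gt0.
exists tau => //.
have /choice[rep hrep] : forall a : 'I_n, exists j : nat,
    (exists i, q i = a /\ v i <= tau) -> q j = a /\ v j <= tau.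
  move=> a; have [[i hi]|h] := pselect (exists i, q i = a /\ v i <= tau); first by exists i.
  by exists 0%N => /h.
pose A (a : 'I_n) := [set w | v (rep a) <= tau /\ u / 2 <= `|Z (s (rep a)) w|].
have mA a : measurable (A a).
  have [h|h] := boolP (v (rep a) <= tau).
    rewrite (_ : A a = [set w | u / 2 <= `|Z (s (rep a)) w|]); first exact: measurable_ge.
    by apply/seteqP; split=> w /=; [case|].
  rewrite (_ : A a = set0)//; apply/seteqP; split=> w //= -[].
  by rewrite (negbTE h).
have PA a : fine (P (A a)) <= eta / 2 / n.+1%:R.
  have [h|h] := boolP (v (rep a) <= tau); last first.
    rewrite (_ : A a = set0) ?measure0/= ?divr_ge0 ?ltW//.
    by apply/seteqP; split=> w //= -[]; rewrite (negbTE h).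
  rewrite -lee_fin fineK ?fin_num_measure//.
  have hm : mean_le P (fun w => Z (s (rep a)) w ^+ 2) tau.
    split; [exact: measurable_funX|by move=> w; exact: sqr_ge0|].
    by rewrite vE lee_fin.
  apply: (le_trans (@mean_le_markov _ _ _ P _ _ ((u / 2) ^+ 2) _ _ hm (mA a) _)).
  - by rewrite exprn_gt0.
  - move=> w [_ h2]; rewrite -[leRHS](real_normK (num_real _)).
    by rewrite lerXn2r ?nnegrE ?(ltW u2).
  - rewrite lee_fin /tau.
    have : n.+1%:R != 0 :> R by rewrite pnatr_eq0.
    by move: n.+1%:R => m m0; rewrite le_eqVlt; apply/orP; left; apply/eqP; field; rewrite m0 gt_eqF.
set B := [set w | _] in mB PB.
have mU : measurable (\big[setU/set0]_a A a) by apply: bigsetU_measurable => a _.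
apply: (@le_trans _ _ (fine (P (B `|` \big[setU/set0]_a A a)))).
  apply: fine_prob_le; [|exact: measurableU|].
    by apply: measurable_exists => i; exact: measurable_gt.
  move=> w [i [vi ui]]; have [qn hqi] := hq i.
  have [qr vr] : q (rep (Ordinal qn)) = q i /\ v (rep (Ordinal qn)) <= tau.
    by apply: hrep; exists i.
  have [h|h] := leP (u / 2) `|Z (s (rep (Ordinal qn))) w|.
    by right; rewrite (bigD1 (Ordinal qn))//=; left.
  left; exists i, (rep (Ordinal qn)); split; first by apply: hqi.
  have := ler_distD 0 (Z (s i) w) (Z (s (rep (Ordinal qn))) w).
  have := ler_normD (Z (s i) w - Z (s (rep (Ordinal qn))) w) (Z (s (rep (Ordinal qn))) w).
  rewrite subrK; lra.
apply: (le_trans (fine_probU_le _ mB mU)).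
have hB : fine (P B) <= eta / 2 by rewrite -lee_fin fineK ?fin_num_measure.
have hA : fine (P (\big[setU/set0]_a A a)) <= eta / 2.
  apply: (le_trans (fine_prob_bigU_le P mA)).
  apply: (@le_trans _ _ (\sum_(a < n) eta / 2 / n.+1%:R)); first exact: ler_sum.
  rewrite sumr_const card_ord -[_ *+ n]mulr_natl mulrCA ler_piMr ?(ltW eta2)//.
  by rewrite ler_pdivrMr ?ltr0n// mul1r ler_nat.
lra.
Qed.

(** Inside a cell the increments have second moment at most [tau], less than that of each variable,
    so [covariance_ge] applies to any member of the cell taken as representative. An empty cell is
    trivial. *)
Let cell_anticoncentration (Y : T -> Omega -> R) (tau rho : R) : 0 < tau -> 0 < rho ->
  (K 2 * rho) ^+ 2 <= tau -> centered_gaussian_field P Y -> moment_class gamma K supp P Y ->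
  forall (Q : nat -> Prop), (forall i j, Q i -> Q j -> (gamma (s i) (s j) < rho%:E)%E) ->
  (forall i, Q i -> tau < \int[P]_w (Y (s i) w ^+ 2)) ->
  exists2 kappa : R, 0 <= kappa & forall m (alpha beta eps : R),
    alpha < beta -> 0 < eps ->
    fine (P [set w | forall i, (i < m)%N /\ Q i -> Y (s i) w <= beta]) <=
    fine (P [set w | forall i, (i < m)%N /\ Q i -> Y (s i) w <= alpha]) +
    20 * kappa * (beta - alpha) + eps.
Proof.
move=> tau0 rho0 Ktau gY hY Q Qrho Qtau.
have [[i0 Q0]|nQ] := pselect (exists i, Q i); last first.
  exists 0 => // m alpha beta eps ab eps0.
  have E x : [set w | forall i, (i < m)%N /\ Q i -> Y (s i) w <= x] = setT.
    by apply/seteqP; split=> // w _ i [_ Qi]; exfalso; apply: nQ; exists i.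
  by rewrite !E mulr0 mul0r addr0 lerDl ltW.
apply: (@filtered_anticoncentration _ _ _ _ _ Y s Q i0 gY).
  exact: lt_trans (Qtau _ Q0).
move=> i Qi; apply: le_trans (ltW (Qtau _ Qi)); apply: le_trans Ktau.
rewrite -lee_fin /Rintegral fineK; first exact: moment_class_sqr (ltW (Qrho _ _ Qi Q0)).
rewrite ge0_fin_numE; last by apply: integral_ge0 => w _; rewrite lee_fin sqr_ge0.
by apply: (le_lt_trans (moment_class_sqr hY rho0 (ltW (Qrho _ _ Qi Q0)))); rewrite ltry.
Qed.

(* The indices of small variance do not reach [u / 2], by chaining.  The other ones are split
   into finitely many cells, inside which the covariance with a representative is at least
   half the variance of the latter, so that [filtered_anticoncentration] applies. *)
Lemma sup_left_continuous (u eta : R) : 0 < u -> 0 < eta -> exists2 e : R, 0 < e & forall m,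
  fine (P [set w | forall i, (i < m)%N -> `|Z (s i) w| <= u]) <=
  fine (P [set w | forall i, (i < m)%N -> `|Z (s i) w| <= u - e]) + eta.
Proof.
move=> u0 eta0.
have u2 : 0 < u / 2 by lra.
have eta2 : 0 < eta / 2 by lra.
have [tau tau0 small] := small_variance u2 eta2.
(* Makes the increments inside a cell of second moment at most [tau]; the [+ 1] avoids dividing by
   [K 2 = 0]. *)
pose rho := Num.sqrt tau / (K 2 + 1).
have K1 : 0 < K 2 + 1 by rewrite ltr_wpDl.
have rho0 : 0 < rho by rewrite divr_gt0// sqrtr_gt0.
have Ktau : (K 2 * rho) ^+ 2 <= tau.
  have Kr0 : 0 <= K 2 * rho := mulr_ge0 K2_ge0 (ltW rho0).
  rewrite -[leRHS](sqr_sqrtr (ltW tau0)) lerXn2r ?nnegrE ?sqrtr_ge0//.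
  by rewrite /rho mulrCA ler_piMr ?sqrtr_ge0// ler_pdivrMr// mul1r lerDl.
have [n [q hq]] := cells s rho0.
pose Q (a : nat) i := tau < v i /\ q i = a.
have Qrho a i j : Q a i -> Q a j -> (gamma (s i) (s j) < rho%:E)%E.
  by move=> [_ qi] [_ qj]; apply: (hq i).2; rewrite qi qj.
(* The anticoncentration bound is one-sided; the absolute value requires it for [Z] and for
   [- Z]. *)
have gN := centered_gaussian_fieldN gZ.
have hN : moment_class gamma K supp P (fun t w => - Z t w).
  split=> [t|t t' r p r0 tt' p2 sp]; first by apply: measurableT_comp => //; exact: hZ.1.
  by under eq_integral do rewrite -opprD normrN; exact: hZ.2.
have /choice[kp hkp] : forall a : 'I_n, exists kappa : R, 0 <= kappa /\
    forall m (alpha beta eps : R), alpha < beta -> 0 < eps ->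
    fine (P [set w | forall i, (i < m)%N /\ Q a i -> Z (s i) w <= beta]) <=
    fine (P [set w | forall i, (i < m)%N /\ Q a i -> Z (s i) w <= alpha]) +
    20 * kappa * (beta - alpha) + eps.
  move=> a; have [] := @cell_anticoncentration Z tau rho tau0 rho0 Ktau gZ hZ (Q a).
  - exact: Qrho.
  - by move=> i [].
  - by move=> kappa k0 hk; exists kappa.
have /choice[kn hkn] : forall a : 'I_n, exists kappa : R, 0 <= kappa /\
    forall m (alpha beta eps : R), alpha < beta -> 0 < eps ->
    fine (P [set w | forall i, (i < m)%N /\ Q a i -> - Z (s i) w <= beta]) <=
    fine (P [set w | forall i, (i < m)%N /\ Q a i -> - Z (s i) w <= alpha]) +
    20 * kappa * (beta - alpha) + eps.
  move=> a; have [] := @cell_anticoncentration (fun t w => - Z t w) tau rho tau0 rho0 Ktau gN hN (Q a).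
  - exact: Qrho.
  - by move=> i []; under eq_Rintegral do rewrite sqrrN.
  - by move=> kappa k0 hk; exists kappa.
pose kappa := \sum_a (kp a + kn a).
have kappa0 : 0 <= kappa.
  by apply: sumr_ge0 => a _; rewrite addr_ge0//; [exact: (hkp a).1|exact: (hkn a).1].
(* [e <= u / 2] keeps [u - e] above the level that small variances rarely reach; the other term
   gives [20 * kappa * e <= eta / 4]. *)
pose e := Num.min (u / 2) (eta / (80 * (kappa + 1))).
have e0 : 0 < e by rewrite lt_min u2 divr_gt0// mulr_gt0// ltr_wpDl.
have eu : e <= u / 2 by rewrite ge_min lexx.
have ek : 20 * kappa * e <= eta / 4.
  have : e <= eta / (80 * (kappa + 1)) by rewrite ge_min lexx orbT.
  rewrite ler_pdivlMr ?mulr_gt0 ?ltr_wpDl//; nra.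
exists e => // m.
pose eps := eta / (8 * n.+1%:R).
have eps0 : 0 < eps by rewrite divr_gt0// mulr_gt0// ltr0n.
pose Dp (a : 'I_n) := [set w | forall i, (i < m)%N /\ Q a i -> Z (s i) w <= u] `\`
  [set w | forall i, (i < m)%N /\ Q a i -> Z (s i) w <= u - e].
pose Dn (a : 'I_n) := [set w | forall i, (i < m)%N /\ Q a i -> - Z (s i) w <= u] `\`
  [set w | forall i, (i < m)%N /\ Q a i -> - Z (s i) w <= u - e].
have mb x (a : 'I_n) : measurable [set w | forall i, (i < m)%N /\ Q a i -> Z (s i) w <= x].
  by apply: (@measurable_forall _ _ (fun i => (i < m)%N /\ Q a i) (fun i => [set w | Z (s i) w <= x]))
    => i; exact: measurable_le.
have mbn x (a : 'I_n) : measurable [set w | forall i, (i < m)%N /\ Q a i -> - Z (s i) w <= x].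
  apply: (@measurable_forall _ _ (fun i => (i < m)%N /\ Q a i) (fun i => [set w | - Z (s i) w <= x]))
    => i; apply: (@measurable_le _ _ _ (fun w => - Z (s i) w)).
  by apply: measurableT_comp => //; exact: hZ.1.
have mbox x : measurable [set w | forall i, (i < m)%N -> `|Z (s i) w| <= x].
  by apply: (@measurable_forall _ _ (fun i => (i < m)%N) (fun i => [set w | `|Z (s i) w| <= x]))
    => i; exact: measurable_le.
have mDp a : measurable (Dp a) by exact: measurableD.
have mDn a : measurable (Dn a) by exact: measurableD.
have uu : u - e < u by lra.
have uue : u - (u - e) = e by ring.
have PDp a : fine (P (Dp a)) <= 20 * kp a * e + eps.
  apply: fine_probD_le => //; first by move=> w h i hi; apply: le_trans (h i hi) (ltW uu).
  by have := (hkp a).2 m _ _ _ uu eps0; rewrite uue addrA.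
have PDn a : fine (P (Dn a)) <= 20 * kn a * e + eps.
  apply: fine_probD_le => //; first by move=> w h i hi; apply: le_trans (h i hi) (ltW uu).
  by have := (hkn a).2 m _ _ _ uu eps0; rewrite uue addrA.
set Lo := [set w | exists i, _] in small.
have mLo : measurable Lo by apply: measurable_exists => i; exact: measurable_gt.
pose D := \big[setU/set0]_a (Dp a `|` Dn a).
have mD : measurable D by apply: bigsetU_measurable => a _; exact: measurableU.
have PD : fine (P D) <= eta / 2.
  apply: (le_trans (fine_prob_bigU_le P (fun a => measurableU _ _ (mDp a) (mDn a)))).
  apply: (@le_trans _ _ (\sum_a (20 * e * (kp a + kn a) + 2 * eps))).
    apply: ler_sum => a _; apply: (le_trans (fine_probU_le P (mDp a) (mDn a))).
    have := PDp a; have := PDn a; lra.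
  rewrite big_split/= -mulr_sumr sumr_const card_ord -/kappa -[_ *+ n]mulr_natl.
  have : n%:R * (2 * eps) <= eta / 4.
    rewrite /eps.
    have : n%:R <= n.+1%:R :> R by rewrite ler_nat.
    have : 0 < n.+1%:R :> R by rewrite ltr0n.
    move: n.+1%:R n%:R => x y x0 yx.
    rewrite (_ : y * _ = (eta / 4) * (y / x)); last by field; rewrite gt_eqF.
    by rewrite ler_piMr// ?ler_pdivrMr// ?mul1r//; lra.
  move: ek; lra.
pose G := [set w | forall i, (i < m)%N -> `|Z (s i) w| <= u - e].
apply: (@le_trans _ _ (fine (P (G `|` (Lo `|` D))))).
  apply: fine_prob_le => //.
    exact: measurableU (mbox (u - e)) (measurableU _ _ mLo mD).
  (* An index exceeding [u - e] has either small variance, hence [Lo], or a cell, in which its sign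
     decides between [Dp] and [Dn]. *)
  move=> w hw.
  have [h|/existsNP[i /not_implyP[im /negP]]] := pselect (G w); first by left.
  rewrite -ltNge => hi; right.
  have [vi|vi] := leP (v i) tau.
    left; exists i; split=> //; lra.
  right; have [qn _] := hq i; rewrite /D (bigD1 (Ordinal qn))//=; left.
  have Qi : Q (Ordinal qn) i by [].
  have [z0|z0] := leP 0 (Z (s i) w).
    left; split.
      by move=> j [jm _]; apply: le_trans (hw j jm); exact: ler_norm.
    by move=> /(_ i (conj im Qi)); move: hi; rewrite ger0_norm// ltNge => /negP.
  right; split.
    by move=> j [jm _]; apply: le_trans (hw j jm); rewrite -normrN; exact: ler_norm.
  by move=> /(_ i (conj im Qi)); move: hi; rewrite ltr0_norm// ltNge => /negP.
have h1 := fine_probU_le P (mbox (u - e)) (measurableU _ _ mLo mD).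
have h2 := fine_probU_le P mLo mD.
apply: (le_trans h1); move: h2 small PD; rewrite /G; lra.
Qed.

End one_field.

Section weak_limit.
Context dZ (OmegaZ : measurableType dZ) (PZ : probability OmegaZ R).
Context d (Omega : measurableType d) (P : probability Omega R).
Variables (Z : T -> OmegaZ -> R) (Y : nat -> T -> Omega -> R).
Hypotheses (gZ : centered_gaussian_field PZ Z) (hZ : moment_class gamma K supp PZ Z).
Hypotheses (hY : forall n, moment_class gamma K supp P (Y n))
  (Y2 : forall n t, square_integrable P (Y n t))
  (Bd : T -> R) (YB : forall n t, \int[P]_w (Y n t w ^+ 2) <= Bd t)
  (ZB : forall t, \int[PZ]_w (Z t w ^+ 2) <= Bd t).
Hypothesis cf : forall m (t : 'I_m -> T) (a : 'I_m -> R) phi,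
  (fun n => \int[P]_w cos (\sum_i a i * Y n (t i) w + phi)) @ \oo -->
  \int[PZ]_w cos (\sum_i a i * Z (t i) w + phi).
Variable s : nat -> T.

Let G m x := fine (PZ [set w | forall i, (i < m)%N -> `|Z (s i) w| <= x]).
Let H n m x := fine (P [set w | forall i, (i < m)%N -> `|Y n (s i) w| <= x]).

(** Doubling the vector with opposite signs turns a box for absolute values into a one-sided box,
    the form handled by [box_cvg]. *)
Let signed m (V : T -> R) (j : 'I_(m + m)) : R :=
  match fintype.split j with inl i => V (s i) | inr i => - V (s i) end.

Let signed_sum m (a : 'I_(m + m) -> R) V :
  \sum_j a j * signed V j = \sum_(i < m) (a (lshift m i) - a (rshift m i)) * V (s i).
Proof.
rewrite big_split_ord/= -big_split/=; apply: eq_bigr => i _.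
have -> : signed V (lshift m i) = V (s i).
  by rewrite /signed -[lshift m i]/(unsplit (inl i)) unsplitK.
have -> : signed V (rshift m i) = - V (s i).
  by rewrite /signed -[rshift m i]/(unsplit (inr i)) unsplitK.
by rewrite mulrBl mulrN.
Qed.

Let signed_box (O : Type) (V : T -> O -> R) m x :
  [set w | forall j : 'I_(m + m), signed (fun t => V t w) j <= x] =
  [set w | forall i, (i < m)%N -> `|V (s i) w| <= x].
Proof.
apply/seteqP; split=> w /= h.
  move=> i im; rewrite ler_norml.
  have := h (lshift m (Ordinal im)); have := h (rshift m (Ordinal im)).
  rewrite /signed -[lshift m _]/(unsplit (inl _)) -[rshift m _]/(unsplit (inr _)) !unsplitK/=.
  by move=> ? ?; apply/andP; split=> //; lra.
move=> j; rewrite /signed; case: (fintype.split j) => i.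
  by apply: le_trans (h i (ltn_ord i)); exact: ler_norm.
by apply: le_trans (h i (ltn_ord i)); rewrite -normrN; exact: ler_norm.
Qed.

Lemma abs_box_cvg m (x e eps : R) : 0 < e -> 0 < eps -> \forall n \near \oo,
  H n m (x - e) <= G m (x + e) + eps /\ G m (x - e) <= H n m (x + e) + eps.
Proof.
move=> e0 eps0.
have [Z2 _ _] := gZ.
pose B := \sum_(j < m) Bd (s j).
have hB (j : 'I_m) : Bd (s j) <= B.
  rewrite /B (bigD1 j)//= lerDl; apply: sumr_ge0 => i _.
  by apply: le_trans (ZB _); apply: Rintegral_ge0 => w _; exact: sqr_ge0.
have sgn2 d' (O : measurableType d') (Q : probability O R) (V : T -> O -> R) (j : 'I_(m + m)) :
    (forall t, square_integrable Q (V t)) -> square_integrable Q (fun w => signed (fun t => V t w) j).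
  move=> V2; rewrite /signed; case: (fintype.split j) => i //.
  by under eq_fun do rewrite -mulN1r; exact: square_integrableZ.
have sgnB d' (O : measurableType d') (Q : probability O R) (V : T -> O -> R) (j : 'I_(m + m)) :
    (forall t, \int[Q]_w (V t w ^+ 2) <= Bd t) ->
    \int[Q]_w (signed (fun t => V t w) j ^+ 2) <= B.
  move=> V2; rewrite /signed; case: (fintype.split j) => i; last under eq_Rintegral do rewrite sqrrN.
    exact: le_trans (V2 _) (hB i).
  exact: le_trans (V2 _) (hB i).
have := @box_cvg R (m + m) _ _ _ P _ PZ (fun n j w => signed (fun t => Y n t w) j)
  (fun j w => signed (fun t => Z t w) j) x e B eps e0 eps0
  (fun n j => (sgn2 _ _ P (Y n) j (Y2 n)).1) (fun j => (sgn2 _ _ PZ Z j Z2).1)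
  (fun n j => (sgn2 _ _ P (Y n) j (Y2 n)).2) (fun n j => sgnB _ _ P (Y n) j (YB n))
  (fun j => (sgn2 _ _ PZ Z j Z2).2) (fun j => sgnB _ _ PZ Z j ZB).
have hcf (a : 'I_(m + m) -> R) phi :
  (fun n => \int[P]_w cos (\sum_j a j * signed (fun t => Y n t w) j + phi)) @ \oo -->
  \int[PZ]_w cos (\sum_j a j * signed (fun t => Z t w) j + phi).
  have E d' (O : measurableType d') (Q : probability O R) (V : T -> O -> R) :
      \int[Q]_w cos (\sum_j a j * signed (fun t => V t w) j + phi) =
      \int[Q]_w cos (\sum_(i < m) (a (lshift m i) - a (rshift m i)) * V (s i) w + phi).
    by apply: eq_Rintegral => w _; rewrite signed_sum.
  have FE : (fun n => \int[P]_w cos (\sum_j a j * signed (fun t => Y n t w) j + phi)) =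
      (fun n => \int[P]_w cos (\sum_(i < m) (a (lshift m i) - a (rshift m i)) * Y n (s i) w + phi)).
    by apply/funext => n; exact: E.
  have := @cf m (fun i => s i) (fun i => a (lshift m i) - a (rshift m i)) phi.
  by rewrite -FE -E.
move=> /(_ hcf); apply: filterS => n.
by rewrite !signed_box.
Qed.

(** For the upper bound finitely many indices suffice, since dropping indices enlarges the event.
    For the lower bound the modulus, uniform in [n], reduces all indices of [Y n] to [m2] of them,
    with [m2] independent of [n]. *)
Lemma sup_cvg (u : R) : 0 < u ->
  (fun n => fine (P [set w | forall i, `|Y n (s i) w| <= u])) @ \oo -->
  fine (PZ [set w | forall i, `|Z (s i) w| <= u]).
Proof.
move=> u0; apply/cvgrPdist_le => eps eps0.
pose eta := eps / 3; have eta0 : 0 < eta by rewrite divr_gt0.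
have mZ t := hZ.1 t; have mY n t := (hY n).1 t.
have mGZ x m := measurable_abs_box m x (fun i => mZ (s i)).
have mHY n x m := measurable_abs_box m x (fun i => mY n (s i)).
have mGi x := measurable_abs_box_all x (fun i => mZ (s i)).
have mHi n x := measurable_abs_box_all x (fun i => mY n (s i)).
have Gle x m : fine (PZ [set w | forall i, `|Z (s i) w| <= x]) <= G m x.
  by apply: fine_prob_le => // w h i _; exact: h.
have Hle n x m : fine (P [set w | forall i, `|Y n (s i) w| <= x]) <= H n m x.
  by apply: fine_prob_le => // w h i _; exact: h.
(* Upper bound: one [eta] for moving the level of the limit to [u + e1], one for keeping [m1]
   indices, one for the comparison of boxes. *)
have [e1 e10 he1] := abs_box_right_approx PZ u (fun i => mZ (s i)) eta0.
have e12 : 0 < e1 / 2 by lra.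
have [m1 hm1] := abs_box_finite_approx PZ (u + e1) (fun i => mZ (s i)) eta0.
have up := abs_box_cvg m1 (u + e1 / 2) e12 eta0.
have [e2 e20 he2] := sup_left_continuous gZ hZ s u0 eta0.
(* Lower bound: the interval from [u - e2] to [u] is cut in thirds, two for the comparison of boxes
   on either side of [u - 2 * (e2 / 3)] and one for the modulus. *)
have e23 : 0 < e2 / 3 by lra.
have [delta d0 hd] := modulus e23 eta0.
have [nc [q hq]] := cells s d0.
(* Finitely many indices meet every cell that occurs. *)
have [m2 hm2] : exists m2, forall i, exists2 j, (j < m2)%N & q i = q j.
  have /choice[rep hrep] : forall a : 'I_nc, exists j : nat,
      (exists i, q i = a) -> q j = a.
    move=> a; have [[i hi]|h] := pselect (exists i, q i = a); first by exists i.
    by exists 0%N => /h.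
  exists (\max_a rep a).+1 => i; have [qi _] := hq i.
  exists (rep (Ordinal qi)); first by rewrite ltnS leq_bigmax.
  by rewrite hrep//; exists i.
have lo := abs_box_cvg m2 (u - 2 * (e2 / 3)) e23 eta0.
near=> n.
have [u1 _] : H n m1 (u + e1 / 2 - e1 / 2) <= G m1 (u + e1 / 2 + e1 / 2) + eta /\
    G m1 (u + e1 / 2 - e1 / 2) <= H n m1 (u + e1 / 2 + e1 / 2) + eta by near: n.
have [_ l1] : H n m2 (u - 2 * (e2 / 3) - e2 / 3) <= G m2 (u - 2 * (e2 / 3) + e2 / 3) + eta /\
    G m2 (u - 2 * (e2 / 3) - e2 / 3) <= H n m2 (u - 2 * (e2 / 3) + e2 / 3) + eta by near: n.
rewrite ler_norml; apply/andP; split.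
  have := Hle n u m1; move: u1 he1 hm1; rewrite addrK -[u + _ + _]addrA.
  have -> : e1 / 2 + e1 / 2 = e1 by field.
  rewrite /G /H /eta; lra.
have [mB PB] := hd _ _ P (Y n) s (hY n).
set B := [set w | exists i j, _] in mB PB.
have hB : H n m2 (u - e2 / 3) <= fine (P [set w | forall i, `|Y n (s i) w| <= u]) + eta.
  apply: (@le_trans _ _ (fine (P ([set w | forall i, `|Y n (s i) w| <= u] `|` B)))); last first.
    apply: (le_trans (fine_probU_le P (mHi n u) mB)); rewrite lerD2l.
    by rewrite -lee_fin fineK ?fin_num_measure.
  apply: fine_prob_le => //; first exact: measurableU (mHi n u) mB.
  move=> w hw; have [hBw|hBw] := pselect (B w); [by right|left => i].
  have [j jm qij] := hm2 i; have := hw j jm.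
  have : `|Y n (s i) w - Y n (s j) w| <= e2 / 3.
    by rewrite leNgt; apply/negP => h; apply: hBw; exists i, j; split=> //; apply: (hq i).2.
  have := ler_normD (Y n (s i) w - Y n (s j) w) (Y n (s j) w); rewrite subrK; lra.
have := Gle u m2; have := he2 m2; move: l1 hB.
have -> : u - 2 * (e2 / 3) - e2 / 3 = u - e2 by field.
have -> : u - 2 * (e2 / 3) + e2 / 3 = u - e2 / 3 by field.
rewrite /G /H /eta; lra.
Unshelve. all: by end_near. Qed.

End weak_limit.

Section continuity.
Context d (Omega : measurableType d) (P : probability Omega R).
Variables (Z : T -> Omega -> R) (s : nat -> T).
Hypothesis hZ : moment_class gamma K supp P Z.

Let bad e delta := [set w | exists i j, (gamma (s i) (s j) < delta%:E)%E /\
  (e < `|Z (s i) w - Z (s j) w|)%R].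

Let mbad e delta : measurable (bad e delta).
Proof.
have -> : bad e delta = \bigcup_i [set w | exists j,
    (gamma (s i) (s j) < delta%:E)%E /\ e < `|Z (s i) w - Z (s j) w|].
  by apply/seteqP; split=> w; [move=> [i [j h]]; exists i => //; exists j|
    move=> [i _ [j h]]; exists i, j].
apply: bigcup_measurable => i _.
apply: (@measurable_exists _ _ (fun j => (gamma (s i) (s j) < delta%:E)%E : Prop)
  (fun j => [set w | e < `|Z (s i) w - Z (s j) w|])) => j.
apply: measurable_gt; apply: measurableT_comp => //.
by apply: measurable_funB; exact: hZ.1.
Qed.

(** For fixed [e] the exceptional events decrease with [delta] and have arbitrarily small
    probability, so their intersection is null; countably many [e] suffice. *)
Lemma ae_modulus : {ae P, forall w, forall e : R, 0 < e -> exists2 delta : R, 0 < delta &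
  forall i j, (gamma (s i) (s j) < delta%:E)%E -> `|Z (s i) w - Z (s j) w| <= e}.
Proof.
pose A k := \bigcap_l bad k.+1%:R^-1 l.+1%:R^-1.
have mA k : measurable (A k) by apply: bigcapT_measurable.
have inv_small (x : R) : 0 < x -> exists m : nat, m.+1%:R^-1 <= x.
  move=> x0; exists (Num.truncn x^-1); rewrite -[leRHS]invrK lef_pV2 ?posrE ?invr_gt0 ?ltr0n//.
  by apply: ltW; exact: truncnS_gt.
have A0 k : P (A k) = 0%E.
  apply/eqP; rewrite eq_le measure_ge0 andbT; apply/lee_addgt0Pr => eta eta0.
  have k0 : 0 < k.+1%:R^-1 :> R by rewrite invr_gt0 ltr0n.
  have [delta d0 hd] := modulus k0 eta0.
  have [_ PB] := hd _ _ P Z s hZ; rewrite add0e; apply: le_trans PB.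
  have [l hl] := inv_small delta d0.
  apply: le_measure; rewrite ?inE//; first exact: mbad.
  move=> w /(_ l I)[i [j [h1 h2]]]; exists i, j; split=> //.
  by apply: (lt_le_trans h1); rewrite lee_fin.
exists (\bigcup_k A k); split.
- exact: bigcup_measurable.
- apply/eqP; rewrite eq_le measure_ge0 andbT.
  apply: (le_trans (measure_sigma_subadditive _ _ _ _)) => //; first exact: bigcup_measurable.
  by rewrite eseries0// => k _ _; exact: A0.
- move=> w /= /existsNP[e /not_implyP[e0 he]].
  have [k hk] := inv_small e e0.
  exists k => // l _.
  apply: contrapT => hl; apply: he; exists l.+1%:R^-1; first by rewrite invr_gt0 ltr0n.
  move=> i j hij; rewrite leNgt; apply/negP => h; apply: hl; exists i, j; split=> //.
  exact: le_lt_trans h.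
Qed.

(** Separability supplies indices close to [t] and to [t'] both in distance and in value; the
    triangle inequality through them uses three steps of [delta / 3]. *)
Lemma as_continuous_of_modulus :
  {ae P, forall w, forall (t : T) (e : R), 0 < e -> exists i,
     (gamma (s i) t < e%:E)%E /\ `|Z (s i) w - Z t w| < e} ->
  as_continuous_field P gamma Z.
Proof.
move=> sep; apply: filterS2 ae_modulus sep => w md sp t e e0.
have e4 : 0 < e / 4 by lra.
have [delta d0 hd] := md _ e4.
have d3 : 0 < delta / 3 by lra.
exists (delta / 3) => // t' htt'.
pose r := Num.min (delta / 3) (e / 4).
have r0 : 0 < r by rewrite lt_min d3 e4.
have rd : r <= delta / 3 by rewrite ge_min lexx.
have re : r <= e / 4 by rewrite ge_min lexx orbT.
have [i [gi Zi]] := sp t _ r0; have [j [gj Zj]] := sp t' _ r0.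
have : `|Z (s j) w - Z (s i) w| <= e / 4.
  apply: hd; apply: (le_lt_trans (gamma_tri _ t' _)).
  apply: (@le_lt_trans _ _ (gamma (s j) t' + (gamma t' t + gamma t (s i)))%E).
    by apply: leeD => //; exact: gamma_tri.
  have -> : delta%:E = ((delta / 3)%:E + ((delta / 3)%:E + (delta / 3)%:E))%E.
    by rewrite -!EFinD; congr EFin; field.
  apply: lteD; first by apply: (lt_le_trans gj); rewrite lee_fin.
  by apply: lteD; rewrite gamma_sym//; apply: (lt_le_trans gi); rewrite lee_fin.
move: Zi Zj; rewrite !ltr_norml ler_norml => /andP[? ?] /andP[? ?] /andP[? ?].
by apply/andP; split; lra.
Qed.

End continuity.

End supremum.

(** * Completed probabilities and separable suprema *)

Section completion.
Context (R : realType) d (Omega : measurableType d) (P : probability Omega R).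

(** The completed probability is an outer measure, hence monotone on all sets, and [A] lies between
    [B] without [N] and [B] united with [N]. *)
Lemma completed_prob_ae (A B : set Omega) : measurable B ->
  {ae P, forall w, A w <-> B w} -> completed_prob P A = P B.
Proof.
move=> mB [N [mN PN hN]].
have AB w : ~ N w -> (A w <-> B w).
  by move=> Nw; apply: contrapT => h; apply: Nw; apply: hN.
rewrite /completed_prob /completed_measure_extension; apply/eqP; rewrite eq_le; apply/andP; split.
- apply: (@le_trans _ _ (P (B `|` N))).
    rewrite -(measurable_mu_extE P (measurableU _ _ mB mN)); apply: le_mu_ext => w Aw.
    by have [Nw|Nw] := pselect (N w); [right|left; apply/(AB w Nw)].
  by rewrite -[leRHS]adde0 -PN; exact: measureU2.
- apply: (@le_trans _ _ (P (B `\` N))).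
    rewrite -[leRHS]adde0 -PN.
    apply: (le_trans _ (measureU2 P (measurableD mB mN) mN)).
    apply: le_measure; rewrite ?inE//; first exact: measurableU (measurableD mB mN) mN.
    by move=> w Bw; have [Nw|Nw] := pselect (N w); [right|left].
  rewrite -(measurable_mu_extE P (measurableD mB mN)); apply: le_mu_ext => w [Bw Nw].
  exact/(AB w Nw).
Qed.

Lemma countable_enum (T : Type) (t0 : T) (S : set T) : countable S ->
  exists s : nat -> T, forall t, S t -> exists i, s i = t.
Proof.
move=> /countable_injP[f finj].
have /choice[s hs] : forall n, exists t, (exists t', S t' /\ f t' = n) -> S t /\ f t = n.
  move=> n; have [[t ht]|h] := pselect (exists t', S t' /\ f t' = n); first by exists t.
  by exists t0 => /h.
exists s => t St; exists (f t).
have [S1 S2] := hs (f t) (ex_intro _ t (conj St erefl)).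
by apply: finj => //; rewrite inE.
Qed.

(** Exceeding the level strictly is an open condition on a single value, so it passes from an index
    of [T] to a nearby member of the sequence. *)
Lemma sup_event_ae (T : Type) (V : T -> Omega -> R) (s : nat -> T) (u k : R) :
  0 < k -> {ae P, forall w, forall (t : T) (e : R), 0 < e -> exists i, `|V (s i) w - V t w| < e} ->
  {ae P, forall w, ((u%:E < k%:E * ereal_sup (range (fun t => `|V t w|%:E)))%E <->
    ~ (forall i, `|k * V (s i) w| <= u)%R)}.
Proof.
move=> k0; apply: filterS => w sep.
have E : ((u%:E < k%:E * ereal_sup (range (fun t => `|V t w|%:E)))%E <->
    exists t, u / k < `|V t w|).
  rewrite -lte_pdivrMl// -EFinM mulrC; split.
    by move=> /ereal_sup_gt[_ [t _ <-]]; rewrite lte_fin => h; exists t.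
  move=> [t h]; apply: (@lt_le_trans _ _ `|V t w|%:E); first by rewrite lte_fin.
  by apply: ereal_sup_ubound; exists t.
rewrite E; split.
- move=> [t ht] h; have e0 : 0 < `|V t w| - u / k by rewrite subr_gt0.
  have [i hi] := sep t _ e0; have := h i.
  rewrite normrM gtr0_norm// mulrC -ler_pdivlMr// leNgt => /negP; apply.
  have := ler_normD (V t w - V (s i) w) (V (s i) w); rewrite subrK distrC; lra.
- move=> /existsNP[i /negP]; rewrite -ltNge normrM gtr0_norm// mulrC -ltr_pdivrMr// => h.
  by exists (s i).
Qed.

End completion.

(** * The empirical process *)

Section second_moments.
Context (R : realType) d (Omega : measurableType d) (P : probability Omega R).

(** Comparison of moments by truncation at [v^2] instead of Jensen; the resulting factor 2 is
    absorbed later by [12 * sqrt 2 <= 17]. *)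
Lemma second_moment_le (f : Omega -> R) (p v : R) : measurable_fun setT f -> 2 <= p -> 0 < v ->
  (\int[P]_w (`|f w| `^ p)%:E <= (v `^ p)%:E)%E -> (\int[P]_w (f w ^+ 2)%:E <= (2 * v ^+ 2)%:E)%E.
Proof.
move=> mf p2 v0 fv.
have q1 : 1 <= p / 2 by lra.
have v20 : 0 < v ^+ 2 by rewrite exprn_gt0.
have hv : (v ^+ 2) `^ (p / 2) = v `^ p by rewrite sqr_powR_half gtr0_norm.
have [] := @mean_le_max _ _ _ P _ [:: tt] (fun=> fun w => f w ^+ 2) (v ^+ 2) (p / 2) (v ^+ 2) v20 q1.
- by rewrite mul1r.
- by move=> _; exact: measurable_funX.
- move=> _; rewrite hv; under eq_integral do rewrite (ger0_norm (sqr_ge0 _)) sqr_powR_half.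
  exact: fv.
move=> mg _; apply: le_trans; apply: ge0_le_integral => //.
- by move=> w _; rewrite lee_fin sqr_ge0.
- by apply/measurable_EFinP; exact: measurable_funX.
- exact/measurable_EFinP.
- move=> w _; rewrite lee_fin big_seq1 (ger0_norm (sqr_ge0 _)).
  by apply: le_add_powR => //; exact: sqr_ge0.
Qed.

Lemma square_integrable_Rintegral_le (f : Omega -> R) (c : R) : square_integrable P f ->
  (\int[P]_w (f w ^+ 2)%:E <= c%:E)%E -> \int[P]_w (f w ^+ 2) <= c.
Proof.
move=> [mf f2] fc; rewrite -lee_fin /Rintegral fineK//.
exact: (integrable_fin_num measurableT f2).
Qed.

Lemma Rintegral_sqr_sum (I : finType) (F : I -> Omega -> R) : (forall i, square_integrable P (F i)) ->
  \int[P]_w ((\sum_i F i w) ^+ 2) = \sum_i \sum_j \int[P]_w (F i w * F j w).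
Proof.
move=> F2.
have iF i j := square_integrableM (F2 i) (F2 j).
have hF i := Rintegral_sum_fin (index_enum I) (iF i).
have [_ E] := Rintegral_sum_fin (index_enum I) (fun i => (hF i).1).
rewrite -[RHS](eq_bigr _ (fun i _ => (hF i).2)) -E; apply: eq_Rintegral => w _.
by rewrite expr2 mulr_suml; apply: eq_bigr => i _; rewrite mulr_sumr.
Qed.

Lemma Rintegral_sqrB (F G : Omega -> R) : square_integrable P F -> square_integrable P G ->
  \int[P]_w ((F w - G w) ^+ 2) =
  \int[P]_w (F w ^+ 2) - 2 * \int[P]_w (F w * G w) + \int[P]_w (G w ^+ 2).
Proof.
move=> F2 G2.
have E w : (F w - G w) ^+ 2 = (F w ^+ 2 + (-2) * (F w * G w)) + G w ^+ 2 by ring.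
have i1 := integrableZl_fin (-2) (square_integrableM F2 G2).
under eq_Rintegral do rewrite E.
rewrite RintegralD//; [|exact: integrableD_fin F2.2 i1|exact: G2.2].
rewrite RintegralD//; [|exact: F2.2].
by rewrite RintegralZl ?mulNr//; exact: square_integrableM.
Qed.

End second_moments.

Section empirical_process.
Context (R : realType) (dX dO : measure_display) (X : measurableType dX) (nu : probability X R).
Context (Omega : measurableType dO) (P : probability Omega R).
Variables (eta : nat -> {mfun Omega >-> X}) (T : Type) (g : T -> X -> R).
Hypotheses (heta : iid_with_distribution P nu eta) (hg : forall t, g t \in Lfun nu 2%:E).

Notation h := (centered nu g).
Let xi := (fun (t : T) (w : Omega) => h t (eta 0%N w)).
Let psi := moment_function P xi.
Let gamma := gls_distance P psi xi.

Lemma Lfun_square_integrable t : square_integrable nu (g t).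
Proof.
split; last exact: Lfun2_integrable_sqr.
by have := hg t; rewrite inE => /andP[]; rewrite inE.
Qed.

Lemma square_integrable_cst (c : R) : square_integrable nu (fun=> c).
Proof. by split=> //; exact: finite_measure_integrable_cst. Qed.

Lemma centered_square_integrable t : square_integrable nu (h t).
Proof.
by apply: square_integrableD; [exact: Lfun_square_integrable|exact: square_integrable_cst].
Qed.

Lemma centered_mean t : \int[nu]_x h t x = 0.
Proof.
rewrite RintegralB//; last exact: finite_measure_integrable_cst.
  by rewrite Rintegral_cst// [X in fine X](probability_setT nu) mulr1 subrr.
exact: square_integrable1 (Lfun_square_integrable t).
Qed.

Lemma centered_covariance t s :
  \int[nu]_x (h t x * h s x) = \int[nu]_x (g t x * g s x) - mean nu g t * mean nu g s.
Proof.
have gt := Lfun_square_integrable t; have gs := Lfun_square_integrable s.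
have E x : h t x * h s x = (g t x * g s x + (- mean nu g s) * g t x) + (- mean nu g t) * h s x.
  by rewrite /centered; ring.
have i1 := square_integrableM gt gs.
have i2 := integrableZl_fin (- mean nu g s) (square_integrable1 gt).
have i3 := integrableZl_fin (- mean nu g t) (square_integrable1 (centered_square_integrable s)).
under eq_Rintegral do rewrite E.
rewrite RintegralD//; last exact: integrableD_fin.
rewrite RintegralD// !RintegralZl//; last 2 first.
- exact: square_integrable1 (centered_square_integrable s).
- exact: square_integrable1.
by rewrite centered_mean mulr0 addr0 mulNr [mean nu g s * _]mulrC.
Qed.

Lemma sample_measurable t i : measurable_fun setT (fun w => h t (eta i w)).
Proof. by apply: measurableT_comp => //; exact: (centered_square_integrable t).1. Qed.

Lemma gls_distance_moment_law p t s (r : R) : 1 <= p -> (psi p < +oo)%E -> 0 <= r ->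
  (gamma t s <= r%:E)%E ->
  (\int[nu]_x (`|h t x - h s x| `^ p)%:E <= ((fine (psi p) * r) `^ p)%:E)%E.
Proof.
move=> p1 py r0 ts.
have := gls_distance_moment (fun t => sample_measurable t 0) p1 py r0 ts.
rewrite (ge0_integral_iid heta (f := fun x => (`|h t x - h s x| `^ p)%:E) 0)//.
  apply/measurable_EFinP; apply: (measurableT_comp (measurable_powR p)).
  apply: measurableT_comp => //; apply: measurable_funB.
    exact: (centered_square_integrable t).1.
  exact: (centered_square_integrable s).1.
Qed.

Lemma chain_scale_ge0 (p : R) (t : T) : 0 <= chain_scale psi p.
Proof.
rewrite /chain_scale; case: eqP => // _.
rewrite mulr_ge0 ?mulr_ge0 ?sqrtr_ge0// fine_ge0//.
exact: (moment_function_ge0 P xi t).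
Qed.

(* [v] is a common bound for the p-th moments of the increments; it is positive even
   when [psi p = 0]. *)
Lemma chain_scaleP p t s (r : R) : 2 <= p -> (psi p < +oo)%E -> 0 < r -> (gamma t s <= r%:E)%E ->
  exists2 v : R, 0 < v & 17 * Num.sqrt p * v = chain_scale psi p * r /\
    (\int[nu]_x (`|h t x - h s x| `^ p)%:E <= (v `^ p)%:E)%E.
Proof.
move=> p2 py r0 ts.
have s0 : 0 < Num.sqrt p by rewrite sqrtr_gt0; lra.
have p0 : psi p = (fine (psi p))%:E.
  by rewrite fineK// ge0_fin_numE//; exact: (moment_function_ge0 P xi t).
have psi0 : 0 <= fine (psi p) by rewrite fine_ge0//; exact: (moment_function_ge0 P xi t).
have hm := gls_distance_moment_law (le_trans (ler1n _ 2) p2) py (ltW r0) ts.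
exists (chain_scale psi p * r / (17 * Num.sqrt p)).
  rewrite divr_gt0 ?mulr_gt0// /chain_scale; case: eqP => // pn0.
  rewrite mulr_gt0 ?mulr_gt0// lt_neqAle psi0 andbT; apply/eqP => h0.
  by apply: pn0; rewrite p0 -h0.
split; first by field; rewrite gt_eqF.
apply: (le_trans hm); rewrite lee_fin ge0_ler_powR ?nnegrE//; first lra.
- by rewrite mulr_ge0// ltW.
- by rewrite divr_ge0 ?mulr_ge0 ?(chain_scale_ge0 p t) ?(ltW r0) ?(ltW s0).
rewrite /chain_scale; case: eqP => [->|_].
  by rewrite /= mul0r mul1r divr_ge0 ?mulr_ge0 ?(ltW r0) ?(ltW s0).
rewrite le_eqVlt; apply/orP; left; apply/eqP; field; by rewrite gt_eqF.
Qed.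

(** At [n = 0] it is 0, so the uniform bounds below hold for every [n]. *)
Definition normalized_sum (n : nat) (t : T) (w : Omega) : R :=
  (\sum_(1 <= i < n.+1) h t (eta i w)) / Num.sqrt n%:R.

Lemma normalized_sum_measurable n t : measurable_fun setT (normalized_sum n t).
Proof.
by apply: measurable_funM => //; apply: measurable_sum => i; exact: sample_measurable.
Qed.

Lemma iid_normalized_moment (f : X -> R) (p : R) n : 2 <= p -> measurable_fun setT f ->
  nu.-integrable setT (fun x => (`|f x| `^ p)%:E) -> \int[nu]_x f x = 0 ->
  (\int[P]_w (`|(\sum_(1 <= i < n.+1) f (eta i w)) / Num.sqrt n%:R| `^ p)%:E <=
   ((5 * p) `^ (p / 2))%:E * \int[nu]_x (`|f x| `^ p)%:E)%E.
Proof.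
move=> p2 mf fp f0.
have I0 : (0 <= \int[nu]_x (`|f x| `^ p)%:E)%E.
  by apply: integral_ge0 => x _; rewrite lee_fin powR_ge0.
have p0 : 0 < p by lra.
have [->|n0] := eqVneq n 0%N.
  under eq_integral do rewrite big_nil mul0r normr0 powR0 ?gt_eqF//.
  by rewrite integral0 mule_ge0// lee_fin powR_ge0.
have nR : 0 < n%:R :> R by rewrite ltr0n lt0n.
have sn : 0 < Num.sqrt n%:R :> R by rewrite sqrtr_gt0.
pose k : R := n%:R `^ (p / 2).
have k0 : 0 < k by rewrite powR_gt0.
have E w : `|(\sum_(1 <= i < n.+1) f (eta i w)) / Num.sqrt n%:R| `^ p =
    k^-1 * `|\sum_(1 <= i < n.+1) f (eta i w)| `^ p.
  rewrite normrM powRM// mulrC; congr (_ * _).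
  rewrite normfV gtr0_norm// /k -{2}(sqr_sqrtr (ltW nR)) sqr_powR_half gtr0_norm//.
  by rewrite -(powR_inv1 (ltW sn)) -powRrM mulN1r powRN.
under eq_integral do rewrite E EFinM.
rewrite ge0_integralZl//; last 2 first.
- apply/measurable_EFinP; apply: (measurableT_comp (measurable_powR p)).
  by apply: measurableT_comp => //; apply: measurable_sum => i; exact: measurableT_comp.
- by rewrite lee_fin invr_ge0 ltW.
rewrite lee_pdivrMl// muleA -EFinM.
apply: (le_trans (iid_sum_moment heta n p2 mf fp f0)).
have p5 : 0 <= 5 * p by rewrite mulr_ge0// ltW.
by rewrite [5 * p * _]mulrC (powRM _ (ler0n _ n) p5).
Qed.

Lemma normalized_sumB n t s w : normalized_sum n t w - normalized_sum n s w =
  (\sum_(1 <= i < n.+1) (h t (eta i w) - h s (eta i w))) / Num.sqrt n%:R.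
Proof. by rewrite /normalized_sum -mulrBl -sumrB. Qed.

Lemma centeredB_mean t s : \int[nu]_x (h t x - h s x) = 0.
Proof.
rewrite RintegralB// ?centered_mean ?subrr//.
  exact: square_integrable1 (centered_square_integrable t).
exact: square_integrable1 (centered_square_integrable s).
Qed.

Lemma centeredB_square_integrable t s : square_integrable nu (fun x => h t x - h s x).
Proof.
under eq_fun do rewrite -mulN1r; apply: square_integrableD; first exact: centered_square_integrable.
by apply: square_integrableZ; exact: centered_square_integrable.
Qed.

Lemma normalized_sum_class n :
  moment_class gamma (chain_scale psi) (fun p => (psi p < +oo)%E) P (normalized_sum n).
Proof.
split; first exact: normalized_sum_measurable.
move=> t s r p r0 ts p2 py.
have [v v0 [vE hv]] := chain_scaleP p2 py r0 ts.
have mh := (centeredB_square_integrable t s).1.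
have p0 : 0 < p by lra.
under eq_integral do rewrite normalized_sumB.
apply: (le_trans (iid_normalized_moment n p2 mh _ (centeredB_mean t s))).
  apply/integrableP; split.
    apply/measurable_EFinP; apply: (measurableT_comp (measurable_powR p)).
    exact: measurableT_comp.
  under eq_integral do rewrite /= ger0_norm ?powR_ge0//.
  by apply: (le_lt_trans hv); rewrite ltry.
apply: (@le_trans _ _ (((5 * p) `^ (p / 2))%:E * (v `^ p)%:E)%E).
  by rewrite lee_wpmul2l// lee_fin powR_ge0.
have s0 : 0 <= Num.sqrt p by exact: sqrtr_ge0.
rewrite -EFinM lee_fin -vE [X in _ <= X]powRM ?mulr_ge0 ?(ltW v0)//.
rewrite ler_wpM2r ?powR_ge0//.
(* Only [5 <= 17^2] is needed here; the value 17 is dictated by the Gaussian field. *)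
have -> : (17 * Num.sqrt p) `^ p = (17 ^+ 2 * p) `^ (p / 2).
  by rewrite -{3}(sqr_sqrtr (ltW p0)) -exprMn sqr_powR_half ger0_norm// mulr_ge0.
by rewrite ge0_ler_powR ?nnegrE ?mulr_ge0 ?divr_ge0 ?(ltW p0)// ler_pM2r//; lra.
Qed.

Lemma normalized_sum_square_integrable n t : square_integrable P (normalized_sum n t).
Proof.
rewrite /normalized_sum; under eq_fun do rewrite mulrC.
apply: square_integrableZ; apply: square_integrable_sum => i; split.
  exact: sample_measurable.
exact: (integrable_iid heta i (centered_square_integrable t).2).
Qed.

(** The moment inequality at [p = 2], where [5 * 2 = 10]; what counts is uniformity in [n]. *)
Lemma normalized_sum_second_moment n t :
  \int[P]_w (normalized_sum n t w ^+ 2) <= 10 * \int[nu]_x (h t x ^+ 2).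
Proof.
have [mh h2] := centered_square_integrable t.
have E x : `|x| `^ 2 = x ^+ 2 :> R by rewrite powR_mulrn// real_normK// num_real.
have h2' : nu.-integrable setT (fun x => (`|h t x| `^ 2)%:E).
  by apply: eq_integrable h2 => // x _; rewrite /= E.
apply: square_integrable_Rintegral_le; first exact: normalized_sum_square_integrable.
have := iid_normalized_moment n (lexx 2) mh h2' (centered_mean t).
under eq_integral do rewrite E.
under [X in (_ <= _ * X)%E -> _]eq_integral do rewrite E.
rewrite divff// powRr1 ?mulr_ge0//.
have -> : (\int[nu]_x (h t x ^+ 2)%:E = (\int[nu]_x (h t x ^+ 2))%:E)%E.
  by rewrite /Rintegral fineK//; exact: (integrable_fin_num measurableT h2).
by rewrite -EFinM -natrM.
Qed.

(** A linear combination of normalized sums is the normalized sum of the single function [H], so the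
    one-dimensional limit theorem suffices. *)
Lemma normalized_sum_cos m (t : 'I_m -> T) (a : 'I_m -> R) phi :
  (fun n => \int[P]_w cos (\sum_i a i * normalized_sum n (t i) w + phi)) @ \oo -->
  cos phi * expR (- ((\sum_i \sum_j a i * a j * \int[nu]_x (h (t i) x * h (t j) x)) / 2)).
Proof.
pose H x := \sum_i a i * h (t i) x.
have H2i i : square_integrable nu (fun x => a i * h (t i) x).
  by apply: square_integrableZ; exact: centered_square_integrable.
have H2 : square_integrable nu H by exact: square_integrable_sum.
have H0 : \int[nu]_x H x = 0.
  have [_ ->] := Rintegral_sum_fin (index_enum 'I_m) (fun i => square_integrable1 (H2i i)).
  rewrite big1// => i _; rewrite RintegralZl ?centered_mean ?mulr0//.
  exact: square_integrable1 (centered_square_integrable _).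
have HH : \int[nu]_x (H x ^+ 2) = \sum_i \sum_j a i * a j * \int[nu]_x (h (t i) x * h (t j) x).
  rewrite Rintegral_sqr_sum//; apply: eq_bigr => i _; apply: eq_bigr => j _.
  rewrite -RintegralZl//; first by apply: eq_Rintegral => x _; rewrite mulrACA.
  by apply: square_integrableM; exact: centered_square_integrable.
have := clt_cos_shift heta (phi := phi) H2.1 H2.2 H0; rewrite HH.
have -> : (fun n => \int[P]_w cos (\sum_i a i * normalized_sum n (t i) w + phi)) =
  (fun n => \int[P]_w cos ((\sum_(1 <= i < n.+1) H (eta i w)) / Num.sqrt n%:R + phi)) => //.
apply/funext => n; apply: eq_Rintegral => w _; congr (cos (_ + _)).
rewrite /H exchange_big/= mulr_suml; apply: eq_bigr => i _.
by rewrite /normalized_sum -mulr_sumr mulrA.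
Qed.

Section gaussian_limit.
Context (dZ : measure_display) (OmegaZ : measurableType dZ) (PZ : probability OmegaZ R) (Z : T -> OmegaZ -> R).
Hypotheses (hZ_gauss : gaussian_field PZ Z) (hZ_centered : forall t, ('E_PZ[Z t] = 0)%E)
  (hZ_cov : forall t s, ('E_PZ[(fun w => (Z t w * Z s w)%R)] =
    ((\int[nu]_x (g t x * g s x)) - mean nu g t * mean nu g s)%R%:E)%E).

Let Z_measurable t : measurable_fun setT (Z t).
Proof.
have [mY _] := hZ_gauss (fun=> t : T) (fun _ : 'I_1 => 1).
by move: mY; under eq_fun do rewrite big_ord1 mul1r.
Qed.

Let covE t s : (\int[PZ]_w (Z t w * Z s w)%:E = (\int[nu]_x (h t x * h s x))%:E)%E.
Proof. by rewrite centered_covariance -hZ_cov unlock. Qed.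

Let Z_square_integrable t : square_integrable PZ (Z t).
Proof.
split=> //; apply/integrableP; split.
  by apply/measurable_EFinP; exact: measurable_funX.
under eq_integral do rewrite /= ger0_norm ?sqr_ge0// expr2.
by rewrite covE ltry.
Qed.

Lemma gaussian_limit_centered : centered_gaussian_field PZ Z.
Proof.
by split=> // t; have := hZ_centered t; rewrite unlock /Rintegral => ->.
Qed.

Lemma gaussian_limit_covariance t s : \int[PZ]_w (Z t w * Z s w) = \int[nu]_x (h t x * h s x).
Proof. by rewrite [LHS]/Rintegral covE. Qed.

(** Equal covariances give the increments of [Z] the second moments of [h t - h s], which
    [second_moment_le] bounds through the [p]-th moment; [gaussian_moment] then returns to order
    [p]. *)
Lemma gaussian_limit_class :
  moment_class gamma (chain_scale psi) (fun p => (psi p < +oo)%E) PZ Z.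
Proof.
split=> // t s r p r0 ts p2 py.
have [v v0 [vE hv]] := chain_scaleP p2 py r0 ts.
have p0 : 0 < p by lra.
have [Z2 Z0 _] := gaussian_limit_centered.
have gY : gaussian_variable PZ (fun w => Z t w - Z s w).
  have := @gaussian_fieldS _ _ _ _ PZ Z 1 (fun=> t) s (fun=> 1) (-1) hZ_gauss.
  by under eq_fun do rewrite big_ord1 mul1r mulN1r.
have Y2 : square_integrable PZ (fun w => Z t w - Z s w).
  under eq_fun do rewrite -mulN1r; apply: square_integrableD => //.
  exact: square_integrableZ.
have Y0 : \int[PZ]_w (Z t w - Z s w) = 0.
  by rewrite RintegralB// ?Z0 ?subrr//; exact: square_integrable1.
have hs2 := centered_square_integrable.
have EV : \int[PZ]_w ((Z t w - Z s w) ^+ 2) = \int[nu]_x ((h t x - h s x) ^+ 2).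
  rewrite (Rintegral_sqrB (Z2 t) (Z2 s)) (Rintegral_sqrB (hs2 t) (hs2 s)).
  have E u : \int[PZ]_w (Z u w ^+ 2) = \int[nu]_x (h u x ^+ 2).
    exact: gaussian_limit_covariance.
  by rewrite !E gaussian_limit_covariance.
pose v2 := Num.sqrt 2 * v.
have v20 : 0 < v2 by rewrite mulr_gt0// sqrtr_gt0.
have hV : \int[PZ]_w ((Z t w - Z s w) ^+ 2) <= v2 ^+ 2.
  rewrite EV /v2 exprMn sqr_sqrtr//; apply: square_integrable_Rintegral_le.
    exact: centeredB_square_integrable.
  exact: second_moment_le (centeredB_square_integrable t s).1 p2 v0 hv.
apply: (le_trans (gaussian_moment gY Y2.2 Y0 p2 v20 hV)).
rewrite lee_fin -vE ge0_ler_powR ?nnegrE ?mulr_ge0 ?sqrtr_ge0 ?(ltW v0) ?(ltW v20) ?(ltW p0)//.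
have s2 : 12 * Num.sqrt 2 <= 17 :> R.
  have h1 : Num.sqrt 2 ^+ 2 = 2 :> R by rewrite sqr_sqrtr.
  have h2 : 0 <= Num.sqrt 2 :> R by exact: sqrtr_ge0.
  nra.
have : 0 <= Num.sqrt p * v by rewrite mulr_ge0 ?sqrtr_ge0// ltW.
rewrite /v2; nra.
Qed.

Lemma gaussian_limit_cos m (t : 'I_m -> T) (a : 'I_m -> R) phi :
  \int[PZ]_w cos (\sum_i a i * Z (t i) w + phi) =
  cos phi * expR (- ((\sum_i \sum_j a i * a j * \int[nu]_x (h (t i) x * h (t j) x)) / 2)).
Proof.
have [Z2 Z0 _] := gaussian_limit_centered.
have S2i i : square_integrable PZ (fun w => a i * Z (t i) w) by exact: square_integrableZ.
have S2 := square_integrable_sum (index_enum 'I_m) S2i.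
have S0 : \int[PZ]_w (\sum_i a i * Z (t i) w) = 0.
  have [_ ->] := Rintegral_sum_fin (index_enum 'I_m) (fun i => square_integrable1 (S2i i)).
  by rewrite big1// => i _; rewrite RintegralZl ?Z0 ?mulr0//; exact: square_integrable1.
rewrite (gaussian_cos_shift (hZ_gauss t a) S2.2 S0); congr (_ * expR (- (_ / 2))).
rewrite Rintegral_sqr_sum//; apply: eq_bigr => i _; apply: eq_bigr => j _.
rewrite -gaussian_limit_covariance -RintegralZl//; last exact: square_integrableM.
by apply: eq_Rintegral => x _; rewrite mulrACA.
Qed.

End gaussian_limit.
End empirical_process.

Lemma normalized_sumE (R : realType) (dX dO : measure_display) (X : measurableType dX)
    (nu : probability X R) (Omega : measurableType dO) (eta : nat -> {mfun Omega >-> X})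
    (T : Type) (g : T -> X -> R) n t w : (0 < n)%N ->
  Num.sqrt n%:R * (sample_mean eta g n t w - mean nu g t) = normalized_sum nu eta g n t w.
Proof.
move=> n0; have nR : 0 < n%:R :> R by rewrite ltr0n.
have sn : 0 < Num.sqrt n%:R :> R by rewrite sqrtr_gt0.
rewrite /normalized_sum /sample_mean sumrB big_const_nat iter_addr addr0 subn1/=.
rewrite -(mulr_natr (mean nu g t)).
have E (q N S m : R) : q != 0 -> N = q ^+ 2 -> q * (N^-1 * S - m) = (S - m * N) / q.
  by move=> q0 ->; field.
by apply: E; [rewrite gt_eqF|rewrite sqr_sqrtr// ltW].
Qed.

Lemma completed_prob_exceed (R : realType) (d : measure_display) (Omega : measurableType d)
    (P : probability Omega R) (T : Type) (V : T -> Omega -> R) (s : nat -> T) (u k : R)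
    (A : set Omega) :
  0 < k -> (forall t, measurable_fun setT (V t)) ->
  {ae P, forall w, forall (t : T) (e : R), 0 < e -> exists i, `|V (s i) w - V t w| < e} ->
  (forall w, A w <-> (u%:E < k%:E * ereal_sup (range (fun t => `|V t w|%:E)))%E) ->
  completed_prob P A = (1 - fine (P [set w | forall i, `|k * V (s i) w| <= u]))%:E.
Proof.
move=> k0 mV sep AE.
have mB : measurable [set w | forall i, `|k * V (s i) w| <= u].
  by apply: (measurable_abs_box_all u (V := fun i w => k * V (s i) w)) => i; exact: measurable_funM.
rewrite (@completed_prob_ae _ _ _ P A (~` [set w | forall i, `|k * V (s i) w| <= u])).
- by rewrite probability_setC// -(fineK (fin_num_measure P _ mB)) EFinB.
- exact: measurableC.
- by apply: filterS (sup_event_ae u k0 sep) => w h; rewrite AE; exact: h.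
Qed.

(** One sequence has to serve every sample size and the limit, because [sup_cvg] compares them along
    the same indices. *)
Lemma countable_separant (T : Type) (t0 : T) (S : nat -> set T) (S' : set T) :
  (forall n, countable (S n)) -> countable S' ->
  exists s : nat -> T, (forall n t, S n t -> exists i, s i = t) /\
    (forall t, S' t -> exists i, s i = t).
Proof.
move=> cS cS'.
pose U n := if n is n'.+1 then S n' else S'.
have cU : countable (\bigcup_n U n) by apply: bigcup_countable => // -[|n] _; [exact: cS'|exact: cS].
have [s hs] := countable_enum t0 cU; exists s; split.
  by move=> n t St; apply: hs; exists n.+1.
by move=> t St; apply: hs; exists 0%N.
Qed.

Local Open Scope ereal_scope.

Theorem theorem4p2 (R : realType)
  (dX dT dO dZ : measure_display)
  (X : measurableType dX) (nu : probability X R)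
  (T : measurableType dT) (mu : probability T R)
  (g : T -> X -> R)
  (hg : forall t : T, g t \in Lfun nu 2%:E)
  (hQ : {ae nu, forall x, ess_sup mu (fun t => `|g t x|%:E) \is a fin_num})
  (Omega : measurableType dO) (P : probability Omega R)
  (eta : nat -> {mfun Omega >-> X})
  (heta : iid_with_distribution P nu eta)
  (OmegaZ : measurableType dZ) (PZ : probability OmegaZ R)
  (Z : T -> OmegaZ -> R)
  (hZ_gauss : gaussian_field PZ Z)
  (hZ_centered : forall t : T, 'E_PZ[Z t] = 0)
  (hZ_cov : forall t s : T,
    'E_PZ[(fun w => (Z t w * Z s w)%R)] =
    ((\int[nu]_x (g t x * g s x))%R - mean nu g t * mean nu g s)%R%:E)
  (C0 : R)
  (hC0 : (177 / 10 ^+ 2 + 638 / 10 ^+ 5 <= C0 < 177 / 10 ^+ 2 + 639 / 10 ^+ 5)%R)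
  (b : \bar R) (hb : 2%:E <= b) :
  let xi := (fun (t : T) (w : Omega) => centered nu g t (eta 0%N w)) in
  let psi := moment_function P xi in
  let gamma := gls_distance P psi xi in
  (forall n : nat, (0 < n)%N ->
    separable_field P gamma
      (fun t w => (sample_mean eta g n t w - mean nu g t)%R)) ->
  separable_field PZ gamma Z ->
  (forall p : R, (2 <= p)%R -> p%:E <= b -> psi p < +oo) ->
  \int[lebesgue_measure]_(eps in `[0%R, 1%R])
     expeR (v_star (psi_bar C0 psi) (metric_entropy gamma eps)) < +oo ->
  as_continuous_field PZ gamma Z /\
  forall u : R, (0 < u)%R ->
    (fun n : nat => completed_prob P
       [set w | u%:E < (Num.sqrt n%:R)%:E *
          ereal_sup (range (fun t : T =>
            `|sample_mean eta g n t w - mean nu g t|%:E))])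
    @ \oo -->
    completed_prob PZ
      [set w | u%:E < ereal_sup (range (fun t : T => `|Z t w|%:E))].
Proof.
move=> xi psi gamma hsepn hsepZ hfin hint.
(* [T] is inhabited because it carries a probability. *)
have [t0 _] : exists t : T, True.
  apply: contrapT => nT; have := probability_setT mu.
  rewrite (_ : [set: T] = set0) ?measure0; first by move=> [] /eqP; rewrite eq_sym oner_eq0.
  by apply/seteqP; split=> t // _; apply: nT; exists t.
have mxi t : measurable_fun setT (xi t) := sample_measurable eta hg t 0.
have psi0 p : 0 <= psi p := moment_function_ge0 P xi t0 p.
have gamma0 p : (2 <= p)%R -> psi p = 0 -> forall t s, gamma t s <= 0.
  by move=> p2 p0 t s; apply: (gls_distance_le0 mxi t s _ p0); lra.
have C00 : (0 < C0)%R.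
  have /andP[h _] := hC0; apply: lt_le_trans h.
  have p10 (k : nat) : (0 < 10 ^+ k :> R)%R by apply: exprn_gt0; rewrite ltr0n.
  by apply: addr_gt0; (apply: divr_gt0; last exact: p10); rewrite ltr0n.
have [N [c [p [L [net [L0 Lsum] p2 suppp ent]]]]] := entropy_nets t0 C00 psi0 gamma0 hint.
have psi2 : psi 2%R < +oo by exact: hfin.
have K20 : (0 <= chain_scale psi 2)%R by exact: (chain_scale_ge0 nu P eta g 2 t0).
have gsym : forall t s, gamma t s = gamma s t := gls_distance_sym P xi.
have gtri : forall t s r, gamma t r <= gamma t s + gamma s r := gls_distance_triangle P mxi.
have modulus := chaining_modulus (supp := fun p => psi p < +oo) K20 psi2 net L0 Lsum p2 suppp ent.
have gZ := gaussian_limit_centered hg hZ_gauss hZ_centered hZ_cov.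
have hZ := gaussian_limit_class heta hg hZ_gauss hZ_centered hZ_cov.
(* Separability is assumed for positive sample sizes, hence the index [n.+1]. *)
have /choice[S hS] : forall n, exists S : set T, countable S /\
    {ae P, forall w, forall (t : T) (e : R), (0 < e)%R -> exists s : T,
      [/\ S s, gamma t s < e%:E &
        (`|(sample_mean eta g n.+1 s w - mean nu g s) -
          (sample_mean eta g n.+1 t w - mean nu g t)| < e)%R]}.
  by move=> n; exact: hsepn.
have [SZ [cSZ hSZ]] := hsepZ.
have [s [hs hsZ]] := countable_separant t0 (fun n => (hS n).1) cSZ.
have sepZ : {ae PZ, forall w, forall (t : T) (e : R), (0 < e)%R -> exists i,
    gamma (s i) t < e%:E /\ (`|Z (s i) w - Z t w| < e)%R}.
  apply: filterS hSZ => w h t e e0; have [t' [St' gt' Zt']] := h t e e0.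
  by have [i si] := hsZ t' St'; exists i; rewrite si gsym.
split; first exact: (as_continuous_of_modulus gsym gtri modulus hZ sepZ).
move=> u u0.
have YB n t : (\int[P]_w (normalized_sum nu eta g n t w ^+ 2) <=
    10 * \int[nu]_x (centered nu g t x ^+ 2))%R.
  exact: normalized_sum_second_moment.
have ZB t : (\int[PZ]_w (Z t w ^+ 2) <= 10 * \int[nu]_x (centered nu g t x ^+ 2))%R.
  have -> : (\int[PZ]_w (Z t w ^+ 2) = \int[nu]_x (centered nu g t x ^+ 2))%R.
    exact: (gaussian_limit_covariance hg hZ_cov t t).
  by rewrite ler_peMl ?ler1n//; apply: Rintegral_ge0 => x _; exact: sqr_ge0.
have cf m (t : 'I_m -> T) (a : 'I_m -> R) (phi : R) :
    (fun n => \int[P]_w cos (\sum_i a i * normalized_sum nu eta g n (t i) w + phi))%R @ \oo -->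
    (\int[PZ]_w cos (\sum_i a i * Z (t i) w + phi))%R.
  rewrite (gaussian_limit_cos hg hZ_gauss hZ_centered hZ_cov).
  exact: normalized_sum_cos.
have hlim := sup_cvg (s := s) K20 psi2 gsym gtri net modulus gZ hZ
  (normalized_sum_class heta hg) (normalized_sum_square_integrable heta hg) YB ZB cf u0.
have Zlim : completed_prob PZ [set w | u%:E < ereal_sup (range (fun t : T => `|Z t w|%:E))] =
    (1 - fine (PZ [set w | forall i, `|Z (s i) w| <= u]))%R%:E.
  rewrite (@completed_prob_exceed R _ _ PZ T Z s u 1)//.
  - by under eq_set do under eq_forall do rewrite mul1r.
  - exact: hZ.1.
  - by apply: filterS sepZ => w h t e e0; have [i [_ hi]] := h t e e0; exists i.
  - by move=> w; rewrite mul1e.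
have Ylim n : completed_prob P [set w | u%:E < (Num.sqrt n.+1%:R)%:E *
          ereal_sup (range (fun t : T => `|sample_mean eta g n.+1 t w - mean nu g t|%:E))] =
    (1 - fine (P [set w | forall i, `|normalized_sum nu eta g n.+1 (s i) w| <= u]))%R%:E.
  have sn : (0 < Num.sqrt n.+1%:R :> R)%R by rewrite sqrtr_gt0 ltr0n.
  pose V t w := (sample_mean eta g n.+1 t w - mean nu g t)%R.
  rewrite (@completed_prob_exceed R _ _ P T V s u (Num.sqrt n.+1%:R))//.
  - by under eq_set do under eq_forall do rewrite normalized_sumE//.
  - move=> t; apply: measurable_funB => //; apply: measurable_funM => //.
    apply: measurable_sum => i; apply: measurableT_comp => //.
    exact: (Lfun_square_integrable hg t).1.
  - apply: filterS (hS n).2 => w h t e e0; have [t' [St' _ Vt']] := h t e e0.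
    by have [i si] := hs n t' St'; exists i; rewrite si.
(* The term of index 0, outside the scope of [Ylim], is dropped; the limit does not change. *)
rewrite Zlim -(cvg_shiftS _) /=.
under eq_fun do rewrite Ylim.
apply: cvg_EFin; first exact: nearW.
apply: cvgB; first exact: cvg_cst.
by move: hlim; rewrite -cvg_shiftS.
Qed.
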